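(* Let $d\ge 1$, $a>0$, $R>0$, and let $h\in (L^1\cap L^2)(\mathbb{R}^d)$ be real-valued. Then $$\mathrm{Var}\big(N(h,R)\big)=R^d\sum_{m\in\mathbb{Z}^d}\left\{\int_{\mathbb{R}^d}\widehat h(\lambda)\,\widehat h(Rm-\lambda)\Big(e^{-a\pi^2|m|^2}-e^{-a\pi^2|\lambda|^2/R^2}\,e^{-a\pi^2|Rm-\lambda|^2/R^2}\Big)\,dm_d(\lambda)\right\}.$$
   Context: $m_d$ is Lebesgue measure on $\mathbb{R}^d$, and $|\cdot|$, $\langle\cdot,\cdot\rangle$ are the Euclidean norm and inner product. For a fixed $a>0$, $\{\xi_n\}_{n\in\mathbb{Z}^d}$ are independent identically distributed random vectors in $\mathbb{R}^d$ with density $\phi_a(x)=(a\pi)^{-d/2}e^{-|x|^2/a}$ with respect to $m_d$. The point process is $W=\{n+\xi_n: n\in\mathbb{Z}^d\}$, and its linear statistic with test function $h$ and scale $R>0$ is the random variable $N(h,R)=\sum_{w\in W}h(w/R)=\sum_{n\in\mathbb{Z}^d}h\big((n+\xi_n)/R\big)$. The distribution of $N(h,R)$ does not depend on the choice of representative of $h$. The variance is $\mathrm{Var}(X)=\mathbb{E}[(X-\mathbb{E}X)^2]$. The Fourier transform is $\widehat f(\lambda)=\int_{\mathbb{R}^d}f(x)e^{-2\pi i\langle x,\lambda\rangle}\,dm_d(x)$. *)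

(* Defs.v *)
From HB Require Import structures.
From mathcomp Require Import all_boot all_order all_algebra.
From mathcomp Require Import finmap complex.
From mathcomp Require Import all_classical all_reals all_analysis.

Set Implicit Arguments.
Unset Strict Implicit.
Unset Printing Implicit Defensive.

Import Order.TTheory GRing.Theory Num.Theory.
Import numFieldNormedType.Exports.

Local Open Scope classical_set_scope.
Local Open Scope ring_scope.
Local Open Scope complex_scope.

(* R^d is d.-tuple R with the library's product sigma-algebra (the Borel sets);
   Z^d is d.-tuple int. *)

Section euclidean.
Context (R : realType) (d : nat).
Implicit Types x y : d.-tuple R.

Definition addv x y : d.-tuple R := [tuple tnth x i + tnth y i | i < d].
Definition subv x y : d.-tuple R := [tuple tnth x i - tnth y i | i < d].
Definition scalev (c : R) x : d.-tuple R := [tuple c * tnth x i | i < d].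
Definition dotv x y : R := \sum_(i < d) tnth x i * tnth y i.
Definition enorm x : R := Num.sqrt (dotv x x).
Definition intv (m : d.-tuple int) : d.-tuple R :=
  [tuple (tnth m i)%:~R | i < d].

End euclidean.

Section lebesgue_succ.
Context (R : realType) (n : nat).
Variable mu : {sigma_finite_measure set (n.-tuple R) -> \bar R}.

Definition cons_pair (p : R * n.-tuple R) : n.+1.-tuple R :=
  [tuple of p.1 :: p.2].

Lemma measurable_cons_pair : measurable_fun [set: R * n.-tuple R] cons_pair.
Proof.
by apply: measurable_cons; [exact: measurable_fst|exact: measurable_snd].
Qed.

Definition lebesgue_succ : set (n.+1.-tuple R) -> \bar R :=
  pushforward (lebesgue_measure \x mu)%E cons_pair.

Let lebesgue_succ0 : lebesgue_succ set0 = 0%E.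
Proof. by rewrite /lebesgue_succ /pushforward preimage_set0 measure0. Qed.

Let lebesgue_succ_ge0 A : (0 <= lebesgue_succ A)%E.
Proof. by rewrite /lebesgue_succ /pushforward measure_ge0. Qed.

Let lebesgue_succ_sigma_additive : semi_sigma_additive lebesgue_succ.
Proof.
move=> F mF tF mUF; rewrite /lebesgue_succ /pushforward preimage_bigcup.
have mc := measurable_cons_pair.
apply: measure_semi_sigma_additive.
- by move=> k; rewrite -[X in measurable X]setTI; exact: mc.
- apply/trivIsetP => /= i j _ _ ij; rewrite -preimage_setI.
  by move/trivIsetP : tF => /(_ _ _ _ _ ij) ->//; rewrite preimage_set0.
- by rewrite -preimage_bigcup -[X in measurable X]setTI; exact: mc.
Qed.

HB.instance Definition _ := isMeasure.Build _ _ _ lebesgue_succ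
  lebesgue_succ0 lebesgue_succ_ge0 lebesgue_succ_sigma_additive.

Let lebesgue_succ_sigma_finite : sigma_finite [set: n.+1.-tuple R] lebesgue_succ.
Proof.
have /sigma_finiteP[F [TF ndF Foo]] := sigma_finiteT (@lebesgue_measure R).
have /sigma_finiteP[G [TG ndG Goo]] := sigma_finiteT mu.
pose split_tuple (t : n.+1.-tuple R) : R * n.-tuple R :=
  (thead t, [tuple of behead t]).
have msplit : measurable_fun setT split_tuple.
  by apply: measurable_fun_pair; [exact: measurable_tnth|exact: measurable_behead].
have cons_pairK : cancel cons_pair split_tuple.
  by move=> [u t]; rewrite /split_tuple /= theadE; congr pair; exact/val_inj.
exists (fun k => split_tuple @^-1` (F k `*` G k)).
  rewrite -preimage_bigcup (_ : \bigcup_k _ = setT) ?preimage_setT//.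
  apply/seteqP; split=> // -[x y] _.
  have [i _ Fix] : (\bigcup_i F i) x by rewrite -TF.
  have [j _ Gjy] : (\bigcup_i G i) y by rewrite -TG.
  exists (maxn i j) => //; split=> /=.
    by move: x Fix; exact/subsetPset/ndF/leq_maxl.
  by move: y Gjy; exact/subsetPset/ndG/leq_maxr.
move=> k; have [mF Fk] := Foo k; have [mG Gk] := Goo k; split.
  by rewrite -[X in measurable X]setTI; apply: msplit => //; exact: measurableX.
rewrite /lebesgue_succ /pushforward -comp_preimage.
rewrite (_ : split_tuple \o cons_pair = id) ?preimage_id; last first.
  by apply/funext => p /=; rewrite cons_pairK.
by rewrite product_measure1E// lte_mul_pinfty// ge0_fin_numE.
Qed.

HB.instance Definition _ := Measure_isSigmaFinite.Build _ _ _ lebesgue_succ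
  lebesgue_succ_sigma_finite.

End lebesgue_succ.

(* m_0 is the unit mass on the one-point space and m_(n+1) = m_1 (x) m_n. *)
Fixpoint lebesgue (R : realType) (d : nat) :
    {sigma_finite_measure set (d.-tuple R) -> \bar R} :=
  match d with
  | 0 => \d_([tuple] : 0.-tuple R)
  | n.+1 => lebesgue_succ (lebesgue R n)
  end.

Section complex_integration.
Context d (T : measurableType d) (R : realType).
Variable mu : {measure set T -> \bar R}.
Implicit Type f : T -> R[i].

Definition cintegrable f : Prop :=
  mu.-integrable [set: T] (EFin \o (@complex.Re R \o f)) /\
  mu.-integrable [set: T] (EFin \o (@complex.Im R \o f)).

Definition cintegral f : R[i] :=
  Rintegral mu [set: T] (@complex.Re R \o f)
    +i* Rintegral mu [set: T] (@complex.Im R \o f).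

End complex_integration.

(* Unordered sums of absolutely summable families; rsum and csum are junk when
   the family is not absolutely summable. *)
Section unordered_sums.
Context (R : realType) (I : choiceType).

Definition rsummable (u : I -> R) : Prop := summable [set: I] (EFin \o u).

Definition rsum (u : I -> R) : R :=
  fine (esum [set: I] (EFin \o u)^\+ - esum [set: I] (EFin \o u)^\-)%E.

Definition csummable (u : I -> R[i]) : Prop :=
  rsummable (@complex.Re R \o u) /\ rsummable (@complex.Im R \o u).

Definition csum (u : I -> R[i]) : R[i] :=
  rsum (@complex.Re R \o u) +i* rsum (@complex.Im R \o u).

End unordered_sums.

Definition expi (R : realType) (t : R) : R[i] := cos t +i* sin t.

Definition fourier (R : realType) (d : nat) (f : d.-tuple R -> R)
    (l : d.-tuple R) : R[i] :=
  cintegral (lebesgue R d) (fun x => (f x)%:C * expi (- (2 * pi * dotv x l))).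

Definition gaussian_density (R : realType) (d : nat) (a : R) (x : d.-tuple R) : R :=
  (a * pi) `^ (- (d%:R / 2)) * expR (- (enorm x ^+ 2 / a)).

Section random_families.
Context d d' (T : measurableType d) (T' : measurableType d') (R : realType).
Variable P : probability T R.

Definition has_density (mu : {measure set T' -> \bar R}) (X : {RV P >-> T'})
    (f : T' -> R) : Prop :=
  forall A, measurable A -> distribution P X A = (\int[mu]_(x in A) (f x)%:E)%E.

Definition mutually_independent (I : choiceType) (X : I -> {RV P >-> T'}) : Prop :=
  forall (J : {fset I}) (A : I -> set T'), (forall i, measurable (A i)) ->
  P (\bigcap_(i in [set` J]) (X i @^-1` A i)) =
  (\prod_(i <- J) P (X i @^-1` A i))%E.

End random_families.

Definition scaled_point (R : realType) (d : nat) (r : R) (n : d.-tuple int)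
    (v : d.-tuple R) : d.-tuple R :=
  scalev r^-1 (addv (intv R n) v).

Definition linear_statistic (R : realType) (d : nat) (T : Type)
    (xi : d.-tuple int -> T -> d.-tuple R) (h : d.-tuple R -> R) (r : R)
    (t : T) : R :=
  rsum (fun n => h (scaled_point r n (xi n t))).

Definition variance_integrand (R : realType) (d : nat) (a r : R)
    (h : d.-tuple R -> R) (m : d.-tuple int) (l : d.-tuple R) : R[i] :=
  let l' := subv (scalev r (intv R m)) l in
  fourier h l * fourier h l' *
  (expR (- (a * pi ^+ 2 * enorm (intv R m) ^+ 2))
   - expR (- (a * pi ^+ 2 * enorm l ^+ 2 / r ^+ 2))
     * expR (- (a * pi ^+ 2 * enorm l' ^+ 2 / r ^+ 2)))%:C.

(* Main.v *)
(* Both sides reduce to the same pair of integrals. The summands X_n of N(h,R) are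
   independent, so Var N is the sum over n of E X_n^2 - (E X_n)^2. Summing over the
   lattice turns the Gaussian density into its periodization Theta_a, and the product
   identity phi_a(x-n) phi_a(y-n) = phi_{a/2}((x+y)/2-n) phi_{2a}(x-y) does the same
   for the squared means, whence Var N = R^d V with
     V = \int h(y)^2 Theta_a(R y) dy
         - \iint h(y) h(z) phi_{2a/R^2}(y-z) Theta_{a/2}(R(y+z)/2) dy dz.
   On the Fourier side, Plancherel for h and the Fourier transform of a Gaussian write
   the m-th term of the series as
     e^{-a pi^2 |m|^2} \int h(y)^2 e^{-2 pi i R <m,y>} dy - e^{-a pi^2 |m|^2 / 2}
       \iint h(y) h(z) phi_{2a/R^2}(y-z) e^{-pi i R <m,y+z>} dy dz,
   and summing over m recovers V by the theta identity
     \sum_m e^{-a pi^2 |m|^2} e^{2 pi i <m,y>} = Theta_a(y).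
   All Fourier integrals carry a phase th in a real cosine: th = 0 gives real parts,
   th = pi/2 gives imaginary parts. *)

From HB Require Import structures.
Require Import Defs.
From mathcomp Require Import all_boot all_order all_algebra.
From mathcomp Require Import finmap complex.
From mathcomp Require Import all_classical all_reals all_analysis.
From mathcomp Require Import measurable_realfun ring lra zify.

Import Order.TTheory GRing.Theory Num.Theory.
Import numFieldNormedType.Exports.
Import Defs.

Set Implicit Arguments.
Unset Strict Implicit.
Unset Printing Implicit Defensive.

Local Open Scope classical_set_scope.
Local Open Scope ring_scope.

(** * Integrals and unordered sums *)

(** The obstacle is that [h] is only in L^1 and L^2, so [fourier h] need not be integrable and
    Fubini does not apply to the integrals of [fourier h l * fourier h (s - l)]. They are
    regularized by the factor exp (- e pi^2 (|l|^2 + |s - l|^2)). Since |l|^2 + |s - l|^2 = 2 |l -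
    s/2|^2 + |s|^2 / 2, the frequency can then be integrated out, leaving a double integral of h y h
    z against a Gaussian in y - z ([ftprod_gauss]). As e tends to 0 this concentrates on the
    diagonal, by continuity of translations in L^2, and gives Plancherel. The case s = 0 comes
    first: it shows that |fourier h|^2 is integrable, which dominates all the other cases. The same
    lemma with e = a / r^2 kept fixed evaluates the second half of the m-th term, and the |s|^2 / 2
    above is the origin of the weight exp (- a pi^2 |m|^2 / 2). The theta identity is proved
    pointwise on the line by Dirichlet's kernel and then iterated over the coordinates. It also
    bounds [theta], so that multiplying by [theta] preserves integrability. *)

Section real_integrals.
Context d (T : measurableType d) (R : realType).
Variable mu : {measure set T -> \bar R}.
Implicit Types f g : T -> R.

Lemma integrable_le f g : measurable_fun setT f ->
  mu.-integrable setT (EFin \o g) -> (forall x, `|f x| <= g x) ->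
  mu.-integrable setT (EFin \o f).
Proof.
move=> mf ig fg; apply: (le_integrable _ _ _ ig) => //.
  exact/measurable_EFinP.
by move=> x _ /=; rewrite lee_fin (le_trans (fg x))// ler_norm.
Qed.

Lemma integrable_mulb f g M : measurable_fun setT g ->
  mu.-integrable setT (EFin \o f) -> (forall x, `|g x| <= M) ->
  mu.-integrable setT (EFin \o (fun x => f x * g x)).
Proof.
move=> mg fi gM.
have mf : measurable_fun setT f by apply/measurable_EFinP; case/integrableP : fi.
apply: (@integrable_le _ (fun x => M * `|f x|)).
- exact: measurable_funM.
- have : mu.-integrable setT (fun x => M%:E * (abse \o (EFin \o f)) x)%E.
    by apply: integrableZl => //; exact: integrable_abse.
  by apply: eq_integrable.
- by move=> x; rewrite normrM mulrC ler_wpM2r.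
Qed.

Lemma ae_Rintegral_dominated_cvg (u : nat -> T -> R) (f g : T -> R) :
  (forall n, measurable_fun setT (u n)) -> measurable_fun setT f ->
  {ae mu, forall x, u n x @[n --> \oo] --> f x} ->
  mu.-integrable setT (EFin \o g) -> {ae mu, forall x, forall n, `|u n x| <= g x} ->
  \int[mu]_x u n x @[n --> \oo] --> \int[mu]_x f x.
Proof.
move=> mu_ mf uf ig ug.
have [|||||intf _ /= cv] := @dominated_convergence _ _ _ mu setT measurableT
  (fun n x => (u n x)%:E) (fun x => (f x)%:E) (EFin \o g).
- by move=> n; exact/measurable_EFinP.
- exact/measurable_EFinP.
- by apply: filterS uf => x ux _; apply: cvg_EFin; [exact: nearW|exact: ux].
- by [].
- by apply: filterS ug => x ugx n _; rewrite lee_fin.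
apply: (@fine_cvg _ _ _ _ (fun n => \int[mu]_x (u n x)%:E)%E).
rewrite fineK; last exact: integrable_fin_num.
exact: cv.
Qed.

Lemma Rintegral_dominated_cvg (u : nat -> T -> R) f g :
  (forall n, measurable_fun setT (u n)) -> measurable_fun setT f ->
  (forall x, u n x @[n --> \oo] --> f x) ->
  mu.-integrable setT (EFin \o g) -> (forall n x, `|u n x| <= g x) ->
  \int[mu]_x u n x @[n --> \oo] --> \int[mu]_x f x.
Proof.
move=> mu_ mf uf ig ug.
by apply: (ae_Rintegral_dominated_cvg mu_ mf _ ig); exact: aeW.
Qed.

Lemma EFin_Rintegral f : mu.-integrable setT (EFin \o f) ->
  (\int[mu]_x f x)%:E = (\int[mu]_x (f x)%:E)%E.
Proof. by move=> fi; rewrite /Rintegral fineK//; exact: integrable_fin_num. Qed.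

Lemma integrable_ge0_fin f : measurable_fun setT f -> (forall x, 0 <= f x) ->
  (\int[mu]_x (f x)%:E < +oo)%E -> mu.-integrable setT (EFin \o f).
Proof.
move=> mf f0 foo; apply/integrableP; split; first exact/measurable_EFinP.
by under eq_integral do rewrite /= ger0_norm//.
Qed.

Lemma integrable_measurable f : mu.-integrable setT (EFin \o f) ->
  measurable_fun setT f.
Proof. by move=> fi; apply/measurable_EFinP; case/integrableP : fi. Qed.

Lemma integrable_norm f : mu.-integrable setT (EFin \o f) ->
  mu.-integrable setT (EFin \o (fun x => `|f x|)).
Proof. by move=> /integrable_abse. Qed.

Lemma integrable_scale (c : R) f : mu.-integrable setT (EFin \o f) ->
  mu.-integrable setT (EFin \o (fun x => c * f x)).
Proof.
move=> fi; have : mu.-integrable setT (fun x => c%:E * (f x)%:E)%E.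
  exact: integrableZl.
exact: eq_integrable.
Qed.

Lemma integrable_add f g : mu.-integrable setT (EFin \o f) ->
  mu.-integrable setT (EFin \o g) ->
  mu.-integrable setT (EFin \o (fun x => f x + g x)).
Proof. by move=> fi gi; have := integrableD measurableT fi gi; apply: eq_integrable. Qed.

Lemma integrable_sub f g : mu.-integrable setT (EFin \o f) ->
  mu.-integrable setT (EFin \o g) ->
  mu.-integrable setT (EFin \o (fun x => f x - g x)).
Proof. by move=> fi gi; have := integrableB measurableT fi gi; apply: eq_integrable. Qed.

End real_integrals.

Section real_fubini.
Context d1 d2 (T1 : measurableType d1) (T2 : measurableType d2) (R : realType).
Variable m1 : {sigma_finite_measure set T1 -> \bar R}.
Variable m2 : {sigma_finite_measure set T2 -> \bar R}.
Local Open Scope ereal_scope.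

(** Sections of [f] are integrable only for almost every [x], and elsewhere [fine] may return a
    default value; the real inner integral is therefore compared with [fubini_F] up to a null
    set. *)
Lemma integrable_Rintegral1 (f : T1 * T2 -> R) :
  (m1 \x m2).-integrable setT (EFin \o f) ->
  m1.-integrable setT (EFin \o (fun x => \int[m2]_y f (x, y))%R) /\
  \int[m1]_x (\int[m2]_y f (x, y))%R%:E = \int[m1]_x \int[m2]_y (f (x, y))%:E.
Proof.
move=> fi; have iF := integrable_fubini_F fi.
have mF := measurable_fubini_F fi.
have FE : {ae m1, forall x, setT x ->
    (fubini_F m2 (EFin \o f)) x = (\int[m2]_y f (x, y))%R%:E}.
  apply: filterS (ae_integrable1 fi) => x ix _.
  by rewrite /fubini_F /= EFin_Rintegral.
have mR : measurable_fun setT (EFin \o (fun x => \int[m2]_y f (x, y))%R).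
  by apply/measurable_EFinP/(measurableT_comp _ mF).
split; last by apply/esym/ae_eq_integral.
apply/integrableP; split => //.
rewrite [ltLHS](_ : _ = \int[m1]_x `|fubini_F m2 (EFin \o f) x|).
  by case/integrableP : iF.
apply/esym/ae_eq_integral => //; [exact: measurableT_comp..|].
by apply: filterS FE => x + Tx => /(_ Tx) ->.
Qed.

Lemma integrable_prod_swap (f : T1 * T2 -> R) :
  (m1 \x m2).-integrable setT (EFin \o f) ->
  (m2 \x m1).-integrable setT (EFin \o (fun z => f (z.2, z.1))).
Proof.
move=> fi; have /measurable_EFinP mf := measurable_int _ fi.
apply/integrable12ltyP => /=; last first.
  by apply/(@integrable21ltyP _ _ _ _ _ m1 m2 (EFin \o f)) => //; exact/measurable_EFinP.
apply/measurable_EFinP; apply: (measurableT_comp mf).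
by apply: measurable_fun_pair; [exact: measurable_snd|exact: measurable_fst].
Qed.

Lemma Rintegral_prod1 (f : T1 * T2 -> R) :
  (m1 \x m2).-integrable setT (EFin \o f) ->
  (\int[m1 \x m2]_z f z = \int[m1]_x (\int[m2]_y f (x, y)))%R.
Proof.
move=> fi; rewrite [in RHS]/Rintegral (integrable_Rintegral1 fi).2.
by rewrite /Rintegral -(integral12_prod_meas1 fi).
Qed.

Lemma integrable_tensor (f : T1 -> R) (g : T2 -> R) :
  m1.-integrable setT (EFin \o f) -> m2.-integrable setT (EFin \o g) ->
  (m1 \x m2).-integrable setT (EFin \o (fun z => f z.1 * g z.2)%R).
Proof.
move=> fi gi; have mf := integrable_measurable fi.
have mg := integrable_measurable gi.
apply/integrable12ltyP => /=.
  apply/measurable_EFinP; apply: measurable_funM;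
    exact: measurableT_comp.
have -> : \int[m1]_x \int[m2]_y `|(f x * g y)%R%:E| =
          \int[m1]_x ((\int[m2]_y `|(g y)%:E|) * `|(f x)%:E|).
  apply: eq_integral => x _.
  under eq_integral do rewrite EFinM abseM.
  rewrite ge0_integralZl// 1?muleC//.
  by apply: measurableT_comp => //; exact/measurable_EFinP.
have /integrableP[_ fo] := fi; have /integrableP[_ go] := gi.
rewrite ge0_integralZl//.
- by rewrite lte_mul_pinfty ?integral_ge0// ge0_fin_numE ?integral_ge0.
- by apply: measurableT_comp => //; exact/measurable_EFinP.
- exact: integral_ge0.
Qed.

End real_fubini.

Section real_fubini_swap.
Context d1 d2 (T1 : measurableType d1) (T2 : measurableType d2) (R : realType).
Variable m1 : {sigma_finite_measure set T1 -> \bar R}.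
Variable m2 : {sigma_finite_measure set T2 -> \bar R}.

Lemma integrable_Rintegral2 (f : T1 * T2 -> R) :
  (m1 \x m2)%E.-integrable setT (EFin \o f) ->
  m2.-integrable setT (EFin \o (fun y => \int[m1]_x f (x, y))).
Proof.
by move=> /integrable_prod_swap/integrable_Rintegral1[].
Qed.

Lemma Rintegral_Fubini (f : T1 * T2 -> R) :
  (m1 \x m2)%E.-integrable setT (EFin \o f) ->
  \int[m1]_x (\int[m2]_y f (x, y)) = \int[m2]_y (\int[m1]_x f (x, y)).
Proof.
move=> fi; rewrite {1}/Rintegral (integrable_Rintegral1 fi).2.
rewrite [in RHS]/Rintegral (integrable_Rintegral1 (integrable_prod_swap fi)).2.
by congr fine; exact: (Fubini fi).
Qed.

End real_fubini_swap.

Section unordered_sums.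
Context (R : realType).
Implicit Types I J : countType.

(** Carries a countable family to a sequence, with 0 at the codes of no index. Unordered sums thus
    become integrals against counting measure and inherit linearity, dominated convergence and
    Fubini. *)
Definition seqof I (u : I -> R) (k : nat) : R := oapp u 0 (pickle_inv k).

Lemma esum_pickle I (u : I -> \bar R) : (forall i, 0 <= u i)%E ->
  (\esum_(i in [set: I]) u i = \esum_(k in [set: nat]) oapp u 0%E (pickle_inv k))%E.
Proof.
move=> u0; rewrite [RHS](_ : _ =
    \esum_(k in range (@choice.pickle I)) oapp u 0%E (pickle_inv k))%E.
  rewrite (@reindex_esum R I nat setT (range (@choice.pickle I)) choice.pickle).
    by apply: eq_esum => i _; rewrite /= pickleK_inv.
  split; [by move=> i _; exists i| by move=> i j _ _ /(pcan_inj choice.pickleK)|by []].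
rewrite [RHS]esum_mkcond; apply: eq_esum => k _.
case: ifPn => //; case E : (pickle_inv k) => [i|]//= /negP[].
by rewrite inE; exists i => //; move: (@pickle_invK I k); rewrite E.
Qed.

Lemma integral_counting_seqof I (u : I -> R) : (forall i, 0 <= u i) ->
  (\int[@counting nat R]_k (seqof u k)%:E = \esum_(i in [set: I]) (u i)%:E)%E.
Proof.
move=> u0; rewrite ge0_integral_count; last first.
  by move=> k; rewrite lee_fin /seqof; case: pickle_inv => /=.
rewrite nneseries_esumT; last first.
  by move=> k; rewrite lee_fin /seqof; case: pickle_inv => /=.
rewrite esum_pickle//.
by apply: eq_esum => k _; rewrite /seqof; case: pickle_inv.
Qed.

(** Both sides are [fine] of the same difference of positive and negative parts, so they agree even
    on families that are not summable. *)
Lemma rsumE I (u : I -> R) : rsum u = \int[@counting nat R]_k seqof u k.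
Proof.
rewrite /rsum /Rintegral integralE; congr (fine (_ - _)).
- rewrite (_ : (fun k => _)^\+ = fun k => (seqof (fun i => Num.max (u i) 0) k)%:E)%E.
    rewrite integral_counting_seqof; last by move=> i; rewrite le_max lexx orbT.
    by apply: eq_esum => i _; rewrite funeposE EFin_max.
  by apply/funext => k; rewrite funeposE /seqof; case: pickle_inv => /= [i|];
    rewrite ?EFin_max// maxxx.
- rewrite (_ : (fun k => _)^\- = fun k => (seqof (fun i => Num.max (- u i) 0) k)%:E)%E.
    rewrite integral_counting_seqof; last by move=> i; rewrite le_max lexx orbT.
    by apply: eq_esum => i _; rewrite funenegE EFin_max.
  by apply/funext => k; rewrite funenegE /seqof; case: pickle_inv => /= [i|];
    rewrite ?EFin_max ?EFinN ?oppe0// maxxx.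
Qed.

Lemma rsummableP I (u : I -> R) :
  rsummable u <-> (@counting nat R).-integrable setT (EFin \o seqof u).
Proof.
have -> : rsummable u = (\int[@counting nat R]_k `|(seqof u k)%:E| < +oo)%E :> Prop.
  rewrite /rsummable /summable -integral_counting_seqof//.
  rewrite (_ : integral _ _ _ = \int[@counting nat R]_k `|(seqof u k)%:E|)%E//.
  apply: eq_integral => k _; rewrite /seqof.
  by case: pickle_inv => /= [i|]//; rewrite normr0.
split; first by move=> ?; apply/integrableP; split => //; exact: measurable_EFinP.2.
by case/integrableP.
Qed.

Lemma seqofD I (u v : I -> R) k : seqof (fun i => u i + v i) k = seqof u k + seqof v k.
Proof. by rewrite /seqof; case: pickle_inv => //=; rewrite addr0. Qed.

Lemma seqofB I (u v : I -> R) k : seqof (fun i => u i - v i) k = seqof u k - seqof v k.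
Proof. by rewrite /seqof; case: pickle_inv => //=; rewrite subr0. Qed.

Lemma seqofZ I c (u : I -> R) k : seqof (fun i => c * u i) k = c * seqof u k.
Proof. by rewrite /seqof; case: pickle_inv => //=; rewrite mulr0. Qed.

Lemma seqof_norm I (u : I -> R) k : seqof (fun i => `|u i|) k = `|seqof u k|.
Proof. by rewrite /seqof; case: pickle_inv => //=; rewrite normr0. Qed.

Lemma rsummable_le I (u v : I -> R) : rsummable v -> (forall i, `|u i| <= v i) ->
  rsummable u.
Proof.
move=> /rsummableP sv uv; apply/rsummableP; apply: (integrable_le _ sv) => // k.
by rewrite /seqof; case: pickle_inv => //=; rewrite normr0.
Qed.

Lemma rsummableD I (u v : I -> R) : rsummable u -> rsummable v ->
  rsummable (fun i => u i + v i).
Proof.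
move=> /rsummableP su /rsummableP sv; apply/rsummableP.
by have := integrable_add su sv; apply: eq_integrable => // k _ /=; rewrite seqofD.
Qed.

Lemma rsummableB I (u v : I -> R) : rsummable u -> rsummable v ->
  rsummable (fun i => u i - v i).
Proof.
move=> /rsummableP su /rsummableP sv; apply/rsummableP.
by have := integrable_sub su sv; apply: eq_integrable => // k _ /=; rewrite seqofB.
Qed.

Lemma rsummableZ I c (u : I -> R) : rsummable u -> rsummable (fun i => c * u i).
Proof.
move=> /rsummableP su; apply/rsummableP.
by have := integrable_scale c su; apply: eq_integrable => // k _ /=; rewrite seqofZ.
Qed.

Lemma rsummable_norm I (u : I -> R) : rsummable u -> rsummable (fun i => `|u i|).
Proof.
move=> /rsummableP su; apply/rsummableP.
by have := integrable_norm su; apply: eq_integrable => // k _ /=; rewrite seqof_norm.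
Qed.

Lemma rsumD I (u v : I -> R) : rsummable u -> rsummable v ->
  rsum (fun i => u i + v i) = rsum u + rsum v.
Proof.
move=> /rsummableP su /rsummableP sv; rewrite !rsumE -RintegralD//.
by apply: eq_Rintegral => k _; rewrite seqofD.
Qed.

Lemma rsumB I (u v : I -> R) : rsummable u -> rsummable v ->
  rsum (fun i => u i - v i) = rsum u - rsum v.
Proof.
move=> /rsummableP su /rsummableP sv; rewrite !rsumE -RintegralB//.
by apply: eq_Rintegral => k _; rewrite seqofB.
Qed.

Lemma rsumZ I c (u : I -> R) : rsummable u -> rsum (fun i => c * u i) = c * rsum u.
Proof.
move=> /rsummableP su; rewrite !rsumE -RintegralZl//.
by apply: eq_Rintegral => k _; rewrite seqofZ.
Qed.

Lemma le_rsum I (u v : I -> R) : rsummable u -> rsummable v ->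
  (forall i, u i <= v i) -> rsum u <= rsum v.
Proof.
move=> /rsummableP su /rsummableP sv uv; rewrite !rsumE le_Rintegral// => k _.
by rewrite /seqof; case: pickle_inv => //=.
Qed.

Lemma rsum_ge0 I (u : I -> R) : (forall i, 0 <= u i) -> 0 <= rsum u.
Proof.
move=> u0; rewrite rsumE Rintegral_ge0// => k _.
by rewrite /seqof; case: pickle_inv => //=.
Qed.

Lemma le_norm_rsum I (u : I -> R) : rsummable u -> `|rsum u| <= rsum (fun i => `|u i|).
Proof.
move=> /rsummableP su; rewrite !rsumE (le_trans (le_normr_Rintegral _ su))//.
by under eq_Rintegral do rewrite -seqof_norm.
Qed.

Lemma esum_rsum I (u : I -> R) : (forall i, 0 <= u i) -> rsummable u ->
  (\esum_(i in [set: I]) (u i)%:E = (rsum u)%:E)%E.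
Proof.
move=> u0 /rsummableP su; rewrite rsumE EFin_Rintegral//.
by rewrite -integral_counting_seqof.
Qed.

Lemma ge0_rsummable I (u : I -> R) : (forall i, 0 <= u i) ->
  (\esum_(i in [set: I]) (u i)%:E < +oo)%E -> rsummable u.
Proof.
move=> u0; rewrite /rsummable /summable; congr (_ < _)%E.
by apply: eq_esum => i _; rewrite /= ger0_norm.
Qed.

Lemma rsummable_reindex I J (e : J -> I) (u : I -> R) : bijective e ->
  rsummable u <-> rsummable (u \o e).
Proof.
move=> be; rewrite /rsummable /summable (@reindex_esum R J I [set: J] [set: I] e)//.
by rewrite setTT_bijective.
Qed.

Lemma rsum_reindex I J (e : J -> I) (u : I -> R) : bijective e ->
  rsum (u \o e) = rsum u.
Proof.
move=> be; have bs : set_bij [set: J] [set: I] e by rewrite setTT_bijective.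
rewrite /rsum; congr (fine (_ - _)); rewrite [RHS](@reindex_esum R J I _ _ e _ bs);
  by apply: eq_esum => i _; rewrite ?funeposE ?funenegE.
Qed.

Lemma rsum_posneg I (u : I -> R) : rsummable u ->
  rsum u = rsum (fun i => Num.max (u i) 0) - rsum (fun i => Num.max (- u i) 0).
Proof.
move=> su; rewrite -rsumB.
- congr rsum; apply/funext => i; case: (lerP 0 (u i)) => h.
    by rewrite max_r ?subr0// oppr_le0.
  by rewrite max_l ?sub0r ?opprK// oppr_ge0 ltW.
- apply: (rsummable_le (rsummable_norm su)) => i.
  by rewrite ger0_norm ?le_max ?lexx ?orbT// ge_max normr_ge0 ler_norm.
- apply: (rsummable_le (rsummable_norm su)) => i.
  by rewrite ger0_norm ?le_max ?lexx ?orbT// ge_max normr_ge0 -normrN ler_norm.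
Qed.

Let rsum_pair_ge0 I J (u : I * J -> R) : rsummable u -> (forall z, 0 <= u z) ->
  [/\ forall i, rsummable (fun j => u (i, j)),
      rsummable (fun i => rsum (fun j => u (i, j))) &
      rsum u = rsum (fun i => rsum (fun j => u (i, j)))].
Proof.
move=> su u0.
have eIJ : (\esum_(z in [set: I * J]) (u z)%:E =
          \esum_(i in [set: I]) \esum_(j in [set: J]) (u (i, j))%:E)%E.
  rewrite (@esum_esum _ _ _ setT (fun=> setT) (fun i j => (u (i, j))%:E))//=;
    last by move=> i j _ _; rewrite lee_fin.
  rewrite (_ : setT `*`` _ = setT); last by apply/seteqP; split.
  by apply: eq_esum => -[].
have fin : (\esum_(z in [set: I * J]) (u z)%:E < +oo)%E.
  by rewrite esum_rsum// ltry.
have s1 i : rsummable (fun j => u (i, j)).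
  apply: ge0_rsummable => //; apply: le_lt_trans fin; rewrite eIJ.
  (* The section at [i] is the contribution of the singleton [[set i]] to the iterated sum. *)
  apply: (@le_trans _ _ (\esum_(i0 in [set i]) \esum_(j in [set: J]) (u (i0, j))%:E)%E).
    by rewrite esum_set1//; apply: esum_ge0 => j _; rewrite lee_fin.
  rewrite [leRHS](esumID [set i])//; last by move=> ? _; apply: esum_ge0 => j _; rewrite lee_fin.
  by rewrite setTI leeDl// esum_ge0// => ? _; apply: esum_ge0 => j _; rewrite lee_fin.
have eII : (\esum_(i in [set: I]) \esum_(j in [set: J]) (u (i, j))%:E =
   \esum_(i in [set: I]) (rsum (fun j => u (i, j)))%:E)%E.
  by apply: eq_esum => i _; rewrite esum_rsum.
have s2 : rsummable (fun i => rsum (fun j => u (i, j))).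
  by apply: ge0_rsummable; [move=> i; exact: rsum_ge0|rewrite -eII -eIJ].
split => //; apply: EFin_inj; rewrite -!esum_rsum ?eIJ//.
by move=> i; exact: rsum_ge0.
Qed.

Lemma rsum_pair I J (u : I * J -> R) : rsummable u ->
  [/\ forall i, rsummable (fun j => u (i, j)),
      rsummable (fun i => rsum (fun j => u (i, j))) &
      rsum u = rsum (fun i => rsum (fun j => u (i, j)))].
Proof.
move=> su.
have [s1 s2 _] := rsum_pair_ge0 (rsummable_norm su) (fun=> normr_ge0 _).
have sp : rsummable (fun z => Num.max (u z) 0).
  apply: (rsummable_le (rsummable_norm su)) => i.
  by rewrite ger0_norm ?le_max ?lexx ?orbT// ge_max normr_ge0 ler_norm.
have sn : rsummable (fun z => Num.max (- u z) 0).
  apply: (rsummable_le (rsummable_norm su)) => i.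
  by rewrite ger0_norm ?le_max ?lexx ?orbT// ge_max normr_ge0 -normrN ler_norm.
have [|p1 p2 p3] := rsum_pair_ge0 sp; first by move=> z; rewrite le_max lexx orbT.
have [|n1 n2 n3] := rsum_pair_ge0 sn; first by move=> z; rewrite le_max lexx orbT.
have s1' i : rsummable (fun j => u (i, j)).
  by apply: (rsummable_le (s1 i)) => j.
split => //.
- by apply: (rsummable_le s2) => i; exact: le_norm_rsum.
- apply: (etrans (rsum_posneg su)).
  apply: (etrans (congr2 (fun x y => x - y) p3 n3)).
  rewrite -rsumB//; congr rsum; apply/funext => i.
  by rewrite [in RHS]rsum_posneg.
Qed.

Lemma rsummable_pair_ge0 I J (u : I * J -> R) : (forall z, 0 <= u z) ->
  (forall i, rsummable (fun j => u (i, j))) ->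
  rsummable (fun i => rsum (fun j => u (i, j))) -> rsummable u.
Proof.
move=> u0 s1 s2; apply: ge0_rsummable => //.
rewrite [ltLHS](_ : _ =
      \esum_(i in [set: I]) \esum_(j in [set: J]) (u (i, j))%:E)%E; last first.
  rewrite (@esum_esum _ _ _ setT (fun=> setT) (fun i j => (u (i, j))%:E))//=;
    last by move=> i j _ _; rewrite lee_fin.
  rewrite (_ : setT `*`` _ = setT); last by apply/seteqP; split.
  by apply: eq_esum => -[].
rewrite [ltLHS](_ : _ = \esum_(i in [set: I]) (rsum (fun j => u (i, j)))%:E)%E; last first.
  by apply: eq_esum => i _; rewrite esum_rsum.
by rewrite esum_rsum ?ltry// => i; exact: rsum_ge0.
Qed.

Lemma rsum1 I (i0 : I) (u : I -> R) : (forall i, i != i0 -> u i = 0) ->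
  rsummable u /\ rsum u = u i0.
Proof.
move=> ui0.
have E (v : I -> \bar R) : (forall i, 0 <= v i)%E -> (forall i, i != i0 -> v i = 0%E) ->
    \esum_(i in [set: I]) v i = v i0.
  move=> v0 vi0; rewrite (esumID [set i0])// setTI esum_set1//.
  by rewrite esum1 ?adde0// => i [_ /eqP ii0]; exact: vi0.
split; first by rewrite /rsummable /summable E//= ?ltry// => i /ui0 ->; rewrite normr0.
have Ep i : i != i0 -> (EFin \o u)^\+%E i = 0%E.
  by move=> /ui0 E'; rewrite funeposE /= E' maxxx.
have En i : i != i0 -> (EFin \o u)^\-%E i = 0%E.
  by move=> /ui0 E'; rewrite funenegE /= E' oppr0 maxxx.
rewrite /rsum (E _ _ Ep)// (E _ _ En)//.
exact: (esym (congr1 (fun f => fine (f i0)) (funeposneg (EFin \o u)))).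
Qed.

End unordered_sums.

(* The library declares [counting] sigma-finite without declaring it s-finite, so
   that it is not yet an instance of [sigma_finite_measure]. *)
HB.instance Definition _ (R : realType) := @Measure_isSigmaFinite.Build _ _ _
  (@counting nat R) (sigma_finite_counting R).

Section sum_integral.
Context (R : realType).

Section swap.
Context d (T : measurableType d) (mu : {sigma_finite_measure set T -> \bar R}).

(** Since [nat] is discrete, a preimage is the countable union of its slices. *)
Lemma measurable_uncurry_nat d' (U : measurableType d') (f : nat -> T -> U) :
  (forall n, measurable_fun setT (f n)) ->
  measurable_fun setT (fun z : nat * T => f z.1 z.2).
Proof.
move=> mf _ A mA; rewrite setTI.
rewrite (_ : _ @^-1` A = \bigcup_n ([set n] `*` (f n @^-1` A))).
  apply: bigcupT_measurable => n; apply: measurableX => //.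
  by rewrite -[X in measurable X]setTI; exact: mf.
by apply/seteqP; split => [[n t] /= At|[n t] [m _ [/= ->]]]//; exists n.
Qed.

Context (I : countType).

Lemma measurable_seqof (F : I -> T -> R) k : (forall i, measurable_fun setT (F i)) ->
  measurable_fun setT (fun t => seqof (F^~ t) k).
Proof. by move=> mF; rewrite /seqof; case: (pickle_inv k). Qed.

Lemma integrable_seqof (F : I -> T -> R) :
  (forall i, mu.-integrable setT (EFin \o F i)) ->
  rsummable (fun i => \int[mu]_t `|F i t|) ->
  (@counting nat R \x mu)%E.-integrable setT
    (EFin \o (fun z : nat * T => seqof (F^~ z.2) z.1)).
Proof.
move=> iF sF.
have mS : measurable_fun setT (fun z : nat * T => seqof (F^~ z.2) z.1).
  apply: (measurable_uncurry_nat (f := fun k t => seqof (F^~ t) k)) => k.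
  by apply: measurable_seqof => i; exact: integrable_measurable.
have mE : measurable_fun setT (EFin \o (fun z : nat * T => seqof (F^~ z.2) z.1)).
  exact/measurable_EFinP.
apply/(@integrable12ltyP _ _ nat T R (@counting nat R) mu _ mE).
move/rsummableP : sF => /integrableP[_]; congr (_ < _)%E; apply: eq_integral => k _ /=.
rewrite /seqof; case: pickle_inv => [i|] /=; last by rewrite !normr0 integral0.
rewrite ger0_norm ?Rintegral_ge0//.
by rewrite EFin_Rintegral//; exact: integrable_norm.
Qed.

(** Fubini for the product of counting measure and [mu]; summability at a point [t] is obtained only
    almost everywhere. *)
Lemma rsum_Rintegral (F : I -> T -> R) :
  (forall i, mu.-integrable setT (EFin \o F i)) ->
  rsummable (fun i => \int[mu]_t `|F i t|) ->
  [/\ {ae mu, forall t, rsummable (F^~ t)},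
      mu.-integrable setT (EFin \o (fun t => rsum (F^~ t))),
      rsummable (fun i => \int[mu]_t F i t) &
      \int[mu]_t rsum (F^~ t) = rsum (fun i => \int[mu]_t F i t)].
Proof.
move=> iF sF; have iG := integrable_seqof iF sF.
have E k : seqof (fun i => \int[mu]_t F i t) k = \int[mu]_t seqof (F^~ t) k.
  rewrite /seqof; case: pickle_inv => [i|] //=.
  by rewrite /Rintegral integral0.
split.
- by apply: filterS (ae_integrable2 iG) => t it; apply/rsummableP.
- by have := integrable_Rintegral2 iG; apply: eq_integrable => // t _ /=; rewrite rsumE.
- apply: (rsummable_le sF) => i.
  exact: le_normr_Rintegral.
- under eq_Rintegral do rewrite rsumE.
  rewrite -(Rintegral_Fubini iG) rsumE.
  by apply: eq_Rintegral => k _; rewrite E.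
Qed.

(** Summability is not assumed, so measurability comes from Tonelli applied to the positive and
    negative parts rather than from integrability. *)
Lemma measurable_rsum (F : I -> T -> R) : (forall i, measurable_fun setT (F i)) ->
  measurable_fun setT (fun t => rsum (F^~ t)).
Proof.
move=> mF.
have mS : measurable_fun setT
    (EFin \o (fun z : nat * T => seqof (F^~ z.2) z.1)).
  apply/measurable_EFinP.
  apply: (measurable_uncurry_nat (f := fun k t => seqof (F^~ t) k)) => k.
  exact: measurable_seqof.
have -> : (fun t => rsum (F^~ t)) = fine \o (fun t =>
   (\int[@counting nat R]_k ((EFin \o (fun z : nat * T => seqof (F^~ z.2) z.1))^\+ (k, t))
  - \int[@counting nat R]_k ((EFin \o (fun z : nat * T => seqof (F^~ z.2) z.1))^\- (k, t))))%E.
  apply/funext => t /=; rewrite rsumE /Rintegral integralE.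
  by congr (fine (_ - _)); apply: eq_integral => k _; rewrite ?funeposE ?funenegE.
apply: measurableT_comp => //; apply: emeasurable_funB.
  by apply: (@measurable_fun_fubini_tonelli_G _ _ _ _ _ (@counting nat R));
    [exact: measurable_funepos|].
by apply: (@measurable_fun_fubini_tonelli_G _ _ _ _ _ (@counting nat R));
    [exact: measurable_funeneg|].
Qed.

Lemma ge0_integral_rsum (F : I -> T -> R) :
  (forall i, measurable_fun setT (F i)) -> (forall i t, 0 <= F i t) ->
  (\esum_(i in [set: I]) \int[mu]_t (F i t)%:E =
   \int[mu]_t \esum_(i in [set: I]) (F i t)%:E)%E.
Proof.
move=> mF F0.
have s0 t k : 0 <= seqof (F^~ t) k by rewrite /seqof; case: pickle_inv => /=.
under [RHS]eq_integral do rewrite -integral_counting_seqof//.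
rewrite esum_pickle; last by move=> i; apply: integral_ge0 => t _; rewrite lee_fin.
rewrite -nneseries_esumT; last first.
  by move=> k; case: pickle_inv => //= i; apply: integral_ge0 => t _; rewrite lee_fin.
rewrite -ge0_integral_count; last first.
  by move=> k; case: pickle_inv => //= i; apply: integral_ge0 => t _; rewrite lee_fin.
rewrite -(@fubini_tonelli _ _ _ _ _ (@counting nat R) mu
    (fun z => (seqof (F^~ z.2) z.1)%:E))//=.
- apply: eq_integral => k _; rewrite /seqof; case: pickle_inv => //=.
  by rewrite integral0.
- apply/measurable_EFinP.
  apply: (measurable_uncurry_nat (f := fun k t => seqof (F^~ t) k)) => k.
  exact: measurable_seqof.
- by move=> z; rewrite lee_fin.
Qed.

End swap.
End sum_integral.

(** * Lebesgue measure on tuples *)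

Section affine_line.
Context (R : realType).
Notation leb := (@lebesgue_measure R).

(** By uniqueness of Lebesgue measure: [c] times its image under [x |-> c x + b] agrees with it on
    half-open intervals. *)
Lemma ge0_integral_affine (c b : R) (f : R -> \bar R) : 0 < c ->
  measurable_fun setT f -> (forall x, 0 <= f x)%E ->
  (\int[leb]_x f (c * x + b)%R = c^-1%:E * \int[leb]_x f x)%E.
Proof.
move=> c0 mf f0.
pose phi (x : measurableTypeR R) : measurableTypeR R := c * x + b.
have mphi : measurable_fun setT phi.
  apply: measurable_funD => //; exact: measurable_funM.
pose nu := measure_function_pushforward__canonical__measure_function_Measure leb mphi.
have nuE A : measurable A -> leb A = mscale (NngNum (ltW c0)) nu A.
  apply: lebesgue_measure_unique => /= X [[u v] _ <-].
  rewrite /mscale /= /nu /pushforward /=.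
  rewrite (_ : phi @^-1` _ = `]((u - b) / c), ((v - b) / c)]%classic); last first.
    apply/seteqP; split => x /=; rewrite !in_itv/= /phi.
      by rewrite ltr_pdivrMr// ler_pdivlMr// ltrBlDr lerBrDr mulrC.
    by rewrite ltr_pdivrMr// ler_pdivlMr// ltrBlDr lerBrDr mulrC.
  rewrite !lebesgue_measure_itv/= !lte_fin ltr_pM2r ?invr_gt0// ltrD2r.
  case: ifPn => _; last by rewrite mule0.
  by rewrite -!EFinD -EFinM; congr EFin; field; rewrite gt_eqF.
have -> : (\int[leb]_x f x = c%:E * \int[nu]_x f x)%E.
  rewrite (eq_measure_integral (mscale (NngNum (ltW c0)) nu)); last first.
    by move=> A mA _; exact: nuE.
  by rewrite ge0_integral_mscale.
rewrite muleA -EFinM mulVf ?gt_eqF// mul1e.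
exact: (esym (ge0_integral_pushforward mphi leb _ _ _)).
Qed.

End affine_line.

Section tuple_measurability.
Context d (T : measurableType d) (R : realType) (n : nat).
Implicit Types f g : T -> n.-tuple R.

Lemma measurable_addv f g : measurable_fun setT f -> measurable_fun setT g ->
  measurable_fun setT (fun t => addv (f t) (g t)).
Proof.
move=> /measurable_fun_tnthP mf /measurable_fun_tnthP mg.
apply/measurable_fun_tnthP => i; rewrite (_ : _ \o _ = fun t => tnth (f t) i + tnth (g t) i).
  exact: measurable_funD (mf i) (mg i).
by apply/funext => t /=; rewrite tnth_mktuple.
Qed.

Lemma measurable_subv f g : measurable_fun setT f -> measurable_fun setT g ->
  measurable_fun setT (fun t => subv (f t) (g t)).
Proof.
move=> /measurable_fun_tnthP mf /measurable_fun_tnthP mg.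
apply/measurable_fun_tnthP => i; rewrite (_ : _ \o _ = fun t => tnth (f t) i - tnth (g t) i).
  exact: measurable_funB (mf i) (mg i).
by apply/funext => t /=; rewrite tnth_mktuple.
Qed.

Lemma measurable_scalev c f : measurable_fun setT f ->
  measurable_fun setT (fun t => scalev c (f t)).
Proof.
move=> /measurable_fun_tnthP mf.
apply/measurable_fun_tnthP => i; rewrite (_ : _ \o _ = fun t => c * tnth (f t) i).
  by apply: measurable_funM => //; exact: mf.
by apply/funext => t /=; rewrite tnth_mktuple.
Qed.

Lemma measurable_dotv f g : measurable_fun setT f -> measurable_fun setT g ->
  measurable_fun setT (fun t => dotv (f t) (g t)).
Proof.
move=> /measurable_fun_tnthP mf /measurable_fun_tnthP mg.
apply: measurable_sum => i.
exact: measurable_funM (mf i) (mg i).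
Qed.

Lemma measurable_enorm2 f : measurable_fun setT f ->
  measurable_fun setT (fun t => enorm (f t) ^+ 2).
Proof.
move=> mf; rewrite (_ : (fun t => _) = fun t => dotv (f t) (f t)).
  exact: measurable_dotv.
by apply/funext => t; rewrite sqr_sqrtr// sumr_ge0// => i _; rewrite -expr2 sqr_ge0.
Qed.

End tuple_measurability.

Lemma measurable_cos (R : realType) : measurable_fun setT (@cos R).
Proof. by apply: continuous_measurable_fun; exact: continuous_cos. Qed.

Section cons_pair_vectors.
Context (R : realType) (n : nat).
Implicit Types (z w : R * n.-tuple R).

Lemma cons_pair_surj (x : n.+1.-tuple R) :
  x = cons_pair (thead x, [tuple of behead x]).
Proof. by rewrite {1}(tuple_eta x); apply/val_inj. Qed.

Lemma tnth_cons_pair0 z : tnth (cons_pair z) ord0 = z.1.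
Proof. by []. Qed.

Lemma tnth_cons_pairS z i : tnth (cons_pair z) (lift ord0 i) = tnth z.2 i.
Proof. by rewrite /cons_pair tnthS. Qed.

Lemma addv_cons z w : addv (cons_pair z) (cons_pair w) = cons_pair (z.1 + w.1, addv z.2 w.2).
Proof.
apply: eq_from_tnth => i; rewrite tnth_mktuple.
case: (unliftP ord0 i) => [j ->|->]; rewrite ?tnth_cons_pairS ?tnth_cons_pair0//=.
by rewrite tnth_mktuple.
Qed.

Lemma subv_cons z w : subv (cons_pair z) (cons_pair w) = cons_pair (z.1 - w.1, subv z.2 w.2).
Proof.
apply: eq_from_tnth => i; rewrite tnth_mktuple.
case: (unliftP ord0 i) => [j ->|->]; rewrite ?tnth_cons_pairS ?tnth_cons_pair0//=.
by rewrite tnth_mktuple.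
Qed.

Lemma scalev_cons c z : scalev c (cons_pair z) = cons_pair (c * z.1, scalev c z.2).
Proof.
apply: eq_from_tnth => i; rewrite tnth_mktuple.
case: (unliftP ord0 i) => [j ->|->]; rewrite ?tnth_cons_pairS ?tnth_cons_pair0//=.
by rewrite tnth_mktuple.
Qed.

Lemma dotv_cons z w : dotv (cons_pair z) (cons_pair w) = z.1 * w.1 + dotv z.2 w.2.
Proof.
rewrite /dotv big_ord_recl !tnth_cons_pair0; congr (_ + _).
by apply: eq_bigr => i _; rewrite !tnth_cons_pairS.
Qed.

End cons_pair_vectors.

Lemma enorm2E (R : realType) n (x : n.-tuple R) : enorm x ^+ 2 = dotv x x.
Proof. by rewrite sqr_sqrtr// sumr_ge0// => i _; rewrite -expr2 sqr_ge0. Qed.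

Section lebesgue_tuples.
Context (R : realType).
Notation RM := (measurableTypeR R).
Notation leb := (@lebesgue_measure R : {sigma_finite_measure set RM -> \bar R}).
Notation lebn := (lebesgue R).

(* [cons_pair] with its domain equipped with the product of the sigma-algebras of
   [lebesgue_measure] and of tuples *)
Definition consv n (z : RM * n.-tuple R) : n.+1.-tuple R := cons_pair z.

Lemma measurable_consv n : measurable_fun setT (@consv n).
Proof. exact: measurable_cons_pair. Qed.

Lemma ge0_integral_lebesgueS n (f : n.+1.-tuple R -> \bar R) :
  measurable_fun setT f -> (forall x, 0 <= f x)%E ->
  (\int[lebn n.+1]_x f x = \int[leb \x lebn n]_z f (consv z))%E.
Proof.
move=> mf f0.
exact: (ge0_integral_pushforward (@measurable_consv n) (leb \x lebn n)%E
  measurableT mf (fun y _ => f0 y)).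
Qed.

Lemma integral_lebesgueS n (f : n.+1.-tuple R -> \bar R) :
  measurable_fun setT f ->
  (\int[lebn n.+1]_x f x = \int[leb \x lebn n]_z f (consv z))%E.
Proof.
move=> mf; rewrite integralE [RHS]integralE.
rewrite !ge0_integral_lebesgueS//; [|exact: measurable_funeneg|exact: measurable_funepos].
by congr (_ - _)%E; apply: eq_integral => z _; rewrite ?funeposE ?funenegE.
Qed.

Lemma integrable_lebesgueS n (f : n.+1.-tuple R -> R) :
  (lebn n.+1).-integrable setT (EFin \o f) <->
  (leb \x lebn n)%E.-integrable setT (EFin \o (fun z => f (consv z))) /\
  measurable_fun setT f.
Proof.
split => [/integrableP[mf fi]|[/integrableP[_ fi] mf]].
  split; last exact/measurable_EFinP.
  apply/integrableP; split; first by apply: measurableT_comp mf _; exact: measurable_consv.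
  by move: fi; rewrite ge0_integral_lebesgueS//; exact: measurableT_comp.
apply/integrableP; split; first exact/measurable_EFinP.
by rewrite ge0_integral_lebesgueS//; do 2 apply: measurableT_comp => //.
Qed.

Lemma Rintegral_lebesgueS n (f : n.+1.-tuple R -> R) :
  (lebn n.+1).-integrable setT (EFin \o f) ->
  \int[lebn n.+1]_x f x = \int[leb]_u (\int[lebn n]_v f (consv (u, v))).
Proof.
move=> /[dup] fi /integrable_lebesgueS[fi' mf].
rewrite -(Rintegral_prod1 fi') /Rintegral integral_lebesgueS//.
exact/measurable_EFinP.
Qed.

Lemma integral_lebesgue0 (f : 0.-tuple R -> \bar R) :
  measurable_fun setT f -> (\int[lebn 0]_x f x = f [tuple])%E.
Proof. by move=> mf; rewrite integral_dirac// diracT mul1e. Qed.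

(* Translations and dilations are handled together: the substitution is
   [x |-> c x + v] with [c > 0]. *)
Lemma ge0_integral_affinev n (c : R) (v : n.-tuple R) (f : n.-tuple R -> \bar R) :
  0 < c -> measurable_fun setT f -> (forall x, 0 <= f x)%E ->
  (\int[lebn n]_x f (addv (scalev c x) v) = (c ^- n)%:E * \int[lebn n]_x f x)%E.
Proof.
move=> c0; elim: n v f => [|n IH] v f mf f0.
  rewrite !integral_lebesgue0//.
    by rewrite expr0 invr1 mul1e; congr f; apply: eq_from_tnth => -[].
  apply: measurableT_comp mf _; apply: measurable_addv => //.
  exact: measurable_scalev.
have maff k (w : k.-tuple R) : measurable_fun setT (fun x => addv (scalev c x) w).
  by apply: measurable_addv => //; exact: measurable_scalev.
have mfc : measurable_fun setT (f \o @consv n).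
  by apply: measurableT_comp mf _; exact: measurable_consv.
rewrite !ge0_integral_lebesgueS//; last exact: measurableT_comp mf (maff _ _).
rewrite (cons_pair_surj v); move: (thead v) => v0; set v' := [tuple of behead v].
rewrite !fubini_tonelli1//=; last first.
  by apply: measurableT_comp (measurableT_comp mf (maff _ _)) _; exact: measurable_consv.
rewrite /fubini_F /=.
(* The induction hypothesis treats the tail and gives c^-n; the substitution in the head gives the
   last c^-1. *)
under eq_integral => u _.
  under eq_integral do rewrite /consv scalev_cons addv_cons /=.
  rewrite (IH v' (fun y => f (consv (c * u + v0, y))))//; last first.
    by apply: (measurableT_comp mfc); exact: measurable_pair1.
  over.
pose g (u : RM) := (\int[lebn n]_y f (consv (u, y)))%E.
have mg : measurable_fun setT g.
  exact: (@measurable_fun_fubini_tonelli_F _ _ RM _ _ (lebn n) (f \o @consv n) mfc (fun z => f0 _)).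
have g0 u : (0 <= g u)%E by exact: integral_ge0.
transitivity (\int[leb]_u ((c ^- n)%:E * g (c * u + v0)%R))%E => //.
rewrite ge0_integralZl//; last 2 first.
- apply: (measurableT_comp mg).
  by apply: measurable_funD => //; exact: measurable_funM.
- by rewrite lee_fin invr_ge0 exprn_ge0// ltW.
by rewrite (ge0_integral_affine v0 c0 mg g0) muleA -EFinM -invfM -exprSr.
Qed.

End lebesgue_tuples.

Section affine_corollaries.
Context (R : realType).
Notation RM := (measurableTypeR R).
Notation leb := (@lebesgue_measure R).
Notation lebn := (lebesgue R).

Lemma measurable_affinev n (c : R) (v : n.-tuple R) :
  measurable_fun setT (fun x => addv (scalev c x) v).
Proof. by apply: measurable_addv => //; exact: measurable_scalev. Qed.

Lemma integrable_affinev n (c : R) (v : n.-tuple R) (f : n.-tuple R -> R) : 0 < c ->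
  (lebn n).-integrable setT (EFin \o f) ->
  (lebn n).-integrable setT (EFin \o (fun x => f (addv (scalev c x) v))).
Proof.
move=> c0 fi; have mf := integrable_measurable fi.
apply/integrableP; split.
  by apply/measurable_EFinP; exact: (measurableT_comp mf (measurable_affinev c v)).
rewrite (@ge0_integral_affinev _ _ c v (fun x => `|(f x)%:E|%E))//; last first.
  by apply: measurableT_comp => //; exact/measurable_EFinP.
case/integrableP : fi => _ fo.
by rewrite lte_mul_pinfty// lee_fin invr_ge0 exprn_ge0// ltW.
Qed.

Lemma Rintegral_affinev n (c : R) (v : n.-tuple R) (f : n.-tuple R -> R) : 0 < c ->
  (lebn n).-integrable setT (EFin \o f) ->
  \int[lebn n]_x f (addv (scalev c x) v) = c ^- n * \int[lebn n]_x f x.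
Proof.
move=> c0 fi; have /measurable_int mf := fi.
apply: EFin_inj; rewrite EFinM !EFin_Rintegral//; last exact: integrable_affinev.
rewrite integralE [in RHS]integralE.
have E g : measurable_fun setT g -> (forall x, 0 <= g x)%E ->
    (\int[lebn n]_x g (addv (scalev c x) v) = (c ^- n)%:E * \int[lebn n]_x g x)%E.
  exact: ge0_integral_affinev.
rewrite muleBr//; last first.
  by rewrite fin_num_adde_defr// integrable_fin_num//; exact: integrable_funepos.
rewrite -!E//; [|exact: measurable_funeneg|exact: measurable_funepos].
by congr (_ - _)%E; apply: eq_integral => x _; rewrite ?funeposE ?funenegE.
Qed.

Lemma scale1v n (x : n.-tuple R) : scalev 1 x = x.
Proof. by apply: eq_from_tnth => i; rewrite tnth_mktuple mul1r. Qed.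

Lemma ge0_integral_addv n (v : n.-tuple R) (f : n.-tuple R -> \bar R) :
  measurable_fun setT f -> (forall x, 0 <= f x)%E ->
  (\int[lebn n]_x f (addv x v) = \int[lebn n]_x f x)%E.
Proof.
move=> mf f0; have := ge0_integral_affinev v ltr01 mf f0.
by rewrite expr1n invr1 mul1e => <-; apply: eq_integral => x _; rewrite scale1v.
Qed.

Lemma integrable_addv n (v : n.-tuple R) (f : n.-tuple R -> R) :
  (lebn n).-integrable setT (EFin \o f) ->
  (lebn n).-integrable setT (EFin \o (fun x => f (addv x v))).
Proof.
move=> fi; have := integrable_affinev v ltr01 fi.
by apply: eq_integrable => // x _ /=; rewrite scale1v.
Qed.

Lemma Rintegral_addv n (v : n.-tuple R) (f : n.-tuple R -> R) :
  (lebn n).-integrable setT (EFin \o f) ->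
  \int[lebn n]_x f (addv x v) = \int[lebn n]_x f x.
Proof.
move=> fi; have := Rintegral_affinev v ltr01 fi.
by rewrite expr1n invr1 mul1r => <-; apply: eq_Rintegral => x _; rewrite scale1v.
Qed.

Lemma integrable_affine (c b : R) (f : R -> R) : 0 < c ->
  leb.-integrable setT (EFin \o f) ->
  leb.-integrable setT (EFin \o (fun x => f (c * x + b))).
Proof.
move=> c0 fi; have mf := integrable_measurable fi.
apply/integrableP; split.
  apply/measurable_EFinP; apply: (measurableT_comp mf).
  by apply: measurable_funD => //; exact: measurable_funM.
rewrite (@ge0_integral_affine _ c b (fun x => `|(f x)%:E|%E))//; last first.
  by apply: measurableT_comp => //; exact/measurable_EFinP.
case/integrableP : fi => _ fo.
by rewrite lte_mul_pinfty// lee_fin invr_ge0 ltW.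
Qed.

Lemma Rintegral_affine (c b : R) (f : R -> R) : 0 < c ->
  leb.-integrable setT (EFin \o f) ->
  \int[leb]_x f (c * x + b) = c^-1 * \int[leb]_x f x.
Proof.
move=> c0 fi; have /measurable_int mf := fi.
apply: EFin_inj; rewrite EFinM !EFin_Rintegral//; last exact: integrable_affine.
rewrite integralE [in RHS]integralE.
rewrite muleBr//; last first.
  by rewrite fin_num_adde_defr// integrable_fin_num//; exact: integrable_funepos.
rewrite -!(ge0_integral_affine b c0)//; [|exact: measurable_funeneg|exact: measurable_funepos].
by congr (_ - _)%E; apply: eq_integral => x _; rewrite ?funeposE ?funenegE.
Qed.

End affine_corollaries.

(** * Fourier transform of the Gaussian *)

Section gaussian_line.
Context (R : realType).
Notation leb := (@lebesgue_measure R).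

(** The fundamental theorem on [-n, n], followed by dominated convergence. *)
Lemma Rintegral_derive_line (H h : R -> R) (l l' : R) :
  (forall x : R, is_derive x (1 : R) H (h x)) -> continuous h ->
  leb.-integrable setT (EFin \o h) ->
  H n%:R @[n --> \oo] --> l -> H (- n%:R) @[n --> \oo] --> l' ->
  \int[leb]_x h x = l - l'.
Proof.
move=> dH ch ih Hl Hl'.
have mh := integrable_measurable ih.
have cv : \int[leb]_(x in `[- n%:R, n%:R]) h x @[n --> \oo] --> \int[leb]_x h x.
  under eq_fun do rewrite Rintegral_mkcond.
  apply: (@Rintegral_dominated_cvg _ _ _ leb (fun n => h \_ `[- n%:R, n%:R]%classic)
            h (fun x => `|h x|)) => //.
  - by move=> n; apply/(measurable_restrictT h) => //; exact: measurable_funTS.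
  - move=> x; apply: cvg_near_cst.
    near=> n; rewrite patchE mem_set//= in_itv/= -ler_norml.
    near: n; exact: nbhs_infty_ger.
  - exact: integrable_norm.
  - by move=> n x; rewrite patchE; case: ifPn => // _; rewrite normr0.
have cv2 : \int[leb]_(x in `[- n%:R, n%:R]) h x @[n --> \oo] --> l - l'.
  apply: cvg_trans (cvgB Hl Hl'); apply: near_eq_cvg; near=> n.
  have n0 : (0 < n%:R :> R) by rewrite ltr0n; near: n; exists 1%N.
  rewrite /Rintegral (@continuous_FTC2 _ h H)//.
  - by rewrite (lt_trans _ n0)// oppr_lt0.
  - exact: continuous_subspaceT.
  - have cH : continuous H.
      move=> x; apply: differentiable_continuous; apply/derivable1_diffP.
      by have [] := dH x.
    split; first by move=> x _; have [] := dH x.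
      by apply: cvg_at_right_filter; exact: cH.
    by apply: cvg_at_left_filter; exact: cH.
  - by move=> x _; rewrite derive1E; have [] := dH x.
exact: (cvg_unique _ cv cv2).
Unshelve. all: by end_near. Qed.

Lemma gauss_fun_cvg0 : gauss_fun (n%:R : R) @[n --> \oo] --> (0 : R).
Proof.
apply: (cvg_comp (fun n : nat => n%:R : R) (@gauss_fun R) _ (@cvg_gauss_fun R)).
exact: cvgr_idn.
Qed.

Lemma integrable_id_gauss : leb.-integrable setT (EFin \o (fun x : R => `|x| * gauss_fun x)).
Proof.
(* The majorant is exp (- x^2 / 2), because |x| <= 1 + x^2 / 2 <= exp (x^2 / 2). *)
have i2 : leb.-integrable setT (EFin \o (fun x : R => gauss_fun ((Num.sqrt 2)^-1 * x + 0))).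
  apply: integrable_affine; last exact: integrableT_gauss.
  by rewrite invr_gt0 sqrtr_gt0.
apply: (integrable_le _ i2) => [|x].
  by apply: measurable_funM => //; exact: measurable_gauss_fun.
rewrite ger0_norm ?mulr_ge0 ?gauss_fun_ge0// /gauss_fun addr0 exprMn exprVn sqr_sqrtr//.
rewrite [in leRHS](_ : - (_ * _) = 2^-1 * x ^+ 2 + (- x ^+ 2)); last by field.
rewrite expRD ler_wpM2r ?expR_ge0//.
apply: le_trans (expR_ge1Dx _).
have := sqr_ge0 (`|x| - 1); rewrite sqrrB real_normK ?num_real// expr1n mulr1.
lra.
Qed.

Definition gauss_cos (th k : R) : R := \int[leb]_x (gauss_fun x * cos (k * x + th)).

Lemma measurable_affine_fun (k th : R) : measurable_fun setT (fun x : R => k * x + th).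
Proof. by apply: measurable_funD => //; exact: measurable_funM. Qed.

Lemma measurable_cos_affine (k th : R) : measurable_fun setT (fun x : R => cos (k * x + th)).
Proof. by apply: (measurableT_comp (@measurable_cos R)); exact: measurable_affine_fun. Qed.

Lemma integrable_gauss_cos th k :
  leb.-integrable setT (EFin \o (fun x => gauss_fun x * cos (k * x + th))).
Proof.
apply: (integrable_mulb (M := 1)); [exact: measurable_cos_affine|exact: integrableT_gauss|].
by move=> x; exact: cos_max.
Qed.

Lemma is_derive_gauss_sin th k (x : R) :
  is_derive x (1 : R) (fun x : R => gauss_fun x * sin (k * x + th))
    (k * (gauss_fun x * cos (k * x + th)) - 2 * (x * gauss_fun x * sin (k * x + th))).
Proof.
rewrite /gauss_fun.
apply: is_derive_eq; rewrite /GRing.scale /=.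
ring.
Qed.

Lemma is_derive_gauss_cos_integrand th (y k : R) :
  is_derive k (1 : R) (fun k : R => gauss_fun y * cos (k * y + th))
    (- (y * gauss_fun y * sin (k * y + th))).
Proof.
apply: is_derive_eq; rewrite /GRing.scale /=.
ring.
Qed.

Lemma integrable_id_gauss_sin th k : leb.-integrable setT
  (EFin \o (fun x : R => x * gauss_fun x * sin (k * x + th))).
Proof.
apply: (integrable_le _ integrable_id_gauss) => [|x].
  apply: measurable_funM; first by apply: measurable_funM => //; exact: measurable_gauss_fun.
  apply: measurableT_comp; last exact: measurable_affine_fun.
  by apply: continuous_measurable_fun; exact: continuous_sin.
rewrite !normrM (ger0_norm (gauss_fun_ge0 _)) ler_piMr ?mulr_ge0 ?gauss_fun_ge0//.
exact: sin_max.
Qed.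

(* Integrating the derivative of [x |-> exp (- x^2) sin (k x + th)] over the line. *)
Lemma Rintegral_id_gauss_sin th k :
  \int[leb]_x (x * gauss_fun x * sin (k * x + th)) = k / 2 * gauss_cos th k.
Proof.
have i1 := integrable_scale k (integrable_gauss_cos th k).
have i2 := integrable_scale 2 (integrable_id_gauss_sin th k).
have bd (s : R) : `|gauss_fun s * sin (k * s + th)| <= gauss_fun s.
  by rewrite normrM (ger0_norm (gauss_fun_ge0 _)) ler_piMr ?gauss_fun_ge0// sin_max.
have /(_ 0 0) := Rintegral_derive_line (is_derive_gauss_sin th k).
rewrite RintegralB// RintegralZl//; last exact: integrable_gauss_cos.
rewrite RintegralZl//; last exact: integrable_id_gauss_sin.
rewrite -/(gauss_cos th k) subr0 => E; suff: k * gauss_cos th k -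
  2 * \int[leb]_x (x * gauss_fun x * sin (k * x + th)) = 0 by lra.
apply: E.
- move=> x; apply: differentiable_continuous.
  by apply/derivable1_diffP; rewrite /gauss_fun; apply: ex_derive.
- exact: integrable_sub.
- apply: norm_cvg0.
  apply: (@squeeze_cvgr _ _ _ _ (cst 0) (fun n => gauss_fun (n%:R : R))).
  + by near=> n; rewrite normr_ge0 bd.
  + exact: cvg_cst.
  + exact: gauss_fun_cvg0.
- apply: norm_cvg0.
  apply: (@squeeze_cvgr _ _ _ _ (cst 0) (fun n => gauss_fun (n%:R : R))).
  + near=> n; rewrite normr_ge0 (le_trans (bd _))//.
    by rewrite /gauss_fun sqrrN.
  + exact: cvg_cst.
  + exact: gauss_fun_cvg0.
Unshelve. all: by end_near. Qed.

(** Differentiating under the integral produces a first-moment integral, which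
    [Rintegral_id_gauss_sin] turns back into [gauss_cos]: a linear differential equation in [k]. *)
Lemma is_derive_gauss_cos th (k : R) :
  is_derive k (1 : R) (gauss_cos th) (- (k / 2 * gauss_cos th k)).
Proof.
pose f (k y : R) : R := gauss_fun y * cos (k * y + th).
have dE (k' y : R) : partial1of2 f k' y = - (y * gauss_fun y * sin (k' * y + th)).
  by rewrite partial1of2E; apply: derive_val; exact: is_derive_gauss_cos_integrand.
(* Any radius would do, since the majorant |y| exp (- y^2) of the partial derivative does not depend
   on [k]. *)
have kI : `]k - 1, k + 1[%classic k by rewrite /= in_itv/=; apply/andP; split; lra.
have if_ k' : `]k - 1, k + 1[%classic k' -> leb.-integrable setT (EFin \o f k').
  by move=> _; exact: integrable_gauss_cos.
have df k' y : `]k - 1, k + 1[%classic k' -> setT y -> derivable (f ^~ y) k' 1.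
  by move=> _ _; have [] := is_derive_gauss_cos_integrand th y k'.
have G0 (y : R) : 0 <= `|y| * gauss_fun y by rewrite mulr_ge0// gauss_fun_ge0.
have Gub k' y : `]k - 1, k + 1[%classic k' -> setT y ->
    `|partial1of2 f k' y| <= `|y| * gauss_fun y.
  move=> _ _; rewrite dE normrN !normrM (ger0_norm (gauss_fun_ge0 _)).
  by rewrite ler_piMr ?mulr_ge0 ?gauss_fun_ge0//; exact: sin_max.
apply: DeriveDef.
  exact: (derivable_under_integral measurableT kI if_ df G0 integrable_id_gauss Gub).
rewrite -derive1E.
rewrite (differentiation_under_integral measurableT kI if_ df G0 integrable_id_gauss Gub).
rewrite -Rintegral_id_gauss_sin -mulN1r -RintegralZl//; last first.
  exact: integrable_id_gauss_sin.
by apply: eq_Rintegral => y _; rewrite dE mulN1r.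
Qed.

(** The equation G' = - (k / 2) G makes G exp (k^2 / 4) constant, and its value at 0 is the Gauss
    integral times cos th. *)
Lemma gauss_cosE th k : gauss_cos th k = Num.sqrt pi * expR (- (k ^+ 2 / 4)) * cos th.
Proof.
have E : gauss_cos th k * expR (k ^+ 2 / 4) = gauss_cos th 0 * expR (0 ^+ 2 / 4).
  apply: (@is_derive_0_is_cst _ (fun k => gauss_cos th k * expR (k ^+ 2 / 4))) => x.
  have d1 := is_derive_gauss_cos th x.
  apply: is_derive_eq; rewrite /GRing.scale /=.
  by field.
have E0 : gauss_cos th 0 = Num.sqrt pi * cos th.
  rewrite /gauss_cos; under eq_Rintegral do rewrite mul0r add0r.
  rewrite RintegralZr//; last exact: integrableT_gauss.
  by congr (_ * _); rewrite /Rintegral integralT_gauss.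
move: E; rewrite E0 expr0n/= mul0r expR0 mulr1 => E.
by rewrite mulrAC -E expRN mulfK// gt_eqF// expR_gt0.
Qed.

End gaussian_line.

Section dot_product.
Context (R : realType) (n : nat).
Implicit Types x y z : n.-tuple R.

Lemma dotvC x y : dotv x y = dotv y x.
Proof. by apply: eq_bigr => i _; rewrite mulrC. Qed.

Lemma dotvDl x y z : dotv (addv x y) z = dotv x z + dotv y z.
Proof. by rewrite -big_split; apply: eq_bigr => i _ /=; rewrite tnth_mktuple mulrDl. Qed.

Lemma dotvDr x y z : dotv x (addv y z) = dotv x y + dotv x z.
Proof. by rewrite dotvC dotvDl !(dotvC x). Qed.

Lemma dotvBl x y z : dotv (subv x y) z = dotv x z - dotv y z.
Proof. by rewrite -sumrB; apply: eq_bigr => i _ /=; rewrite tnth_mktuple mulrBl. Qed.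

Lemma dotvBr x y z : dotv x (subv y z) = dotv x y - dotv x z.
Proof. by rewrite dotvC dotvBl !(dotvC x). Qed.

Lemma dotvZl c x y : dotv (scalev c x) y = c * dotv x y.
Proof. by rewrite mulr_sumr; apply: eq_bigr => i _ /=; rewrite tnth_mktuple mulrA. Qed.

Lemma dotvZr c x y : dotv x (scalev c y) = c * dotv x y.
Proof. by rewrite dotvC dotvZl dotvC. Qed.

Definition dotvE := (dotvDl, dotvDr, dotvBl, dotvBr, dotvZl, dotvZr).

End dot_product.

Section gaussian_density_theory.
Context (R : realType).
Notation leb := (@lebesgue_measure R).
Notation lebn := (lebesgue R).
Implicit Types (a : R).

Definition gaussian_line a (u : R) : R := (a * pi) `^ (- (1 / 2)) * expR (- (u ^+ 2 / a)).

Lemma gaussian_density_cons n a u (v : n.-tuple R) : 0 < a ->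
  gaussian_density a (cons_pair (u, v)) = gaussian_line a u * gaussian_density a v.
Proof.
move=> a0; rewrite /gaussian_density /gaussian_line !enorm2E dotv_cons /=.
rewrite mulrACA -expRD -powRD; last first.
  by apply/implyP => _; rewrite gt_eqF// mulr_gt0// pi_gt0.
congr (_ `^ _ * expR _); last by rewrite -expr2 mulrDl opprD.
by rewrite -[n.+1]addn1 natrD mulrDl opprD addrC.
Qed.

Lemma gaussian_density_ge0 n a (x : n.-tuple R) : 0 <= gaussian_density a x.
Proof. by rewrite mulr_ge0 ?powR_ge0 ?expR_ge0. Qed.

Lemma measurable_gaussian_density n a :
  measurable_fun setT (@gaussian_density R n a).
Proof.
apply: measurable_funM => //; apply: measurableT_comp => //.
apply: measurableT_comp => //; apply: measurable_funM => //.
exact: measurable_enorm2.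
Qed.

Lemma gaussian_lineE a u : 0 < a ->
  gaussian_line a u = (Num.sqrt (a * pi))^-1 * gauss_fun ((Num.sqrt a)^-1 * u + 0).
Proof.
move=> a0; have ap0 : 0 <= a * pi by rewrite mulr_ge0 ?pi_ge0// ltW.
rewrite /gaussian_line /gauss_fun powRN div1r powR12_sqrt//.
by rewrite addr0 exprMn exprVn sqr_sqrtr ?ltW// [u ^+ 2 / a]mulrC.
Qed.

Lemma integrable_gaussian_line a : 0 < a -> leb.-integrable setT (EFin \o gaussian_line a).
Proof.
move=> a0; rewrite (_ : gaussian_line a = fun u =>
  (Num.sqrt (a * pi))^-1 * gauss_fun ((Num.sqrt a)^-1 * u + 0)).
  apply: integrable_scale; apply: integrable_affine; last exact: integrableT_gauss.
  by rewrite invr_gt0 sqrtr_gt0.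
by apply/funext => u; rewrite gaussian_lineE.
Qed.

Lemma Rintegral_gaussian_line_cos a l th : 0 < a ->
  \int[leb]_u (gaussian_line a u * cos (2 * pi * (u * l) + th)) =
  expR (- (a * pi ^+ 2 * l ^+ 2)) * cos th.
Proof.
move=> a0; have sa0 : 0 < Num.sqrt a by rewrite sqrtr_gt0.
(* Frequency after the substitution u = sqrt a x; it satisfies k^2 / 4 = a pi^2 l^2. *)
pose k := 2 * pi * l * Num.sqrt a.
transitivity (\int[leb]_u ((Num.sqrt (a * pi))^-1 *
   (gauss_fun ((Num.sqrt a)^-1 * u + 0) * cos (k * ((Num.sqrt a)^-1 * u + 0) + th)))).
  apply: eq_Rintegral => u _; rewrite gaussian_lineE// -[LHS]mulrA; congr (_ * (_ * cos (_ + _))).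
  by rewrite /k addr0; field; rewrite gt_eqF.
have isa0 : 0 < (Num.sqrt a)^-1 by rewrite invr_gt0.
rewrite RintegralZl//; last first.
  exact: (integrable_affine 0 isa0 (integrable_gauss_cos th k)).
rewrite (Rintegral_affine 0 isa0 (integrable_gauss_cos th k)).
rewrite -/(gauss_cos th k) gauss_cosE invrK !mulrA sqrtrM ?ltW//.
have sp0 : 0 < Num.sqrt (pi : R) by rewrite sqrtr_gt0 pi_gt0.
rewrite [X in X * expR _ * _](_ : _ = 1); last first.
  by field; rewrite !gt_eqF.
rewrite mul1r; congr (expR (- _) * _).
rewrite /k !exprMn sqr_sqrtr ?ltW//.
by field.
Qed.

Lemma integrable_gaussian_density n a : 0 < a ->
  (lebn n).-integrable setT (EFin \o @gaussian_density R n a).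
Proof.
move=> a0; elim: n => [|n IH].
  have mg : measurable_fun setT (EFin \o @gaussian_density R 0 a).
    by apply/measurable_EFinP; apply: measurable_gaussian_density.
  apply/integrableP; split; first exact: mg.
  have mg' : measurable_fun setT (fun x : 0.-tuple R => `|(gaussian_density a x)%:E|%E).
    exact: (measurableT_comp (@abse_measurable R setT) mg).
  by rewrite (integral_lebesgue0 mg') ltry.
apply/integrable_lebesgueS; split; last exact: measurable_gaussian_density.
have := integrable_tensor (integrable_gaussian_line a0) IH.
by apply: eq_integrable => // -[u v] _ /=; rewrite /consv gaussian_density_cons.
Qed.

Lemma measurable_cos_dotv n c (l : n.-tuple R) th :
  measurable_fun setT (fun x : n.-tuple R => cos (c * dotv x l + th)).
Proof.
apply: (measurableT_comp (@measurable_cos R)); apply: measurable_funD => //.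
by apply: measurable_funM => //; exact: measurable_dotv.
Qed.

Lemma integrable_gaussian_density_cos n a (l : n.-tuple R) th : 0 < a ->
  (lebn n).-integrable setT (EFin \o (fun x : n.-tuple R =>
    gaussian_density a x * cos (2 * pi * dotv x l + th))).
Proof.
move=> a0; apply: (integrable_mulb (M := 1)).
- exact: measurable_cos_dotv.
- exact: integrable_gaussian_density.
- by move=> x; exact: cos_max.
Qed.

(** Induction on the dimension: the first coordinate adds 2 pi u l0 to the phase of the integral
    over the others, which is why [th] must be arbitrary. *)
Lemma Rintegral_gaussian_density_cos n a (l : n.-tuple R) th : 0 < a ->
  \int[lebn n]_x (gaussian_density a x * cos (2 * pi * dotv x l + th)) =
  expR (- (a * pi ^+ 2 * enorm l ^+ 2)) * cos th.
Proof.
move=> a0; elim: n l th => [|n IH] l th.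
  rewrite /Rintegral integral_lebesgue0/=; last first.
    by apply/measurable_EFinP; apply: integrable_measurable;
       exact: integrable_gaussian_density_cos.
  rewrite /gaussian_density !enorm2E /dotv !big_ord0.
  by rewrite !(mul0r, mulr0, oppr0, powRr0, expR0, mul1r, add0r).
rewrite (Rintegral_lebesgueS (integrable_gaussian_density_cos l th a0)).
rewrite (cons_pair_surj l); move: (thead l) => l0; set l' := [tuple of behead l].
rewrite [in RHS](_ : expR _ = expR (- (a * pi ^+ 2 * l0 ^+ 2)) *
    expR (- (a * pi ^+ 2 * enorm l' ^+ 2))); last first.
  by rewrite !enorm2E dotv_cons -expRD /=; congr expR; ring.
transitivity (\int[leb]_u ((gaussian_line a u * cos (2 * pi * (u * l0) + th)) *
    expR (- (a * pi ^+ 2 * enorm l' ^+ 2)))).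
  apply: eq_Rintegral => u _.
  transitivity (gaussian_line a u * \int[lebn n]_v
      (gaussian_density a v * cos (2 * pi * dotv v l' + (2 * pi * (u * l0) + th)))).
    rewrite -RintegralZl//; last exact: integrable_gaussian_density_cos.
    apply: eq_Rintegral => v _; rewrite /consv gaussian_density_cons// -mulrA.
    by rewrite dotv_cons /= mulrDr; congr (_ * (_ * cos _)); ring.
  by rewrite IH mulrA mulrAC.
rewrite RintegralZr//.
  by rewrite Rintegral_gaussian_line_cos// mulrAC mulrA.
apply: (integrable_mulb (M := 1)).
- apply: (measurableT_comp (@measurable_cos R)); apply: measurable_funD => //.
  by apply: measurable_funM => //; exact: measurable_funM.
- exact: integrable_gaussian_line.
- by move=> x; exact: cos_max.
Qed.

Lemma Rintegral_gaussian_density n a : 0 < a ->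
  \int[lebn n]_x (gaussian_density a x) = 1.
Proof.
move=> a0; have := Rintegral_gaussian_density_cos (scalev 0 [tuple 0 | i < n]) 0 a0.
rewrite cos0 enorm2E dotvZl mul0r mulr0 oppr0 expR0 mul1r => <-.
by apply: eq_Rintegral => x _; rewrite dotvZr mul0r mulr0 addr0 cos0 mulr1.
Qed.

(** The parallelogram law around the midpoint: |x - z|^2 + |y - z|^2 = 2 |(x + y)/2 - z|^2 + |x -
    y|^2 / 2. The normalizations match because (a / 2)(2 a) = a^2. *)
Lemma gaussian_density_mul n a (x y z : n.-tuple R) : 0 < a ->
  gaussian_density a (subv x z) * gaussian_density a (subv y z) =
  gaussian_density (a / 2) (subv (scalev 2^-1 (addv x y)) z) *
  gaussian_density (2 * a) (subv x y).
Proof.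
move=> a0; have p0 : 0 < (pi : R) := pi_gt0 R.
rewrite /gaussian_density !enorm2E.
rewrite mulrACA [in RHS]mulrACA -!expRD -!powRM; last 4 first.
  by rewrite mulr_ge0 ?pi_ge0// divr_ge0// ltW.
  by rewrite !mulr_ge0 ?pi_ge0// ltW.
  by rewrite mulr_ge0 ?pi_ge0// ltW.
  by rewrite mulr_ge0 ?pi_ge0// ltW.
congr (_ `^ _ * expR _); first by field.
rewrite !dotvE (dotvC y x) (dotvC z x) (dotvC z y).
by field; rewrite gt_eqF.
Qed.

Lemma gaussian_density_scale n a r (x : n.-tuple R) : 0 < a -> 0 < r ->
  gaussian_density a (scalev r x) * r ^+ n = gaussian_density (a / r ^+ 2) x.
Proof.
move=> a0 r0; have p0 : 0 < (pi : R) := pi_gt0 R.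
rewrite /gaussian_density !enorm2E dotvZl dotvZr mulrAC; congr (_ * expR (- _)).
  rewrite (_ : a / r ^+ 2 * pi = a * pi * r `^ (- 2)).
    rewrite [RHS]powRM ?powR_ge0// ?mulr_ge0 ?ltW//; congr (_ * _).
    rewrite -powRrM -powR_mulrn ?ltW//; congr (_ `^ _).
    by field.
  by rewrite powRN -[2%R]/(2%:R) powR_mulrn ?ltW//; field; rewrite gt_eqF.
by field; rewrite !gt_eqF.
Qed.

Lemma integrable_exp_enorm n c : 0 < c ->
  (lebn n).-integrable setT (EFin \o (fun x : n.-tuple R => expR (- (c * enorm x ^+ 2)))).
Proof.
move=> c0; have ic0 : 0 < c^-1 by rewrite invr_gt0.
have := integrable_scale ((c^-1 * pi) `^ (n%:R / 2)) (integrable_gaussian_density n ic0).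
apply: eq_integrable => // x _ /=; rewrite /gaussian_density mulrA -powRD; last first.
  by apply/implyP => _; rewrite gt_eqF// mulr_gt0// pi_gt0.
by rewrite subrr powRr0 mul1r invrK [X in expR (- X)]mulrC.
Qed.

Lemma Rintegral_exp_enorm_cos n e (x : n.-tuple R) th : 0 < e ->
  \int[lebn n]_l (expR (- (e * pi ^+ 2 * enorm l ^+ 2)) * cos (2 * pi * dotv l x + th)) =
  gaussian_density e x * cos th.
Proof.
move=> e0; have p0 : 0 < (pi : R) := pi_gt0 R.
(* exp (- e pi^2 |l|^2) is a multiple of the Gaussian density with parameter [b], whose transform is
   already known. *)
pose b := (e * pi ^+ 2)^-1.
have b0 : 0 < b by rewrite invr_gt0 mulr_gt0// exprn_gt0.
transitivity (\int[lebn n]_l ((b * pi) `^ (n%:R / 2) *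
   (gaussian_density b l * cos (2 * pi * dotv l x + th)))).
  apply: eq_Rintegral => l _; rewrite mulrA; congr (_ * _).
  rewrite /gaussian_density mulrA -powRD; last first.
    by apply/implyP => _; rewrite gt_eqF// mulr_gt0.
  by rewrite subrr powRr0 mul1r invrK [X in expR (- X)]mulrC.
rewrite RintegralZl//; last exact: integrable_gaussian_density_cos.
rewrite Rintegral_gaussian_density_cos// mulrA; congr (_ * _).
rewrite /gaussian_density; congr (_ * expR (- _)); last first.
  by rewrite /b; move: (pi : R) p0 => p p0; field; rewrite !gt_eqF.
rewrite (_ : b * pi = (e * pi)^-1); last first.
  by rewrite /b; move: (pi : R) p0 => p p0; field; rewrite !gt_eqF.
rewrite -[(e * pi)^-1]powR_inv1 -?powRrM ?mulN1r//.
by rewrite mulr_ge0// ltW.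
Qed.

End gaussian_density_theory.

(** * The theta identity *)

Section folding.
Context (R : realType).
Notation leb := (@lebesgue_measure R).

(** Half-open, so that the integer translates tile the line without overlap. *)
Definition unit_itv (t : R) : R := \1_(`[0, 1[%classic : set R) t.

Lemma unit_itvE t : unit_itv t = ((0 <= t < 1)%R)%:R.
Proof. by rewrite /unit_itv indicE mem_setE /= in_itv. Qed.

Lemma unit_itv_ge0 t : 0 <= unit_itv t.
Proof. by rewrite unit_itvE. Qed.

Lemma unit_itv_le1 t : `|unit_itv t| <= 1.
Proof. by rewrite unit_itvE; case: (0 <= t < 1); rewrite ?normr1 ?normr0. Qed.

Lemma measurable_unit_itv : measurable_fun setT unit_itv.
Proof. exact: measurable_indic. Qed.

Lemma rsum_unit_itv (x c : R) :
  rsummable (fun n : int => c * unit_itv (x - n%:~R)) /\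
  rsum (fun n : int => c * unit_itv (x - n%:~R)) = c.
Proof.
have [|s E] := @rsum1 R int (Num.floor x) (fun n => c * unit_itv (x - n%:~R)).
  move=> n nx; rewrite unit_itvE.
  case: (boolP (0 <= x - n%:~R < 1)) => [/andP[h1 h2]|_]; last by rewrite mulr0.
  move/eqP : nx => []; apply/esym/floor_def; rewrite intrD.
  by apply/andP; split; lra.
split => //; rewrite E unit_itvE.
have /andP[h1 h2] := floor_itv x; rewrite intrD in h2.
by rewrite (_ : _ && _ = true) ?mulr1//; apply/andP; split; lra.
Qed.

Lemma integrable_shift (g : R -> R) (b : R) : leb.-integrable setT (EFin \o g) ->
  leb.-integrable setT (EFin \o (fun x => g (x + b))).
Proof.
move=> ig; have := integrable_affine b ltr01 ig.
by apply: eq_integrable => // x _ /=; rewrite mul1r.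
Qed.

Lemma Rintegral_shift (g : R -> R) (b : R) : leb.-integrable setT (EFin \o g) ->
  \int[leb]_x g (x + b) = \int[leb]_x g x.
Proof.
move=> ig; have := Rintegral_affine b ltr01 ig.
by rewrite invr1 mul1r => <-; apply: eq_Rintegral => x _; rewrite mul1r.
Qed.

(** Cut the line into the cells [n, n + 1) and move each onto [0, 1): [G n] is the piece of [g] on
    the n-th cell, [F n] its translate. Absolute summability is Tonelli, since the pieces of |g| add
    up to |g|. *)
Lemma Rintegral_fold (g : R -> R) : leb.-integrable setT (EFin \o g) ->
  [/\ rsummable (fun n : int => \int[leb]_t (g (t + n%:~R) * unit_itv t)),
      leb.-integrable setT (EFin \o (fun t => rsum (fun n : int => g (t + n%:~R) * unit_itv t))) &
      \int[leb]_t (rsum (fun n : int => g (t + n%:~R) * unit_itv t)) = \int[leb]_t g t].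
Proof.
move=> ig.
pose G (n : int) x := g x * unit_itv (x - n%:~R).
have mi (n : int) : measurable_fun setT (fun x : R => unit_itv (x - n%:~R)).
  by apply: (measurableT_comp measurable_unit_itv); exact: measurable_funB.
have iG n : leb.-integrable setT (EFin \o G n).
  apply: (integrable_mulb (M := 1)); [exact: mi|exact: ig|].
  by move=> x; exact: unit_itv_le1.
have sG : rsummable (fun n => \int[leb]_x `|G n x|).
  apply: ge0_rsummable => [n|]; first exact: Rintegral_ge0.
  rewrite [ltLHS](_ : _ = \esum_(n in [set: int]) \int[leb]_x (`|G n x|)%:E)%E; last first.
    by apply: eq_esum => n _; rewrite EFin_Rintegral//; exact: integrable_norm.
  rewrite ge0_integral_rsum//; last first.
    by move=> n; exact: (integrable_measurable (integrable_norm (iG n))).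
  rewrite [ltLHS](_ : _ = \int[leb]_x `|(g x)%:E|)%E; first by case/integrableP : ig.
  apply: eq_integral => x _; rewrite (_ : (fun n => _) =
      fun n : int => (`|g x| * unit_itv (x - n%:~R))%:E); last first.
    by apply/funext => n; rewrite normrM (ger0_norm (unit_itv_ge0 _)).
  have [s E] := rsum_unit_itv x `|g x|.
  by rewrite esum_rsum ?E// => n; rewrite mulr_ge0 ?unit_itv_ge0.
pose F (n : int) t := g (t + n%:~R) * unit_itv t.
have FG n t : F n t = G n (t + n%:~R) by rewrite /F /G addrK.
have iF n : leb.-integrable setT (EFin \o F n).
  by have := integrable_shift n%:~R (iG n); apply: eq_integrable => // t _ /=; rewrite FG.
have FGint n : \int[leb]_t `|F n t| = \int[leb]_x `|G n x|.
  rewrite -(Rintegral_shift n%:~R (integrable_norm (iG n))).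
  by apply: eq_Rintegral => t _; rewrite FG.
have FGint' n : \int[leb]_t F n t = \int[leb]_x G n x.
  rewrite -(Rintegral_shift n%:~R (iG n)).
  by apply: eq_Rintegral => t _; rewrite FG.
have sF : rsummable (fun n => \int[leb]_t `|F n t|).
  by rewrite (_ : (fun n => _) = fun n => \int[leb]_x `|G n x|)//; apply/funext.
have [_ i1 s1 E1] := rsum_Rintegral iF sF.
have [_ i2 s2 E2] := rsum_Rintegral iG sG.
split => //; rewrite [LHS]E1.
rewrite (_ : (fun n => _) = fun n => \int[leb]_x G n x); last exact/funext.
by rewrite -E2; apply: eq_Rintegral => x _; have [_ ->] := rsum_unit_itv x (g x).
Qed.

End folding.

Section unit_interval.
Context (R : realType).
Notation leb := (@lebesgue_measure R).

Lemma integrable_unit_itv : leb.-integrable setT (EFin \o @unit_itv R).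
Proof.
apply/integrableP; split; first by apply/measurable_EFinP; exact: measurable_unit_itv.
rewrite (_ : integral _ _ _ = \int[leb]_t (\1_(`[0, 1[%classic : set R) t)%:E)%E; last first.
  by apply: eq_integral => t _; rewrite /= ger0_norm// unit_itv_ge0.
rewrite integral_indic// setIT [ltLHS]lebesgue_measure_itv/= lte_fin ltr01.
by rewrite -EFinB ltry.
Qed.

(** A class closed under sums and products whose members are all integrable over the unit interval,
    so that the orthogonality computations below need no separate integrability proofs. *)
Definition bdmeas (f : R -> R) :=
  measurable_fun setT f /\ exists M, forall t, `|f t| <= M.

Lemma bdmeasD f g : bdmeas f -> bdmeas g -> bdmeas (fun t => f t + g t).
Proof.
move=> [mf [M fM]] [mg [M' gM]]; split; first exact: measurable_funD.
by exists (M + M') => t; apply: (le_trans (ler_normD _ _)); exact: lerD.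
Qed.

Lemma bdmeasM f g : bdmeas f -> bdmeas g -> bdmeas (fun t => f t * g t).
Proof.
move=> [mf [M fM]] [mg [M' gM]]; split; first exact: measurable_funM.
by exists (M * M') => t; rewrite normrM ler_pM.
Qed.

Lemma bdmeas_cst c : bdmeas (fun=> c).
Proof. by split => //; exists `|c|. Qed.

Lemma bdmeasZ c f : bdmeas f -> bdmeas (fun t => c * f t).
Proof. by move=> bf; apply: bdmeasM => //; exact: bdmeas_cst. Qed.

Lemma bdmeasB f g : bdmeas f -> bdmeas g -> bdmeas (fun t => f t - g t).
Proof.
move=> bf bg; have := bdmeasD bf (bdmeasZ (-1) bg).
by rewrite (_ : (fun t => f t + -1 * g t) = fun t => f t - g t)//; apply/funext => t; rewrite mulN1r.
Qed.

Lemma bdmeas_cos k th : bdmeas (fun t => cos (k * t + th)).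
Proof. by split; [exact: measurable_cos_affine|exists 1 => t; exact: cos_max]. Qed.

Lemma bdmeas_sin k : bdmeas (fun t => sin (k * t)).
Proof.
split; last by exists 1 => t; exact: sin_max.
apply: (@measurableT_comp _ _ _ _ _ _ (@sin R)); last exact: measurable_funM.
by apply: continuous_measurable_fun; exact: continuous_sin.
Qed.

(** An integral over the whole line with an indicator, the form in which [Rintegral_fold] delivers
    integrals over a period. *)
Definition iunit (f : R -> R) : R := \int[leb]_t (f t * unit_itv t).

Lemma integrable_iunit f : bdmeas f ->
  leb.-integrable setT (EFin \o (fun t => f t * unit_itv t)).
Proof.
move=> [mf [M fM]]; apply: (integrable_le _ (integrable_scale M integrable_unit_itv)) => [|t].
  by apply: measurable_funM => //; exact: measurable_unit_itv.
by rewrite normrM (ger0_norm (unit_itv_ge0 _)) ler_wpM2r// unit_itv_ge0.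
Qed.

Lemma iunitD f g : bdmeas f -> bdmeas g ->
  iunit (fun t => f t + g t) = iunit f + iunit g.
Proof.
move=> bf bg; rewrite /iunit -RintegralD//; [|exact: integrable_iunit..].
by apply: eq_Rintegral => t _; rewrite mulrDl.
Qed.

Lemma iunitB f g : bdmeas f -> bdmeas g ->
  iunit (fun t => f t - g t) = iunit f - iunit g.
Proof.
move=> bf bg; rewrite /iunit -RintegralB//; [|exact: integrable_iunit..].
by apply: eq_Rintegral => t _; rewrite mulrBl.
Qed.

Lemma iunitZ c f : bdmeas f -> iunit (fun t => c * f t) = c * iunit f.
Proof.
move=> bf; rewrite /iunit -RintegralZl//; last exact: integrable_iunit.
by apply: eq_Rintegral => t _; rewrite mulrA.
Qed.

Lemma iunit_itv f : bdmeas f -> iunit f = \int[leb]_(t in `[0, 1]) f t.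
Proof.
move=> bf; rewrite -Rintegral_itv_bndo_bndc.
  rewrite [RHS]Rintegral_mkcond; apply: eq_Rintegral => t _.
  by rewrite unit_itvE patchE mem_setE /= in_itv /=; case: ifP => _; rewrite ?mulr1 ?mulr0.
apply: (measurable_bounded_integrable (mu := leb)) => //.
- by rewrite [ltLHS]lebesgue_measure_itv/= lte_fin ltr01 -EFinB ltry.
- by have [mf _] := bf; exact: measurable_funTS.
- have [_ [M fM]] := bf; exists M; split; rewrite ?num_real// => x Mx t _ /=.
  by rewrite (le_trans (fM t))// ltW.
Qed.

Lemma iunit1 : iunit (fun=> 1) = 1.
Proof.
rewrite iunit_itv; last exact: bdmeas_cst.
rewrite Rintegral_cst//= [lebesgue_measure _]lebesgue_measure_itv/= lte_fin ltr01.
by rewrite oppr0 adde0 mul1r.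
Qed.

Lemma cosD2piz (z : int) (x : R) : cos (x + 2 * pi * z%:~R) = cos x.
Proof.
have E n y : cos (y + 2 * pi * n%:R) = cos y :> R.
  have := periodicn (@cosD2pi R) n y; rewrite (_ : pi *+ 2 *+ n = 2 * pi * n%:R)//.
  by rewrite -[LHS]mulr_natr -(mulr_natr pi 2) (mulrC pi).
case: z => n; first exact: E.
rewrite NegzE mulrNz mulrN -[in RHS](subrK (2 * pi * n.+1%:R) x) E.
by rewrite -pmulrn.
Qed.

Lemma sin2piz (z : int) : sin (2 * pi * z%:~R) = 0 :> R.
Proof.
have := cosD2piz z (- (pi / 2)).
by rewrite addrC cosBpihalf cosN cos_pihalf.
Qed.

Lemma iunit_cos (z : int) : z != 0 -> iunit (fun t => cos (2 * pi * z%:~R * t)) = 0.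
Proof.
move=> z0; have k0 : 2 * pi * z%:~R != 0 :> R.
  by rewrite !mulf_neq0 ?pnatr_eq0 ?intr_eq0// gt_eqF// pi_gt0.
set k := 2 * pi * z%:~R in k0 *.
have bc : bdmeas (fun t => cos (k * t)).
  by have := bdmeas_cos k 0; under eq_fun do rewrite addr0.
have dF (x : R) : is_derive x (1 : R) (fun t : R => k^-1 * sin (k * t)) (cos (k * x)).
  by apply: is_derive_eq; rewrite /GRing.scale /=; field.
have cc : continuous (fun t : R => cos (k * t)).
  move=> x; apply: differentiable_continuous.
  by apply/derivable1_diffP; apply: ex_derive.
rewrite iunit_itv// /Rintegral (@continuous_FTC2 _ _ (fun t => k^-1 * sin (k * t)))//=.
- by rewrite mulr1 sin2piz !mulr0 sin0 mulr0 subrr.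
- exact: continuous_subspaceT.
- have cF : continuous (fun t : R => k^-1 * sin (k * t)).
    by move=> x; apply: differentiable_continuous; apply/derivable1_diffP; have [] := dF x.
  split; first by move=> x _; have [] := dF x.
    by apply: cvg_at_right_filter; exact: cF.
  by apply: cvg_at_left_filter; exact: cF.
- by move=> x _; rewrite derive1E; have [] := dF x.
Qed.

(** The numerator of Dirichlet's kernel. These functions are orthogonal on the unit interval, with
    square norm 1/2. *)
Definition odd_sin (N : nat) (t : R) : R := sin ((2 * N%:R + 1) * pi * t).

Lemma bdmeas_odd_sin N : bdmeas (odd_sin N).
Proof. exact: bdmeas_sin. Qed.

(** Product-to-sum gives cosines of the integer frequencies N - M and N + M + 1; the latter is never
    zero, the former only for N = M. *)
Lemma iunit_odd_sin N M :
  iunit (fun t => odd_sin N t * odd_sin M t) = if N == M then 2^-1 else 0.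
Proof.
have bz (z : int) : bdmeas (fun t => cos (2 * pi * z%:~R * t)).
  by have := bdmeas_cos (2 * pi * z%:~R) 0; under eq_fun do rewrite addr0.
transitivity (iunit (fun t => 2^-1 * (cos (2 * pi * (N%:Z - M%:Z)%:~R * t) -
                                     cos (2 * pi * (N%:Z + M%:Z + 1)%:~R * t)))).
  congr iunit; apply/funext => t; rewrite /odd_sin.
  set A := (2 * N%:R + 1) * pi * t; set B := (2 * M%:R + 1) * pi * t.
  rewrite (_ : 2 * pi * (N%:Z - M%:Z)%:~R * t = A - B); last first.
    by rewrite intrB -!pmulrn /A /B; ring.
  rewrite (_ : 2 * pi * (N%:Z + M%:Z + 1)%:~R * t = A + B); last first.
    by rewrite !intrD -!pmulrn /A /B; ring.
  by rewrite cosB cosD; field.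
rewrite iunitZ; last exact: bdmeasB.
rewrite iunitB// (@iunit_cos (N%:Z + M%:Z + 1)) ?subr0; last first.
  by rewrite -!PoszD addn1.
case: eqVneq => [->|NM].
  rewrite subrr (_ : (fun t => _) = fun=> 1) ?iunit1 ?mulr1//.
  by apply/funext => t; rewrite mulr0 mul0r cos0.
by rewrite iunit_cos ?mulr0// subr_eq0 eqz_nat.
Qed.

(** Bessel's inequality bounds the sums of the squared coefficients by the square norm of [g], so
    the coefficients tend to 0. *)
Lemma bessel_odd_sin g : bdmeas g ->
  iunit (fun t => g t * odd_sin N t) @[N --> \oo] --> 0.
Proof.
move=> bg; pose c N := iunit (fun t => g t * odd_sin N t).
(* [r K] is [g] minus its projection on the first K functions; the factor 2 is the inverse of their
   square norm. *)
pose r := fix r (K : nat) : R -> R := match K with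
  | 0 => g
  | K'.+1 => fun t => r K' t - 2 * c K' * odd_sin K' t end.
have br K : bdmeas (r K).
  elim: K => [|K IH] //=; apply: bdmeasB => //; apply: bdmeasZ; exact: bdmeas_odd_sin.
have rE K M : (K <= M)%N -> iunit (fun t => r K t * odd_sin M t) = c M.
  elim: K => [|K IH] //= KM.
  rewrite (_ : (fun t => _) = fun t => r K t * odd_sin M t -
       2 * c K * (odd_sin K t * odd_sin M t)); last first.
    by apply/funext => t; ring.
  have b1 := bdmeasM (br K) (bdmeas_odd_sin M).
  have b2 := bdmeasM (bdmeas_odd_sin K) (bdmeas_odd_sin M).
  rewrite iunitB//; last exact: bdmeasZ.
  by rewrite iunitZ// iunit_odd_sin ltn_eqF// mulr0 subr0 IH// ltnW.
(* Pythagoras: each projection removes 2 c_K^2 from the square norm. *)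
have sE K : iunit (fun t => r K t * r K t) =
    iunit (fun t => g t * g t) - 2 * \sum_(N < K) c N ^+ 2.
  elim: K => [|K IH] //=; first by rewrite big_ord0 mulr0 subr0.
  rewrite (_ : (fun t => _) = fun t => (r K t * r K t - 4 * c K * (r K t * odd_sin K t)) +
     4 * c K ^+ 2 * (odd_sin K t * odd_sin K t)); last first.
    by apply/funext => t; ring.
  have b0 := bdmeasM (br K) (br K).
  have b1 := bdmeasM (br K) (bdmeas_odd_sin K).
  have b2 := bdmeasM (bdmeas_odd_sin K) (bdmeas_odd_sin K).
  rewrite iunitD; [|by apply: bdmeasB => //; exact: bdmeasZ|exact: bdmeasZ].
  rewrite iunitB//; last exact: bdmeasZ.
  rewrite !iunitZ// iunit_odd_sin eqxx rE// IH big_ord_recr /=.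
  by field.
have bnd K : \sum_(N < K) c N ^+ 2 <= iunit (fun t => g t * g t).
  have : 0 <= iunit (fun t => r K t * r K t).
    by apply: Rintegral_ge0 => t _; rewrite mulr_ge0 ?unit_itv_ge0// -expr2 sqr_ge0.
  have : 0 <= \sum_(N < K) c N ^+ 2 by apply: sumr_ge0 => N _; exact: sqr_ge0.
  by rewrite sE; lra.
have cv : cvgn (series (fun N => c N ^+ 2)).
  apply: nondecreasing_is_cvgn.
    by apply: nondecreasing_series => n _ _; exact: sqr_ge0.
  exists (iunit (fun t => g t * g t)) => _ [K _ <-].
  by rewrite /series /= big_mkord.
have c20 := cvg_series_cvg_0 cv.
apply: norm_cvg0.
rewrite (_ : (fun N => _) = fun N => Num.sqrt (c N ^+ 2)); last first.
  by apply/funext => N; rewrite sqrtr_sqr.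
by rewrite -[0]sqrtr0; apply: (continuous_cvg _ _ c20); exact: sqrt_continuous.
Qed.

(** With x = pi t / 2, sin (pi t) = 2 cos x sin x, and the mean value theorem gives sin x = x cos s
    with 0 < s < x <= pi / 4. Both cosines are at least 1/2, and x >= t because pi >= 2. *)
Lemma sin_pi_lower (t : R) : 0 <= t -> t <= 2^-1 -> t / 2 <= sin (pi * t).
Proof.
move=> t0 t2; have p2 := pi_ge2 R.
have cosge (s : R) : 0 <= s -> s <= pi / 4 -> 2^-1 <= cos s.
  move=> s0 s4.
  have c2 : 0 <= cos (s *+ 2) by apply: cos_ge0_pihalf; rewrite [s *+ 2]mulr2n; move: (pi : R) p2 s4 => p p2 s4; apply/andP; split; lra.
  have c1 : 0 <= cos s by apply: cos_ge0_pihalf; move: (pi : R) p2 s4 => p p2 s4; apply/andP; split; lra.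
  move: c2; rewrite cos_mulr2n -[cos s ^+ 2 *+ 2]mulr_natr => c2; nra.
have [->|tn0] := eqVneq t 0; first by rewrite mul0r mulr0 sin0.
have tgt0 : 0 < t by rewrite lt_neqAle eq_sym tn0.
have x0 : 0 < pi * t / 2 by rewrite divr_gt0 ?mulr_gt0 ?pi_gt0.
have [s /[!in_itv]/= /andP[s0 s1]] :
    exists2 s, s \in `]0, (pi * t / 2)[%R & sin (pi * t / 2) - sin 0 = cos s * (pi * t / 2 - 0).
  by apply: MVT => //; exact/continuous_subspaceT/continuous_sin.
rewrite sin0 !subr0 => E.
have x4 : pi * t / 2 <= pi / 4 by move: (pi : R) p2 => p p2; nra.
have h1 := cosge s (ltW s0) (le_trans (ltW s1) x4).
have h2 := cosge _ (ltW x0) x4.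
rewrite (_ : pi * t = (pi * t / 2) *+ 2); last by rewrite -[RHS]mulr_natr; field.
rewrite sin_mulr2n E -[leRHS]mulr_natr.
have h3 : 2^-1 * 2^-1 <= cos (pi * t / 2) * cos s by rewrite ler_pM.
have h4 : t <= pi * t / 2 by move: (pi : R) p2 => p p2; nra.
have h5 : 2^-1 * 2^-1 * t <= cos (pi * t / 2) * cos s * (pi * t / 2) by rewrite ler_pM.
by rewrite mulrA; lra.
Qed.

End unit_interval.

Lemma rsum_dominated_cvg (R : realType) (I : countType) (F : nat -> I -> R) (u v : I -> R) :
  (forall i, F n i @[n --> \oo] --> u i) -> rsummable v ->
  (forall n i, `|F n i| <= v i) ->
  rsum (F n) @[n --> \oo] --> rsum u.
Proof.
move=> Fu /rsummableP sv Fv; rewrite rsumE; under eq_fun do rewrite rsumE.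
apply: (Rintegral_dominated_cvg _ _ _ sv) => //.
- by move=> k; rewrite /seqof; case: pickle_inv => //= *; exact: cvg_cst.
- by move=> n k; rewrite /seqof; case: pickle_inv => //= ; rewrite normr0.
Qed.

Section theta_line.
Context (R : realType).
Notation leb := (@lebesgue_measure R).

Lemma integrable_exp_sqr (c y : R) : 0 < c ->
  leb.-integrable setT (EFin \o (fun x : R => expR (- (c * (x + y) ^+ 2)))).
Proof.
move=> c0; have ic0 : 0 < c^-1 by rewrite invr_gt0.
have := integrable_shift y (integrable_scale ((c^-1 * pi) `^ (1 / 2)) (integrable_gaussian_line ic0)).
apply: eq_integrable => // x _ /=; rewrite /gaussian_line mulrA -powRD; last first.
  by apply/implyP => _; rewrite gt_eqF// mulr_gt0// pi_gt0.
by rewrite subrr powRr0 mul1r invrK [X in expR (- X)]mulrC.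
Qed.

(** Comparison with integrals over unit cells: for 0 <= t < 1, (s + t)^2 <= 2 s^2 + 2, so exp (- c
    s^2) is at most exp c times the cell average of exp (- (c / 2)(s + t)^2). [Rintegral_fold] makes
    these averages summable. *)
Lemma rsummable_exp_sqr (c y : R) : 0 < c ->
  rsummable (fun n : int => expR (- (c * (n%:~R - y) ^+ 2))).
Proof.
move=> c0; have c20 : 0 < c / 2 by rewrite divr_gt0.
have ig := integrable_exp_sqr (- y) c20.
have [s _ _] := Rintegral_fold ig.
apply: (rsummable_le (rsummableZ (expR c) s)) => n.
have iG : leb.-integrable setT
    (EFin \o (fun t => expR (- (c / 2 * (t + n%:~R + - y) ^+ 2)) * unit_itv t)).
  apply: (integrable_mulb (M := 1)); last by move=> t; exact: unit_itv_le1.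
    exact: measurable_unit_itv.
  exact: (integrable_shift n%:~R ig).
rewrite ger0_norm ?expR_ge0// -RintegralZl//.
rewrite -[leLHS]mulr1 -[X in _ * X <= _](iunit1 R) /iunit -RintegralZl//; last first.
  by apply: integrable_iunit; exact: bdmeas_cst.
apply: le_Rintegral => //.
- by apply: integrable_scale; apply: integrable_iunit; exact: bdmeas_cst.
- exact: (integrable_scale _ iG).
move=> t _; rewrite mul1r mulrA unit_itvE.
case: (boolP (0 <= t < 1)) => [/andP[t0 t1]|_]; last by rewrite !mulr0.
rewrite !mulr1 -expRD ler_expR.
have : t ^+ 2 <= 1 by rewrite expr_le1// ltW.
have : 0 <= (n%:~R - y - t) ^+ 2 by rewrite sqr_ge0.
set s' := n%:~R - y => h1 h2.
rewrite (_ : t + n%:~R - y = s' + t); last by rewrite /s'; ring.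
have h3 : (s' + t) ^+ 2 <= 2 * s' ^+ 2 + 2.
  by rewrite (_ : (s' + t) ^+ 2 = 2 * s' ^+ 2 + 2 * t ^+ 2 - (s' - t) ^+ 2); [lra|ring].
have := ler_wpM2l (ltW c20) h3; lra.
Qed.

Lemma rsummable_gaussian_line (a y : R) : 0 < a ->
  rsummable (fun n : int => gaussian_line a (y - n%:~R)).
Proof.
move=> a0; have ia0 : 0 < a^-1 by rewrite invr_gt0.
have := rsummableZ ((a * pi) `^ (- (1 / 2))) (rsummable_exp_sqr y ia0).
congr rsummable; apply/funext => n; rewrite /gaussian_line; congr (_ * expR (- _)).
by rewrite mulrC; congr (_ / _); ring.
Qed.

Definition theta_line (a y : R) : R := rsum (fun n : int => gaussian_line a (y - n%:~R)).

Lemma measurable_gaussian_line (a : R) : measurable_fun setT (@gaussian_line R a).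
Proof.
apply: measurable_funM => //; apply: measurableT_comp => //.
by apply: measurableT_comp => //; apply: measurable_funM.
Qed.

Lemma measurable_theta_line (a y : R) : measurable_fun setT (fun t : R => theta_line a (y + t)).
Proof.
apply: (measurable_rsum (F := fun n t => gaussian_line a (y + t - n%:~R))) => n.
apply: (measurableT_comp (measurable_gaussian_line a)).
by apply: measurable_funB => //; exact: measurable_funD.
Qed.

Lemma theta_line_periodic (a y : R) : theta_line a (y + 1) = theta_line a y.
Proof.
rewrite /theta_line -(@rsum_reindex _ _ _ (fun n : int => n + 1)).
  by congr rsum; apply/funext => n /=; congr gaussian_line; rewrite intrD; ring.
by exists (fun n => n - 1) => n; ring.
Qed.

(** From exp (x - z) >= 1 + (x - z), used in both directions; the symmetric right-hand side avoids
    ordering [u] and [v]. *)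
Let expR_lip (u v : R) : `|expR (- u) - expR (- v)| <= `|u - v| * (expR (- u) + expR (- v)).
Proof.
have H (x z : R) : expR (- x) - expR (- z) <= `|x - z| * expR (- x).
  rewrite (_ : expR (- z) = expR (- x) * expR (x - z)); last by rewrite -expRD; congr expR; ring.
  have := expR_ge1Dx (x - z); have := expR_ge0 (- x).
  have : - (x - z) <= `|x - z| by rewrite -normrN ler_norm.
  move: (expR (x - z)) (expR (- x)) `|x - z| => p q w; nra.
have h1 := H u v; have h2 := H v u; rewrite distrC in h2.
have e1 := expR_ge0 (- u); have e2 := expR_ge0 (- v).
have e3 := normr_ge0 (u - v).
rewrite ler_norml; apply/andP; split.
  by rewrite lerNl opprB (le_trans h2)// ler_wpM2l// lerDr.
by rewrite (le_trans h1)// ler_wpM2l// lerDl.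
Qed.

(** The Lipschitz constant must itself decay like a Gaussian in [x], so that it can be summed over
    the lattice in [theta_line_lip]. *)
Lemma gaussian_line_lip (a : R) : 0 < a -> exists2 M, 0 <= M &
  forall x t : R, `|t| <= 1 ->
    `|gaussian_line a (x + t) - gaussian_line a x| <= M * expR (- ((4 * a)^-1 * x ^+ 2)) * `|t|.
Proof.
move=> a0; pose K := (a * pi) `^ (- (1 / 2)) : R.
have K0 : 0 <= K by exact: powR_ge0.
exists (K * ((4 * a + 2) / a * (2 * expR (a^-1)))).
  by rewrite mulr_ge0// mulr_ge0 ?divr_ge0 ?mulr_ge0 ?expR_ge0 ?addr_ge0 ?mulr_ge0// ltW.
move=> x t t1.
have ia : 0 <= a^-1 by rewrite invr_ge0 ltW.
have t2 : t ^+ 2 <= 1 by rewrite -real_normK ?num_real// expr_le1.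
rewrite /gaussian_line -/K -mulrBr normrM (ger0_norm K0).
rewrite [leRHS](_ : _ = K * ((4 * a + 2) / a * (2 * expR a^-1) *
  expR (- ((4 * a)^-1 * x ^+ 2)) * `|t|)); last by ring.
apply: ler_wpM2l => //.
apply: le_trans (expR_lip _ _) _.
(* Both exponentials are at most exp (1 / a) E^2. One factor E absorbs the growth of x^2 + 2 ([b4]),
   the other one remains in the bound. *)
set E := expR (- ((4 * a)^-1 * x ^+ 2)).
have E0 : 0 < E by exact: expR_gt0.
have b1 : `|(x + t) ^+ 2 / a - x ^+ 2 / a| <= `|t| * (x ^+ 2 + 2) / a.
  rewrite -mulrBl normrM (ger0_norm ia) ler_wpM2r// (_ : _ - _ = t * (2 * x + t)); last by ring.
  rewrite normrM ler_wpM2l// (le_trans (ler_normD _ _))// normrM ger0_norm//.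
  have : 0 <= (`|x| - 1) ^+ 2 by exact: sqr_ge0.
  by rewrite sqrrB real_normK ?num_real//; lra.
have E4 : expR (- (x ^+ 2 / (2 * a))) = E * E.
  by rewrite /E -expRD; congr expR; field; rewrite gt_eqF.
have ea : 1 <= expR a^-1 by rewrite -expR0 ler_expR invr_ge0 ltW.
have b2 : expR (- ((x + t) ^+ 2 / a)) <= expR a^-1 * (E * E).
  rewrite -E4 -expRD ler_expR.
  rewrite (_ : a^-1 - _ = (1 - x ^+ 2 / 2) / a); last by field; rewrite gt_eqF.
  rewrite -mulNr ler_wpM2r//.
  have : 0 <= (x + 2 * t) ^+ 2 by exact: sqr_ge0.
  by rewrite (_ : (x + t) ^+ 2 = x ^+ 2 / 2 + (x + 2 * t) ^+ 2 / 2 - t ^+ 2); [lra|field].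
have b3 : expR (- (x ^+ 2 / a)) <= expR a^-1 * (E * E).
  rewrite -[leLHS]mul1r ler_pM ?expR_ge0// -E4 ler_expR lerN2 ler_wpM2l ?sqr_ge0//.
  by rewrite lef_pV2 ?posrE ?mulr_gt0//; lra.
have b4 : (x ^+ 2 + 2) * E <= 4 * a + 2.
  pose w := (4 * a)^-1 * x ^+ 2.
  have h1 : 1 + w <= E^-1 by rewrite /E expRN invrK expR_ge1Dx.
  have h2 : (1 + w) * E <= 1 by rewrite -ler_pdivlMr// mul1r.
  have h3 : E <= 1 by rewrite /E -expR0 ler_expR oppr_le0 mulr_ge0 ?sqr_ge0// invr_ge0 mulr_ge0// ltW.
  have -> : x ^+ 2 = 4 * a * w by rewrite /w; field; rewrite gt_eqF.
  have h4 : a * (w * E) <= a * 1 by rewrite ler_pM2l//; lra.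
  by lra.
have s0 : 0 <= expR (- ((x + t) ^+ 2 / a)) + expR (- (x ^+ 2 / a)).
  by rewrite addr_ge0 ?expR_ge0.
apply: (le_trans (ler_pM (normr_ge0 _) s0 b1 (lerD b2 b3))).
rewrite [leLHS](_ : _ = ((x ^+ 2 + 2) * E) * (a^-1 * (2 * expR a^-1) * E * `|t|)); last by ring.
rewrite [leRHS](_ : _ = (4 * a + 2) * (a^-1 * (2 * expR a^-1) * E * `|t|)); last by ring.
have e0 := ltW E0; apply: ler_wpM2r => //.
by rewrite !mulr_ge0 ?expR_ge0.
Qed.

Lemma theta_line_lip (a y : R) : 0 < a -> exists2 L, 0 <= L &
  forall t : R, `|t| <= 1 -> `|theta_line a (y + t) - theta_line a y| <= L * `|t|.
Proof.
move=> a0; have [M M0 ML] := gaussian_line_lip a0.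
have c0 : 0 < (4 * a)^-1 by rewrite invr_gt0 mulr_gt0.
have s := rsummableZ M (rsummable_exp_sqr y c0).
pose L := rsum (fun n : int => M * expR (- ((4 * a)^-1 * (n%:~R - y) ^+ 2))).
exists L; first by apply: rsum_ge0 => n; rewrite mulr_ge0 ?expR_ge0.
move=> t t1; rewrite /theta_line -rsumB; [|exact: rsummable_gaussian_line..].
have sB := rsummableB (rsummable_gaussian_line (y + t) a0) (rsummable_gaussian_line y a0).
rewrite (le_trans (le_norm_rsum sB))// mulrC /L -rsumZ//.
apply: le_rsum; [exact: rsummable_norm|exact: rsummableZ|].
move=> n; rewrite (_ : y + t - n%:~R = (y - n%:~R) + t); last by ring.
rewrite (le_trans (ML _ _ t1))// [leRHS]mulrC -!mulrA.
by rewrite (_ : (n%:~R - y) ^+ 2 = (y - n%:~R) ^+ 2)//; ring.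
Qed.

(** The cosine has period 1, so folding turns the integral of theta over a period into the integral
    of a single Gaussian over the line. *)
Lemma theta_line_fourier (a y : R) (m : nat) : 0 < a ->
  leb.-integrable setT
    (EFin \o (fun t : R => theta_line a (y + t) * cos (2 * pi * m%:R * t) * unit_itv t)) /\
  \int[leb]_t (theta_line a (y + t) * cos (2 * pi * m%:R * t) * unit_itv t) =
  expR (- (a * pi ^+ 2 * m%:R ^+ 2)) * cos (2 * pi * (y * m%:R)).
Proof.
move=> a0; pose g x := gaussian_line a (x + y) * cos (2 * pi * m%:R * x + 0).
have ig : leb.-integrable setT (EFin \o g).
  apply: (integrable_mulb (M := 1)); last by move=> x; exact: cos_max.
    exact: measurable_cos_affine.
  exact: (integrable_shift y (integrable_gaussian_line a0)).
have [_ i1 E] := Rintegral_fold ig.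
have FE t : rsum (fun n : int => g (t + n%:~R) * unit_itv t) =
    theta_line a (y + t) * cos (2 * pi * m%:R * t) * unit_itv t.
  have co (n : int) : cos (2 * pi * m%:R * (t + n%:~R) + 0) = cos (2 * pi * m%:R * t).
    rewrite addr0 -[RHS](cosD2piz (m%:Z * n)) intrM -pmulrn; congr cos; ring.
  (* Folding translates by [+ n] whereas [theta_line] subtracts [n], hence the change of sign of the
     index. *)
  have bN : bijective (@GRing.opp int) by exists -%R => n; rewrite opprK.
  have sN := (rsummable_reindex (fun n => gaussian_line a (y + t - n%:~R)) bN).1
    (rsummable_gaussian_line (y + t) a0).
  rewrite [RHS](_ : _ = cos (2 * pi * m%:R * t) * unit_itv t * theta_line a (y + t)); last by ring.
  rewrite /theta_line -(rsum_reindex (fun n => gaussian_line a (y + t - n%:~R)) bN).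
  apply: (etrans _ (rsumZ (cos (2 * pi * m%:R * t) * unit_itv t) sN)).
  congr rsum; apply/funext => n /=; rewrite /g co.
  rewrite mulrNz opprK (_ : t + n%:~R + y = y + t + n%:~R); last by ring.
  by rewrite -mulrA mulrC.
split; first by move: i1; apply: eq_integrable => // t _ /=; rewrite FE.
transitivity (\int[leb]_t g t); first by rewrite -E; apply: eq_Rintegral => t _; rewrite FE.
pose k x := gaussian_line a x * cos (2 * pi * (x * m%:R) + - (2 * pi * (y * m%:R))).
have ik : leb.-integrable setT (EFin \o k).
  apply: (integrable_mulb (M := 1)); last by move=> x; exact: cos_max.
    apply: (measurableT_comp (@measurable_cos R)).
    by apply: measurable_funD => //; apply: measurable_funM => //; exact: measurable_funM.
  exact: integrable_gaussian_line.
rewrite -[cos (2 * pi * (y * m%:R))]cosN -Rintegral_gaussian_line_cos//.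
rewrite -(Rintegral_shift y ik); apply: eq_Rintegral => x _.
by rewrite /g /k; congr (_ * cos _); ring.
Qed.

End theta_line.

Section theta_line_identity.
Context (R : realType).
Notation leb := (@lebesgue_measure R).

Definition dirichlet (N : nat) (t : R) : R :=
  1 + \sum_(m < N) 2 * cos (2 * pi * m.+1%:R * t).

(** Telescoping: 2 sin (pi t) cos (2 pi m t) is the difference of two consecutive [odd_sin]. *)
Lemma dirichletE N (t : R) : sin (pi * t) * dirichlet N t = odd_sin N t.
Proof.
elim: N => [|N IH]; rewrite /dirichlet.
  by rewrite big_ord0 addr0 mulr1 /odd_sin mulr0 add0r mul1r.
rewrite big_ord_recr /= addrA mulrDr -/(dirichlet N t) IH /odd_sin.
rewrite (_ : (2 * N.+1%:R + 1) * pi * t = 2 * pi * N.+1%:R * t + pi * t); last by ring.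
rewrite (_ : (2 * N%:R + 1) * pi * t = 2 * pi * N.+1%:R * t - pi * t); last first.
  by rewrite -[N.+1]addn1 natrD; ring.
by rewrite !sinD sinN cosN; ring.
Qed.

Lemma bdmeas_dirichlet N : bdmeas (dirichlet N).
Proof.
rewrite /dirichlet; elim: N => [|N IH].
  by under eq_fun do rewrite big_ord0 addr0; exact: bdmeas_cst.
under eq_fun do rewrite big_ord_recr /= addrA.
apply: bdmeasD => //; apply: bdmeasZ.
by have := bdmeas_cos (2 * pi * N.+1%:R : R) 0; under eq_fun do rewrite addr0.
Qed.

Lemma iunit_dirichlet N : iunit (dirichlet N) = 1.
Proof.
elim: N => [|N IH].
  by rewrite /dirichlet (_ : (fun t => _) = fun=> 1) ?iunit1//; apply/funext => t;
    rewrite big_ord0 addr0.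
have bc : bdmeas (fun t : R => cos (2 * pi * N.+1%:R * t)).
  by have := bdmeas_cos (2 * pi * N.+1%:R : R) 0; under eq_fun do rewrite addr0.
rewrite (_ : dirichlet N.+1 = fun t => dirichlet N t + 2 * cos (2 * pi * N.+1%:R * t)).
  rewrite iunitD//; [|exact: bdmeas_dirichlet|exact: bdmeasZ].
  by rewrite IH iunitZ// (@iunit_cos R N.+1%:Z)// mulr0 addr0.
by apply/funext => t; rewrite /dirichlet big_ord_recr /= addrA.
Qed.

(** The argument is real so that the natural indices of the partial sums and the integer indices of
    the series share it. *)
Definition theta_coef (a : R) (x : R) : R := expR (- (a * pi ^+ 2 * x ^+ 2)).

Lemma theta_line_dirichlet (a y : R) N : 0 < a ->
  leb.-integrable setT (EFin \o (fun t => theta_line a (y + t) * dirichlet N t * unit_itv t)) /\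
  \int[leb]_t (theta_line a (y + t) * dirichlet N t * unit_itv t) =
  1 + \sum_(m < N) 2 * (theta_coef a m.+1%:R * cos (2 * pi * (y * m.+1%:R))).
Proof.
move=> a0; elim: N => [|N [iN IH]].
  have [i0 E0] := theta_line_fourier y 0 a0.
  have E t : theta_line a (y + t) * dirichlet 0 t * unit_itv t =
      theta_line a (y + t) * cos (2 * pi * 0%:R * t) * unit_itv t.
    by rewrite /dirichlet big_ord0 addr0 mulr0 mul0r cos0.
  split; first by move: i0; apply: eq_integrable => // t _ /=; rewrite E.
  transitivity (\int[leb]_t (theta_line a (y + t) * cos (2 * pi * 0%:R * t) * unit_itv t)).
    by apply: eq_Rintegral => t _; exact: E.
  rewrite E0 big_ord0 addr0 !(mulr0, expr0n) /=.
  by rewrite !(mulr0, oppr0, expR0, cos0, mulr1).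
have [i0 E0] := theta_line_fourier y N.+1 a0.
have i1 := integrable_scale 2 i0.
have E t : theta_line a (y + t) * dirichlet N.+1 t * unit_itv t =
    theta_line a (y + t) * dirichlet N t * unit_itv t +
    2 * (theta_line a (y + t) * cos (2 * pi * N.+1%:R * t) * unit_itv t).
  by rewrite /dirichlet big_ord_recr /=; ring.
split.
  by have := integrable_add iN i1; apply: eq_integrable => // t _ /=; rewrite E.
under eq_Rintegral do rewrite E.
by rewrite RintegralD// RintegralZl// IH E0 big_ord_recr /= addrA.
Qed.

(* Dirichlet's convergence argument: the remainder is the [N]-th coefficient of
   the bounded function [(theta (y + t) - theta y) / sin (pi t)] in the orthogonal
   system [sin ((2 N + 1) pi t)], which vanishes in the limit by Bessel. *)
Lemma theta_line_cvg (a y : R) : 0 < a ->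
  1 + \sum_(m < N) 2 * (theta_coef a m.+1%:R * cos (2 * pi * (y * m.+1%:R)))
    @[N --> \oo] --> theta_line a y.
Proof.
move=> a0; have [L L0 Llip] := theta_line_lip y a0.
pose g t := (theta_line a (y + t) - theta_line a y) / sin (pi * t) * unit_itv t.
have gb t : `|g t| <= 2 * L.
  rewrite /g unit_itvE; case: (boolP (0 <= t < 1)) => [/andP[t0 t1]|_]; last first.
    by rewrite mulr0 normr0 mulr_ge0.
  have [->|tn0] := eqVneq t 0; first by rewrite addr0 subrr !mul0r normr0 mulr_ge0.
  have tgt0 : 0 < t by rewrite lt_neqAle eq_sym tn0.
  (* [s] is the distance from [t] to the nearer endpoint of [0, 1]; the quotient of L s by s / 2
     gives the bound 2 L. *)
  have key s : 0 < s -> s <= 2^-1 -> s / 2 <= `|sin (pi * t)| ->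
      `|theta_line a (y + t) - theta_line a y| <= L * s ->
      `|(theta_line a (y + t) - theta_line a y) / sin (pi * t) * true%:R| <= 2 * L.
    move=> s0 s2 h1 h2; rewrite mulr1 normrM normfV.
    rewrite ler_pdivrMr; last by rewrite (lt_le_trans _ h1)// divr_gt0.
    rewrite (le_trans h2)// (_ : L * s = 2 * L * (s / 2)); last by field.
    by rewrite ler_wpM2l// mulr_ge0.
  have [th|th] := lerP t 2^-1.
    apply: (key t) => //; first by rewrite (le_trans _ (ler_norm _))// sin_pi_lower.
    have t1' : `|t| <= 1 by rewrite ger0_norm// ltW.
    by have := Llip t t1'; rewrite (ger0_norm t0).
  (* Near 1 the sine is reflected about 1/2, and periodicity of theta lets the Lipschitz bound be
     used at t - 1. *)
  apply: (key (1 - t)) => //; [lra|lra| |].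
    rewrite (le_trans _ (ler_norm _))// (_ : pi * t = - (pi * (1 - t)) + pi); last by ring.
    by rewrite sinDpi sinN opprK sin_pi_lower//; lra.
  have t1' : `|t - 1| <= 1 by rewrite ler0_norm; lra.
  have := Llip (t - 1) t1'; rewrite (ler0_norm (_ : t - 1 <= 0)) ?opprB; last by lra.
  by rewrite -[theta_line a (y + (t - 1))]theta_line_periodic addrA subrK.
have bg : bdmeas g.
  split; last by exists (2 * L).
  (* On [0, 1) the sine is nonnegative, so its inverse is the power of exponent -1, measurable by
     [measurable_powR]. *)
  rewrite (_ : g = fun t => (theta_line a (y + t) - theta_line a y) *
      sin (pi * t) `^ (-1) * unit_itv t); last first.
    apply/funext => t; rewrite /g unit_itvE.
    case: (boolP (0 <= t < 1)) => [/andP[t0 t1]|_]; last by rewrite !mulr0.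
    rewrite powR_inv1// sin_ge0_pi// mulr_ge0 ?pi_ge0//=.
    by rewrite ler_piMr ?pi_ge0// ltW.
  apply: measurable_funM; last exact: measurable_unit_itv.
  apply: measurable_funM.
    by apply: measurable_funB => //; exact: measurable_theta_line.
  apply: (measurableT_comp (measurable_powR (-1))).
  by have [ms _] := @bdmeas_sin R pi; exact: ms.
(* Dirichlet's kernel has mean 1, so the remainder is the integral of theta (y + t) - theta y
   against it; multiplying and dividing by sin (pi t) gives [g] and [odd_sin]. At t = 0 the
   difference of thetas vanishes. *)
have E N : 1 + \sum_(m < N) 2 * (theta_coef a m.+1%:R * cos (2 * pi * (y * m.+1%:R))) =
    theta_line a y + iunit (fun t => g t * odd_sin N t).
  have [iN <-] := theta_line_dirichlet y N a0.
  have iD := integrable_iunit (bdmeasZ (theta_line a y) (bdmeas_dirichlet N)).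
  apply/eqP; rewrite addrC -subr_eq; apply/eqP.
  rewrite -[X in _ - X]mulr1 -[X in _ * X](iunit_dirichlet N) -iunitZ; last exact: bdmeas_dirichlet.
  rewrite /iunit -RintegralB//; apply: eq_Rintegral => t _.
  rewrite -!mulrBl -dirichletE /g unit_itvE.
  case: (boolP (0 <= t < 1)) => [/andP[t0 t1]|_]; last by rewrite !mulr0.
  rewrite !mulr1; have [->|tn0] := eqVneq t 0.
    by rewrite addr0 subrr !mul0r.
  have s0 : sin (pi * t) != 0.
    rewrite gt_eqF// sin_gt0_pi// mulr_gt0 ?pi_gt0//=; last by rewrite lt_neqAle eq_sym tn0.
    by rewrite gtr_pMr// pi_gt0.
  by field.
rewrite (funext E) -[X in _ --> X]addr0.
by apply: cvgD; [exact: cvg_cst|exact: bessel_odd_sin].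
Qed.

Lemma rsummable_theta_coef (a : R) : 0 < a ->
  rsummable (fun m : int => theta_coef a m%:~R).
Proof.
move=> a0; have c0 : 0 < a * pi ^+ 2 by rewrite mulr_gt0// exprn_gt0// pi_gt0.
have := rsummable_exp_sqr 0 c0; congr rsummable; apply/funext => m.
by rewrite subr0.
Qed.

(** Symmetric truncation, which identifies the series over the integers with the limit of the
    partial sums in [theta_line_cvg]. *)
Let even_trunc (u : int -> R) (N : nat) (m : int) : R :=
  if (`|m| <= N)%N then u m else 0.

Let rsum_even_trunc (u : int -> R) N : (forall m, u (- m) = u m) ->
  rsummable (even_trunc u N) /\
  rsum (even_trunc u N) = u 0 + \sum_(m < N) 2 * u (m.+1%:Z).
Proof.
move=> ueven; elim: N => [|N [sN IH]].
  have [|s E] := @rsum1 R int 0 (even_trunc u 0).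
    by move=> m m0; rewrite /even_trunc leqn0 absz_eq0 (negbTE m0).
  by split => //; rewrite E /even_trunc /= big_ord0 addr0.
pose v (z m : int) := if m == z then u m else 0.
have sv z : rsummable (v z) /\ rsum (v z) = u z.
  have [|s E] := @rsum1 R int z (v z); first by move=> m /negbTE mz; rewrite /v mz.
  by split => //; rewrite E /v eqxx.
have EN : even_trunc u N.+1 =
    (fun m => even_trunc u N m + (v N.+1%:Z m + v (- N.+1%:Z) m)).
  apply/funext => m; rewrite /even_trunc /v leq_eqVlt ltnS.
  have [mN|mN] := leqP `|m|%N N.
    rewrite orbT (_ : (m == _) = false); last by apply/negP => /eqP mE; move: mN; rewrite mE; lia.
    rewrite (_ : (m == _) = false) ?addr0//; apply/negP => /eqP mE; move: mN; rewrite mE; lia.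
  rewrite orbF add0r; have [E|nE] := eqVneq `|m|%N N.+1.
    have [E'|E'] : m = N.+1%:Z \/ m = - N.+1%:Z by lia.
      by rewrite E' eqxx (_ : (_ == _) = false) ?addr0//; apply/negP => /eqP; lia.
    by rewrite E' eqxx (_ : (_ == _) = false) ?add0r//; apply/negP => /eqP; lia.
  rewrite (_ : (m == _) = false); last by apply/negP => /eqP mE; move: nE; rewrite mE; lia.
  by rewrite (_ : (m == _) = false) ?addr0//; apply/negP => /eqP mE; move: nE; rewrite mE; lia.
have [s1 E1] := sv N.+1%:Z; have [s2 E2] := sv (- N.+1%:Z).
have s12 := rsummableD s1 s2.
rewrite EN; split; first exact: rsummableD.
rewrite rsumD// rsumD// E1 E2 IH ueven big_ord_recr /= -addrA; congr (_ + (_ + _)).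
by ring.
Qed.

(* The theta identity, with an arbitrary phase so that it can be iterated over
   the coordinates. *)
Lemma theta_line_identity (a y th : R) : 0 < a ->
  rsum (fun m : int => theta_coef a m%:~R * cos (2 * pi * (m%:~R * y) + th)) =
  cos th * theta_line a y.
Proof.
move=> a0; have sw := rsummable_theta_coef a0.
have w0 (m : int) : 0 <= theta_coef a m%:~R by exact: expR_ge0.
have wN (m : int) : theta_coef a (- m)%:~R = theta_coef a m%:~R.
  by rewrite /theta_coef mulrNz sqrrN.
have sb (f : int -> R) : (forall m, `|f m| <= 1) ->
    rsummable (fun m : int => theta_coef a m%:~R * f m).
  move=> fb; apply: (rsummable_le sw) => m.
  by rewrite normrM (ger0_norm (w0 _)) ler_piMr.
pose u (m : int) := theta_coef a m%:~R * cos (2 * pi * (m%:~R * y)).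
pose v (m : int) := theta_coef a m%:~R * sin (2 * pi * (m%:~R * y)).
have su : rsummable u by apply: sb => m; exact: cos_max.
have sv : rsummable v by apply: sb => m; exact: sin_max.
(* The sine series is odd in [m], so only the cosine part of the phase expansion survives. *)
have rv : rsum v = 0.
  have : rsum v = rsum (fun m => -1 * v m).
    rewrite -(@rsum_reindex _ _ _ (@GRing.opp int)); last first.
      by exists -%R => n; rewrite opprK.
    congr rsum; apply/funext => m /=; rewrite /v wN mulrNz.
    by rewrite (_ : 2 * pi * (- m%:~R * y) = - (2 * pi * (m%:~R * y))) ?sinN; ring.
  by rewrite rsumZ// => h; lra.
have ru : rsum u = theta_line a y.
  have ue m : u (- m) = u m by rewrite /u wN mulrNz mulNr mulrN cosN.
  have c1 : rsum (even_trunc u N) @[N --> \oo] --> rsum u.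
    apply: (rsum_dominated_cvg (v := fun m => theta_coef a m%:~R)) => //.
      move=> m; apply: cvg_near_cst; exists `|m|%N => // N /= mN.
      by rewrite /even_trunc mN.
    move=> N m; rewrite /even_trunc; case: ifP => _; last by rewrite normr0.
    by rewrite /u normrM (ger0_norm (w0 _)) ler_piMr// cos_max.
  have c2 := @theta_line_cvg a y a0.
  have E : (fun N => rsum (even_trunc u N)) =
      fun N => 1 + \sum_(m < N) 2 * (theta_coef a m.+1%:R * cos (2 * pi * (y * m.+1%:R))).
    apply/funext => N; rewrite (rsum_even_trunc N ue).2 /u mulr0z mul0r mulr0 cos0 mulr1.
    rewrite {1}/theta_coef expr0n mulr0 oppr0 expR0; congr (_ + _).
    by apply: eq_bigr => m _; rewrite -pmulrn [y * _]mulrC.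
  by rewrite E in c1; exact: (cvg_unique _ c1 c2).
rewrite -ru -[RHS]subr0 -(mulr0 (sin th)) -rv -!rsumZ// -rsumB; [|exact: rsummableZ..].
by congr rsum; apply/funext => m; rewrite /u /v cosD; ring.
Qed.

End theta_line_identity.

Section theta_identity.
Context (R : realType).

Definition cons_int n (z : int * n.-tuple int) : n.+1.-tuple int := [tuple of z.1 :: z.2].

Lemma cons_int_bij n : bijective (@cons_int n).
Proof.
exists (fun t => (thead t, [tuple of behead t])) => [[u t]|t].
  by rewrite /= theadE; congr pair; exact/val_inj.
by rewrite /cons_int [RHS](tuple_eta t); exact/val_inj.
Qed.

Lemma intv_cons n (z : int * n.-tuple int) :
  intv R (cons_int z) = cons_pair (z.1%:~R, intv R z.2).
Proof.
apply: eq_from_tnth => i; rewrite tnth_mktuple.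
case: (unliftP ord0 i) => [j ->|->]; rewrite ?tnth_cons_pairS ?tnth_cons_pair0//=.
by rewrite /cons_int tnthS tnth_mktuple.
Qed.

Definition theta n (a : R) (y : n.-tuple R) : R :=
  rsum (fun k : n.-tuple int => gaussian_density a (subv y (intv R k))).

Definition theta_weight n (a : R) (m : n.-tuple int) : R :=
  expR (- (a * pi ^+ 2 * enorm (intv R m) ^+ 2)).

Lemma theta_weight_ge0 n a (m : n.-tuple int) : 0 <= theta_weight a m.
Proof. exact: expR_ge0. Qed.

Lemma theta_weight_cons n a (z : int * n.-tuple int) :
  theta_weight a (cons_int z) = theta_coef a z.1%:~R * theta_weight a z.2.
Proof.
rewrite /theta_weight /theta_coef intv_cons !enorm2E dotv_cons /= -expRD.
by congr expR; ring.
Qed.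

Lemma rsummable_tensor (I J : countType) (u : I -> R) (v : J -> R) :
  rsummable u -> rsummable v -> rsummable (fun z : I * J => u z.1 * v z.2).
Proof.
move=> su sv.
have s : rsummable (fun z : I * J => `|u z.1| * `|v z.2|).
  apply: (@rsummable_pair_ge0 _ _ _ (fun z => `|u z.1| * `|v z.2|)) => [z|i|/=];
    first exact: mulr_ge0.
    exact: (rsummableZ `|u i| (rsummable_norm sv)).
  rewrite (_ : (fun i => _) = fun i => rsum (fun j => `|v j|) * `|u i|).
    exact: (rsummableZ _ (rsummable_norm su)).
  by apply/funext => i; rewrite (rsumZ _ (rsummable_norm sv)) mulrC.
by apply: (rsummable_le s) => z; rewrite normrM.
Qed.

Lemma rsummable_theta_weight n (a : R) : 0 < a ->
  rsummable (fun m : n.-tuple int => theta_weight a m).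
Proof.
move=> a0; elim: n => [|n IH].
  by have [|] // := @rsum1 R (0.-tuple int) [tuple] (fun m => theta_weight a m);
    move=> m; rewrite (tuple0 m) eqxx.
apply/(rsummable_reindex _ (cons_int_bij n)).
have := rsummable_tensor (rsummable_theta_coef a0) IH.
congr rsummable; apply/funext => z /=.
by rewrite theta_weight_cons.
Qed.

Lemma gaussian_density_cons_int n a (y : n.+1.-tuple R) (z : int * n.-tuple int) : 0 < a ->
  gaussian_density a (subv y (intv R (cons_int z))) =
  gaussian_line a (thead y - z.1%:~R) *
  gaussian_density a (subv [tuple of behead y] (intv R z.2)).
Proof.
move=> a0; rewrite intv_cons {1}(cons_pair_surj y) subv_cons /=.
exact: gaussian_density_cons.
Qed.

Lemma rsummable_gaussian_density n (a : R) (y : n.-tuple R) : 0 < a ->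
  rsummable (fun k : n.-tuple int => gaussian_density a (subv y (intv R k))).
Proof.
move=> a0; elim: n y => [|n IH] y.
  by have [|] // := @rsum1 R (0.-tuple int) [tuple]
    (fun k => gaussian_density a (subv y (intv R k))); move=> m; rewrite (tuple0 m) eqxx.
apply/(rsummable_reindex _ (cons_int_bij n)).
have := rsummable_tensor (rsummable_gaussian_line (thead y) a0) (IH [tuple of behead y]).
congr rsummable; apply/funext => z /=.
by rewrite gaussian_density_cons_int.
Qed.

Lemma thetaS n (a : R) (y : n.+1.-tuple R) : 0 < a ->
  theta a y = theta_line a (thead y) * theta a [tuple of behead y].
Proof.
move=> a0; rewrite /theta -(rsum_reindex _ (cons_int_bij n)).
have s := rsummable_tensor (rsummable_gaussian_line (thead y) a0)
  (rsummable_gaussian_density [tuple of behead y] a0).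
rewrite (_ : _ \o _ = fun z : int * n.-tuple int => gaussian_line a (thead y - z.1%:~R) *
    gaussian_density a (subv [tuple of behead y] (intv R z.2))); last first.
  by apply/funext => z /=; rewrite gaussian_density_cons_int.
have [_ _ E] := rsum_pair s; rewrite [LHS]E /=.
rewrite (_ : (fun i => _) = fun i : int => rsum (fun k =>
   gaussian_density a (subv [tuple of behead y] (intv R k))) * gaussian_line a (thead y - i%:~R)).
  by rewrite rsumZ 1?mulrC//; exact: rsummable_gaussian_line.
by apply/funext => i; rewrite rsumZ 1?mulrC//; exact: rsummable_gaussian_density.
Qed.

Lemma theta_identity n (a th : R) (y : n.-tuple R) : 0 < a ->
  rsum (fun m : n.-tuple int => theta_weight a m * cos (2 * pi * dotv (intv R m) y + th)) =
  cos th * theta a y.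
Proof.
move=> a0; elim: n y th => [|n IH] y th.
  have [|_ E1] := @rsum1 R (0.-tuple int) [tuple]
      (fun m => theta_weight a m * cos (2 * pi * dotv (intv R m) y + th)).
    by move=> m; rewrite (tuple0 m) eqxx.
  have [|_ E2] := @rsum1 R (0.-tuple int) [tuple]
      (fun k => gaussian_density a (subv y (intv R k))).
    by move=> m; rewrite (tuple0 m) eqxx.
  rewrite E1 /theta E2 /theta_weight /gaussian_density !enorm2E /dotv !big_ord0.
  by rewrite !(mulr0, mul0r, oppr0, expR0, mul1r, mulr1, add0r, powRr0).
have sT : rsummable (fun z : int * n.-tuple int =>
    theta_coef a z.1%:~R * theta_weight a z.2 *
    cos (2 * pi * (z.1%:~R * thead y) +
         (2 * pi * dotv (intv R z.2) [tuple of behead y] + th))).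
  apply: (rsummable_le (rsummable_tensor (rsummable_theta_coef a0)
    (rsummable_theta_weight n a0))) => z.
  by rewrite normrM ger0_norm ?mulr_ge0 ?expR_ge0// ler_piMr ?cos_max// mulr_ge0 ?expR_ge0.
have E : (fun m => theta_weight a m * cos (2 * pi * dotv (intv R m) y + th)) \o @cons_int n =
    fun z : int * n.-tuple int =>
    theta_coef a z.1%:~R * theta_weight a z.2 *
    cos (2 * pi * (z.1%:~R * thead y) +
         (2 * pi * dotv (intv R z.2) [tuple of behead y] + th)).
  apply/funext => z /=; rewrite theta_weight_cons intv_cons {1}(cons_pair_surj y) dotv_cons /=.
  by congr (_ * cos _); ring.
rewrite -(rsum_reindex _ (cons_int_bij n)) E thetaS//.
(* The two indices are exchanged so that the inner sum runs over the first coordinate; the other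
   coordinates then only enter its phase, and [theta_line_identity] applies. *)
have bs : bijective (fun z : n.-tuple int * int => (z.2, z.1)).
  by exists (fun z => (z.2, z.1)) => -[].
rewrite -(rsum_reindex _ bs).
have [_ _ E'] := rsum_pair ((rsummable_reindex _ bs).1 sT).
rewrite [LHS]E' /=.
rewrite (_ : (fun i => _) = fun m : n.-tuple int => theta_line a (thead y) *
   (theta_weight a m * cos (2 * pi * dotv (intv R m) [tuple of behead y] + th))).
  rewrite rsumZ ?IH; first by ring.
  apply: (rsummable_le (rsummable_theta_weight n a0)) => m.
  by rewrite normrM ger0_norm ?expR_ge0// ler_piMr ?cos_max ?expR_ge0.
apply/funext => m; rewrite mulrCA -[X in _ = _ * X]mulrC -(theta_line_identity _ _ a0).
rewrite -rsumZ; first by congr rsum; apply/funext => i; ring.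
apply: (rsummable_le (rsummable_theta_coef a0)) => i.
by rewrite normrM ger0_norm ?expR_ge0// ler_piMr ?cos_max ?expR_ge0.
Qed.

(** A bound uniform in [y], read off the cosine series. It makes [f * theta] integrable for every
    integrable [f]. *)
Lemma theta_le n (a : R) (y : n.-tuple R) : 0 < a ->
  0 <= theta a y <= rsum (fun m : n.-tuple int => theta_weight a m).
Proof.
move=> a0; apply/andP; split; first by apply: rsum_ge0 => k; exact: gaussian_density_ge0.
have := theta_identity 0 y a0; rewrite cos0 mul1r => <-.
have sw := rsummable_theta_weight n a0.
have b m : `|theta_weight a m * cos (2 * pi * dotv (intv R m) y + 0)| <= theta_weight a m.
  by rewrite normrM ger0_norm ?expR_ge0// ler_piMr ?cos_max ?expR_ge0.
apply: le_rsum => //; first exact: rsummable_le sw b.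
by move=> m; rewrite (le_trans (ler_norm _)).
Qed.

Lemma measurable_theta d (T : measurableType d) n (a : R) (f : T -> n.-tuple R) :
  measurable_fun setT f -> measurable_fun setT (fun t => theta a (f t)).
Proof.
move=> mf; apply: (measurable_rsum (F := fun k t => gaussian_density a (subv (f t) (intv R k)))) => k.
apply: (measurableT_comp (@measurable_gaussian_density R n a)).
exact: measurable_subv.
Qed.

End theta_identity.

Lemma ler_sqr_norm (R : realType) (a b : R) : `|a| <= `|b| -> a ^+ 2 <= b ^+ 2.
Proof.
move=> ab; rewrite -(real_normK (num_real a)) -(real_normK (num_real b)).
by rewrite ler_pXn2r// nnegrE.
Qed.

(** * Continuity of translations in the square mean *)

Section square_integrable_difference.
Context d (T : measurableType d) (R : realType).
Variable mu : {measure set T -> \bar R}.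

Lemma integrable_sqrB (f g : T -> R) :
  measurable_fun setT f -> measurable_fun setT g ->
  mu.-integrable setT (EFin \o (fun x => f x ^+ 2)) ->
  mu.-integrable setT (EFin \o (fun x => g x ^+ 2)) ->
  mu.-integrable setT (EFin \o (fun x => (f x - g x) ^+ 2)).
Proof.
move=> mf mg if2 ig2.
apply: (integrable_le _ (integrable_scale 2 (integrable_add if2 ig2))).
  by apply: measurable_funX; exact: measurable_funB.
move=> x; rewrite ger0_norm ?sqr_ge0//.
have : 0 <= (f x + g x) ^+ 2 by exact: sqr_ge0.
rewrite sqrrD sqrrB; lra.
Qed.

End square_integrable_difference.

Section translation_line.
Context (R : realType).
Notation leb := (@lebesgue_measure R).

Lemma measurable_addr (h : R) : measurable_fun setT (fun x : R => x + h).
Proof. exact: measurable_funD. Qed.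

Lemma integrable_indic_sym (c : R) : 0 < c -> leb.-integrable setT
  (EFin \o (\1_(`[(- c)%R, c]%classic : set R) : R -> R)).
Proof.
move=> c0; apply/integrableP; split; first by apply/measurable_EFinP; exact: measurable_indic.
rewrite (_ : integral _ _ _ = \int[leb]_t (\1_(`[(- c)%R, c]%classic : set R) t)%:E)%E; last first.
  by apply: eq_integral => t _; rewrite /= ger0_norm// indicE.
rewrite integral_indic// setIT [ltLHS]lebesgue_measure_itv/=.
by case: ifP => _; rewrite ?ltry// -EFinB ltry.
Qed.

Lemma integrable_bounded_support (f : R -> R) (M : R) : 0 < M ->
  measurable_fun setT f -> (forall x, `|f x| <= M) ->
  (forall x, M < `|x| -> f x = 0) -> leb.-integrable setT (EFin \o f).
Proof.
move=> M0 mf fM supp.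
apply: (integrable_le _ (integrable_scale M (integrable_indic_sym M0))); first exact: mf.
move=> x; rewrite indicE mem_setE /= in_itv /= -ler_norml.
have [xM|xM] := lerP `|x| M; first by rewrite mulr1.
by rewrite mulr0 supp ?normr0//; lra.
Qed.

(** Approximate [f] in L^1 by a continuous [g] on the compact [E]. For [g] the claim is dominated
    convergence on the smaller interval [D], whose translates by [u n] stay in [E]. The margins 1
    and 2 around M come from |u n| <= 1. *)
Let translation_L1 (f : R -> R) (M : R) (u : nat -> R) : 0 < M ->
  measurable_fun setT f -> (forall x, `|f x| <= M) ->
  (forall x, M < `|x| -> f x = 0) ->
  u n @[n --> \oo] --> 0 -> (forall n, `|u n| <= 1) ->
  \int[leb]_x `|f x - f (x + u n)| @[n --> \oo] --> 0.
Proof.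
move=> M0 mf fM supp u0 u1.
pose D : set R := `[(- (M + 1))%R, (M + 1)%R]%classic.
pose E : set R := `[(- (M + 2))%R, (M + 2)%R]%classic.
have mE : measurable (E : set (measurableTypeR R)) by exact: measurable_itv.
have M10 : 0 < M + 1 by lra.
have M20 : 0 < M + 2 by lra.
have iD := integrable_indic_sym M10; have iE := integrable_indic_sym M20.
have if_ := integrable_bounded_support M0 mf fM supp.
apply/cvgrPdist_le => /= e e0.
have aux (a b : R) : a <= e / 4 -> b <= e / 2 -> a + b + a <= e by lra.
have e40 : 0 < e / 4 by rewrite divr_gt0.
have [g [cg ig ag]] : exists g : R -> R, [/\ continuous g,
    leb.-integrable E (EFin \o g) & \int[leb]_(x in E) `|f x - g x| <= e / 4].
  have ifE : leb.-integrable E (EFin \o f)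
    by apply: (integrableS measurableT _ _ if_) => //; exact: measurable_itv.
  have fE : (leb E < +oo)%E.
    by rewrite [ltLHS]lebesgue_measure_itv/=; case: ifP => _; rewrite ?ltry// -EFinB ltry.
  have [g_ [cg ig lim0]] := approximation_continuous_integrable mE fE ifE.
  have /fine_cvg := lim0; move/cvgrPdist_le => /(_ _ e40)[N _ /(_ N (leqnn N))] /=.
  rewrite sub0r normrN => h; exists (g_ N); split => //.
  by rewrite (le_trans (ler_norm _)).
have mg : measurable_fun setT g by exact: continuous_measurable_fun.
pose phi x := \1_E x * `|f x - g x|.
pose psi n x := \1_D x * `|g x - g (x + u n)|.
have iphi : leb.-integrable setT (EFin \o phi).
  have : leb.-integrable E (EFin \o (fun x => `|f x - g x|)).
    have ifE : leb.-integrable E (EFin \o f)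
    by apply: (integrableS measurableT _ _ if_) => //; exact: measurable_itv.
    have := integrable_abse (integrableB mE ifE ig).
    by apply: eq_integrable => // x _.
  move/(integrable_mkcond _ mE).
  apply: eq_integrable => // x _; rewrite patchE /phi /= indicE.
  by case: ifP => _; rewrite ?mul1r ?mul0r.
have phiE : \int[leb]_x phi x <= e / 4.
  rewrite (le_trans _ ag)// [leRHS]Rintegral_mkcond le_eqVlt; apply/orP; left; apply/eqP.
  apply: eq_Rintegral => x _; rewrite patchE /phi indicE.
  by case: ifP => _; rewrite ?mul1r ?mul0r.
have [B gB] : exists B, forall x, E x -> `|g x| <= B.
  have cptE : compact E by exact: segment_compact.
  have /compact_bounded[B [_ gB]] := continuous_compact (continuous_subspaceT cg) cptE.
  exists (B + 1) => x Ex; apply: (gB (B + 1)); first by rewrite ltrDl.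
  by exists x.
have DE n x : D x -> E (x + u n).
  rewrite /D /E /= !in_itv /= -!ler_norml => xD.
  by rewrite (le_trans (ler_normD _ _))//; have := u1 n; lra.
have DE0 x : D x -> E x.
  by rewrite /D /E /= !in_itv /= -!ler_norml; lra.
have mpsi n : measurable_fun setT (psi n).
  apply: measurable_funM; first by apply: measurable_indic; exact: measurable_itv.
  apply: measurableT_comp => //; apply: measurable_funB => //.
  by apply: (measurableT_comp mg); exact: measurable_addr.
have psib n x : `|psi n x| <= 2 * B * \1_D x.
  rewrite normrM !normr_id indicE; have [xD|xD] := boolP (x \in D); last first.
    by rewrite normr0 mul0r mulr0.
  rewrite normr1 mul1r mulr1 (le_trans (ler_normB _ _))//.
  rewrite inE in xD.
  by have := gB _ (DE0 _ xD); have := gB _ (DE n _ xD); lra.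
have ipsi n : leb.-integrable setT (EFin \o psi n).
  by apply: (integrable_le _ (integrable_scale (2 * B) iD) (psib n)); exact: mpsi.
have psi0 : \int[leb]_x psi n x @[n --> \oo] --> \int[leb]_x (cst 0 x : R).
  apply: (Rintegral_dominated_cvg _ _ _ (integrable_scale (2 * B) iD) psib) => //.
  move=> x; rewrite -[X in _ --> X](mulr0 (\1_D x : R)).
  have xu : x + u n @[n --> \oo] --> x.
    by rewrite -[X in _ --> X](addr0 x); apply: cvgD => //; exact: cvg_cst.
  apply: cvgMr; rewrite -[X in _ --> X](normr0 R).
  apply: cvg_norm; rewrite -[X in _ --> X](subrr (g x)).
  apply: cvgB; first exact: cvg_cst.
  exact: (cvg_comp _ _ xu (cg x)).
rewrite [X in _ --> X](_ : _ = 0) in psi0; last by rewrite /Rintegral integral0.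
have e20 : 0 < e / 2 by rewrite divr_gt0.
move/cvgrPdist_le : psi0 => /(_ _ e20); apply: filterS => n /=.
rewrite !sub0r !normrN => hpsi.
have ifu : leb.-integrable setT (EFin \o (fun x => `|f x - f (x + u n)|)).
  by apply: integrable_norm; apply: integrable_sub => //; exact: (integrable_shift (u n) if_).
rewrite ger0_norm ?Rintegral_ge0//.
have iphiu := integrable_shift (u n) iphi.
(* Outside [D] both values of [f] vanish; inside, the triangle inequality passes through [g] at [x]
   and at [x + u n]. The three integrals are at most e/4, e/2 and e/4. *)
apply: (@le_trans _ _ (\int[leb]_x (phi x + psi n x + phi (x + u n)))).
  apply: le_Rintegral => //.
    by apply: integrable_add => //; exact: integrable_add.
  move=> x _; have phi0 z : 0 <= phi z by rewrite mulr_ge0// indicE.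
  have psi0 : 0 <= psi n x by rewrite mulr_ge0// indicE.
  have [xD|xD] := boolP (x \in D); last first.
    have xM : M + 1 < `|x|.
      by move: xD; rewrite mem_setE /= in_itv /= -ler_norml -ltNge.
    rewrite supp; last by lra.
    rewrite supp; first by rewrite subrr normr0 !addr_ge0.
    have := ler_normB (x + u n) (u n); rewrite addrK.
    by have := u1 n; lra.
  rewrite inE in xD; rewrite /phi /psi !indicE !mem_set//; [|exact: DE|exact: DE0].
  rewrite !mul1r (_ : f x - f (x + u n) = (f x - g x) + (g x - g (x + u n)) -
    (f (x + u n) - g (x + u n))); last by ring.
  by rewrite (le_trans (ler_normB _ _))// lerD2r ler_normD.
rewrite RintegralD//; last exact: integrable_add.
rewrite RintegralD// (Rintegral_shift (u n) iphi).
exact: (aux _ _ phiE (le_trans (ler_norm _) hpsi)).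
Qed.

Lemma integrable_sqr_shift (f : R -> R) h :
  leb.-integrable setT (EFin \o (fun x => f x ^+ 2)) ->
  leb.-integrable setT (EFin \o (fun x => f (x + h) ^+ 2)).
Proof. by move=> /(integrable_shift h). Qed.

(** Truncate [f] in value and in support. The tail is small in L^2, and for the truncation the
    squared difference is at most 2 (M + 1) times the absolute difference, so [translation_L1]
    suffices. *)
Lemma translation_L2_bounded (f : R -> R) (u : nat -> R) :
  measurable_fun setT f -> leb.-integrable setT (EFin \o (fun x => f x ^+ 2)) ->
  u n @[n --> \oo] --> 0 -> (forall n, `|u n| <= 1) ->
  \int[leb]_x (f x - f (x + u n)) ^+ 2 @[n --> \oo] --> 0.
Proof.
move=> mf if2 u0 u1.
pose t (M : nat) (x : R) : R := if (`|f x| <= M.+1%:R) && (`|x| <= M.+1%:R) then f x else 0.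
have mt M : measurable_fun setT (t M).
  apply: measurable_fun_ifT => //; apply: measurable_and.
    by apply: measurable_fun_ler => //; exact: measurableT_comp.
  by apply: measurable_fun_ler => //.
have tle M x : `|t M x| <= `|f x| by rewrite /t; case: ifP; rewrite ?normr0.
have rle M x : `|f x - t M x| <= `|f x|.
  by rewrite /t; case: ifP; rewrite ?subr0// subrr normr0.
have it2 M : leb.-integrable setT (EFin \o (fun x => t M x ^+ 2)).
  apply: (integrable_le _ if2); first by apply: measurable_funX; exact: mt.
  by move=> x; rewrite ger0_norm ?sqr_ge0//; exact: ler_sqr_norm.
have r0 : \int[leb]_x (f x - t M x) ^+ 2 @[M --> \oo] --> \int[leb]_x (cst 0 x : R).
  apply: (Rintegral_dominated_cvg _ _ _ if2) => //.
  - by move=> M; apply: measurable_funX; apply: measurable_funB; [exact: mf|exact: mt].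
  - move=> x; apply: cvg_near_cst; near=> M.
    rewrite /t (_ : _ && _ = true) ?subrr ?expr0n//; apply/andP; split.
      by rewrite (@le_trans _ _ M%:R) ?ler_nat//; near: M; exact: nbhs_infty_ger.
    by rewrite (@le_trans _ _ M%:R) ?ler_nat//; near: M; exact: nbhs_infty_ger.
  - by move=> M x; rewrite ger0_norm ?sqr_ge0//; exact: ler_sqr_norm.
rewrite [X in _ --> X](_ : _ = 0) in r0; last by rewrite /Rintegral integral0.
apply/cvgrPdist_le => /= e e0.
(* Here [j] is the square norm of the tail, counted once at x and once at x + u n, and [i] that of
   the truncated difference: 2 (e/4) + 8 (e/16) = e. *)
have aux (i j k : R) : j <= e / 16 -> i <= k -> k <= e / 4 -> 2 * i + (4 * j + 4 * j) <= e by lra.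
have e160 : 0 < e / 16 by rewrite divr_gt0.
move/cvgrPdist_le : r0 => /(_ _ e160)[M _ /(_ M (leqnn M))] /=.
rewrite sub0r normrN => hM.
have tb x : `|t M x| <= M.+1%:R.
  by rewrite /t; case: ifP => [/andP[]//|_]; rewrite normr0.
have ts x : M.+1%:R < `|x| -> t M x = 0.
  by rewrite ltNge /t => /negbTE ->; rewrite andbF.
have M0 : 0 < M.+1%:R :> R by [].
have := translation_L1 M0 (mt M) tb ts u0 u1.
have e80 : 0 < e / (8 * M.+1%:R) by rewrite divr_gt0// mulr_gt0.
move/cvgrPdist_le => /(_ _ e80); apply: filterS => n /=.
rewrite !sub0r !normrN => hn.
have mfu : measurable_fun setT (fun x : R => f (x + u n)).
  by apply: (measurableT_comp mf); exact: measurable_addr.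
have mtu : measurable_fun setT (fun x : R => t M (x + u n)).
  by apply: (measurableT_comp (mt M)); exact: measurable_addr.
pose r (x : R) := (f x - t M x) ^+ 2.
have ir : leb.-integrable setT (EFin \o r).
  by apply: integrable_sqrB; [exact: mf|exact: mt|exact: if2|exact: it2].
have iru := integrable_shift (u n) ir.
have isq : leb.-integrable setT (EFin \o (fun x => (f x - f (x + u n)) ^+ 2)).
  by apply: integrable_sqrB; [exact: mf|exact: mfu|exact: if2|exact: integrable_sqr_shift].
have itq : leb.-integrable setT (EFin \o (fun x => (t M x - t M (x + u n)) ^+ 2)).
  by apply: integrable_sqrB; [exact: mt|exact: mtu|exact: it2|exact: (integrable_sqr_shift (u n) (it2 M))].
rewrite ger0_norm; last by apply: Rintegral_ge0 => x _; exact: sqr_ge0.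
apply: (@le_trans _ _ (\int[leb]_x (2 * (t M x - t M (x + u n)) ^+ 2 + (4 * r x + 4 * r (x + u n))))).
  apply: le_Rintegral => //.
    apply: integrable_add; first exact: integrable_scale.
    by apply: integrable_add; [exact: integrable_scale|exact: (integrable_scale 4 iru)].
  move=> x _; rewrite /r; set a := f x; set b := f _; set c := t M x; set d := t M _.
  have : 0 <= ((c - d) - ((a - c) - (b - d))) ^+ 2 by exact: sqr_ge0.
  have : 0 <= ((a - c) + (b - d)) ^+ 2 by exact: sqr_ge0.
  nra.
rewrite RintegralD//; last 2 first.
- exact: integrable_scale.
- by apply: integrable_add; [exact: integrable_scale|exact: (integrable_scale 4 iru)].
rewrite RintegralZl// RintegralD//; last 2 first.
- exact: integrable_scale.
- exact: (integrable_scale 4 iru).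
rewrite !RintegralZl// (Rintegral_shift (u n) ir).
have h1 := le_trans (ler_norm _) hM; have h2 := le_trans (ler_norm _) hn.
have itl : leb.-integrable setT (EFin \o (fun x => `|t M x - t M (x + u n)|)).
  have it := integrable_bounded_support M0 (mt M) tb ts.
  by apply: integrable_norm; apply: integrable_sub => //; exact: (integrable_shift (u n) it).
have h3 : \int[leb]_x (t M x - t M (x + u n)) ^+ 2 <=
    2 * M.+1%:R * \int[leb]_x `|t M x - t M (x + u n)|.
  rewrite -RintegralZl//; apply: le_Rintegral => //; first exact: integrable_scale.
  move=> x _; rewrite -real_normK ?num_real// expr2 ler_wpM2r//.
  by rewrite (le_trans (ler_normB _ _))//; have := tb x; have := tb (x + u n); lra.
have h4 : 2 * M.+1%:R * \int[leb]_x `|t M x - t M (x + u n)| <= e / 4.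
  rewrite (_ : e / 4 = 2 * M.+1%:R * (e / (8 * M.+1%:R))); last by have := lt0r_neq0 M0; move: M.+1%:R => c c0; field.
  by rewrite ler_wpM2l.
exact: (aux _ _ _ h1 h3 h4).
Unshelve. all: by end_near. Qed.

End translation_line.

Section translation.
Context (R : realType).
Notation leb := (@lebesgue_measure R).
Notation lebn n := (lebesgue R n).
Notation RM := (measurableTypeR R).

Lemma translation_L2_line (f : R -> R) (u : nat -> R) :
  measurable_fun setT f -> leb.-integrable setT (EFin \o (fun x => f x ^+ 2)) ->
  u n @[n --> \oo] --> 0 ->
  \int[leb]_x (f x - f (x + u n)) ^+ 2 @[n --> \oo] --> 0.
Proof.
move=> mf if2 u0.
pose v n := if `|u n| <= 1 then u n else 0.
have v1 n : `|v n| <= 1 by rewrite /v; case: ifP => //; rewrite normr0.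
have uv : \forall n \near \oo, v n = u n.
  move/cvgrPdist_le : u0 => /(_ _ ltr01); apply: filterS => n.
  by rewrite sub0r normrN /v => ->.
have v0 : v n @[n --> \oo] --> 0.
  by apply: cvg_trans u0; apply: near_eq_cvg; apply: filterS uv => n ->.
have := translation_L2_bounded mf if2 v0 v1; apply: cvg_trans; apply: near_eq_cvg.
by apply: filterS uv => n ->.
Qed.

Lemma integrable_sqr_addv n (f : n.-tuple R -> R) (w : n.-tuple R) :
  (lebn n).-integrable setT (EFin \o (fun x => f x ^+ 2)) ->
  (lebn n).-integrable setT (EFin \o (fun x => f (addv x w) ^+ 2)).
Proof. by move=> i2; exact: (integrable_addv w i2). Qed.

Lemma measurable_comp_addv n (f : n.-tuple R -> R) (w : n.-tuple R) :
  measurable_fun setT f -> measurable_fun setT (fun x => f (addv x w)).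
Proof. by move=> mf; apply: (measurableT_comp mf); apply: measurable_addv. Qed.

Lemma sqrB_le2 (a b c : R) : (a - c) ^+ 2 <= 2 * (a - b) ^+ 2 + 2 * (b - c) ^+ 2.
Proof. have : 0 <= ((a - b) - (b - c)) ^+ 2 by exact: sqr_ge0. nra. Qed.

Lemma sqrB_le2sqr (a b : R) : (a - b) ^+ 2 <= 2 * a ^+ 2 + 2 * b ^+ 2.
Proof. have : 0 <= (a + b) ^+ 2 by exact: sqr_ge0. nra. Qed.

Let ae_sec1 n (f : n.+1.-tuple R -> R) : (lebn n.+1).-integrable setT (EFin \o f) ->
  {ae leb, forall u, (lebn n).-integrable setT (EFin \o (fun v => f (consv (u, v))))}.
Proof.
move=> /integrable_lebesgueS[+ _]; exact: ae_integrable1.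
Qed.

Let ae_sec2 n (f : n.+1.-tuple R -> R) : (lebn n.+1).-integrable setT (EFin \o f) ->
  {ae lebn n, forall v, leb.-integrable setT (EFin \o (fun u => f (consv (u, v))))}.
Proof.
move=> /integrable_lebesgueS[+ _]; exact: ae_integrable2.
Qed.

(** Induction on the dimension: the shift is a shift [wa] of the first coordinate followed by a
    shift [wb] of the others, each handled on almost every section. *)
Lemma translation_L2 n (f : n.-tuple R -> R) (w : nat -> n.-tuple R) :
  measurable_fun setT f -> (lebn n).-integrable setT (EFin \o (fun x => f x ^+ 2)) ->
  (forall i, tnth (w k) i @[k --> \oo] --> 0) ->
  \int[lebn n]_x (f x - f (addv x (w k))) ^+ 2 @[k --> \oo] --> 0.
Proof.
elim: n f w => [|n IH] f w mf if2 w0.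
  apply: cvg_near_cst; apply: nearW => k; rewrite /Rintegral integral_lebesgue0.
    by rewrite /= (tuple0 (addv _ _)) subrr expr0n.
  by apply/measurable_EFinP; apply: measurable_funX; apply: measurable_funB => //; exact: measurable_comp_addv.
pose o := scalev 0 (w 0%N).
pose a k := thead (w k); pose b k : n.-tuple R := [tuple of behead (w k)].
pose zn : n.-tuple R := [tuple 0 | i < n].
have znE (x : n.-tuple R) : addv x zn = x.
  by apply: eq_from_tnth => i; rewrite !tnth_mktuple addr0.
pose wa k : n.+1.-tuple R := cons_pair (a k, zn).
pose wb k : n.+1.-tuple R := cons_pair (0, b k).
have a0 : a k @[k --> \oo] --> 0 by exact: w0.
have b0 i : tnth (b k) i @[k --> \oo] --> 0.
  rewrite (_ : (fun k => _) = (fun k => tnth (w k) (lift ord0 i))); first exact: w0.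
  by apply/funext => k; rewrite [in RHS](cons_pair_surj (w k)) tnth_cons_pairS.
have wE x k : addv x (w k) = addv (addv x (wa k)) (wb k).
  rewrite (cons_pair_surj x) {1}(cons_pair_surj (w k)) !addv_cons.
  by rewrite /= addr0 znE.
have mF v : measurable_fun setT (fun x => (f x - f (addv x v)) ^+ 2).
  by apply: measurable_funX; apply: measurable_funB => //; exact: measurable_comp_addv.
have iF v : (lebn n.+1).-integrable setT (EFin \o (fun x => (f x - f (addv x v)) ^+ 2)).
  by apply: integrable_sqrB => //; [exact: measurable_comp_addv|exact: integrable_sqr_addv].
have le k : \int[lebn n.+1]_x (f x - f (addv x (w k))) ^+ 2 <=
   2 * \int[lebn n.+1]_x (f x - f (addv x (wa k))) ^+ 2 +
   2 * \int[lebn n.+1]_x (f x - f (addv x (wb k))) ^+ 2.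
  rewrite -(Rintegral_addv (wa k) (iF (wb k))).
  have i1 := iF (wa k); have i2 := integrable_addv (wa k) (iF (wb k)).
  rewrite -!RintegralZl// -RintegralD//; [|exact: integrable_scale|exact: (integrable_scale 2 i2)].
  apply: le_Rintegral => //.
    by apply: integrable_add; [exact: integrable_scale|exact: (integrable_scale 2 i2)].
  by move=> x _; rewrite wE; exact: sqrB_le2.
have [if2' _] := (integrable_lebesgueS (fun x => f x ^+ 2)).1 if2.
have mfc : measurable_fun setT (fun z : RM * n.-tuple R => f (consv z)).
  by apply: (measurableT_comp mf); exact: measurable_consv.
have mf1 (u : RM) : measurable_fun setT (fun v : n.-tuple R => f (consv (u, v))).
  by apply: (measurableT_comp mfc); exact: measurable_pair1.
have mf2 (v : n.-tuple R) : measurable_fun setT (fun u : RM => f (consv (u, v))).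
  by apply: (measurableT_comp mfc); exact: measurable_pair2.
have Ha : \int[lebn n.+1]_x (f x - f (addv x (wa k))) ^+ 2 @[k --> \oo] --> 0.
  have E k : \int[lebn n.+1]_x (f x - f (addv x (wa k))) ^+ 2 =
      \int[lebn n]_v \int[leb]_u (f (consv (u, v)) - f (consv (u + a k, v))) ^+ 2.
    rewrite Rintegral_lebesgueS// (Rintegral_Fubini ((integrable_lebesgueS _).1 (iF (wa k))).1).
    apply: eq_Rintegral => v _; apply: eq_Rintegral => u _.
    by rewrite /consv addv_cons /= znE.
  rewrite (_ : (fun k => _) = (fun k => \int[lebn n]_v \int[leb]_u (f (consv (u, v)) - f (consv (u + a k, v))) ^+ 2)); last first.
    by apply/funext.
  (* On a section the square norm of a difference is at most twice the sum of the two square norms,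
     which are equal by translation invariance: the majorant 4 |f|^2 is independent of [k]. *)
  pose G v := \int[leb]_u (4 * f (consv (u, v)) ^+ 2).
  have iG : (lebn n).-integrable setT (EFin \o G).
    exact: (integrable_Rintegral2 (f := fun z => 4 * f (consv z) ^+ 2) (integrable_scale 4 if2')).
  rewrite [X in _ --> X](_ : 0 = \int[lebn n]_v (cst 0 v : R)); last by rewrite /Rintegral integral0.
  apply: (ae_Rintegral_dominated_cvg _ _ _ iG) => //.
  - move=> k; have := integrable_Rintegral2 ((integrable_lebesgueS _).1 (iF (wa k))).1.
    move/integrable_measurable; congr (measurable_fun _ _); apply/funext => v.
    by apply: eq_Rintegral => u _; rewrite /consv addv_cons /= znE.
  - apply: filterS (ae_sec2 if2) => v iv; apply: translation_L2_line => //; exact: mf2.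
  - apply: filterS (ae_sec2 if2) => v iv k.
    rewrite ger0_norm; last by apply: Rintegral_ge0 => u _; exact: sqr_ge0.
    have ivk := integrable_shift (a k) iv.
    have eqI : \int[leb]_u (4 * f (consv (u, v)) ^+ 2) =
       \int[leb]_u (2 * f (consv (u, v)) ^+ 2 + 2 * f (consv (u + a k, v)) ^+ 2).
      rewrite RintegralD//; [|exact: integrable_scale|exact: (integrable_scale 2 ivk)].
      rewrite !RintegralZl// (Rintegral_shift (a k) iv); lra.
    rewrite /G eqI; apply: le_Rintegral => //.
    + apply: integrable_sqrB; [exact: mf2| |exact: iv|exact: ivk].
      by apply: (measurableT_comp (mf2 v)); exact: measurable_addr.
    + by apply: integrable_add; [exact: integrable_scale|exact: (integrable_scale 2 ivk)].
    + by move=> u _; exact: sqrB_le2sqr.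
have Hb : \int[lebn n.+1]_x (f x - f (addv x (wb k))) ^+ 2 @[k --> \oo] --> 0.
  have E k : \int[lebn n.+1]_x (f x - f (addv x (wb k))) ^+ 2 =
      \int[leb]_u \int[lebn n]_v (f (consv (u, v)) - f (consv (u, addv v (b k)))) ^+ 2.
    rewrite Rintegral_lebesgueS//.
    apply: eq_Rintegral => u _; apply: eq_Rintegral => v _.
    by rewrite /consv addv_cons /= addr0.
  rewrite (_ : (fun k => _) = (fun k => \int[leb]_u \int[lebn n]_v (f (consv (u, v)) - f (consv (u, addv v (b k)))) ^+ 2)); last first.
    by apply/funext.
  pose G u := \int[lebn n]_v (4 * f (consv (u, v)) ^+ 2).
  have iG : leb.-integrable setT (EFin \o G).
    exact: (integrable_Rintegral1 (f := fun z => 4 * f (consv z) ^+ 2) (integrable_scale 4 if2')).1.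
  rewrite [X in _ --> X](_ : 0 = \int[leb]_u (cst 0 u : R)); last by rewrite /Rintegral integral0.
  apply: (ae_Rintegral_dominated_cvg _ _ _ iG) => //.
  - move=> k; have := (integrable_Rintegral1 ((integrable_lebesgueS _).1 (iF (wb k))).1).1.
    move/integrable_measurable; congr (measurable_fun _ _); apply/funext => u.
    by apply: eq_Rintegral => v _; rewrite /consv addv_cons /= addr0.
  - apply: filterS (ae_sec1 if2) => u iu; apply: (IH (fun v => f (consv (u, v)))) => //; exact: mf1.
  - apply: filterS (ae_sec1 if2) => u iu k.
    rewrite ger0_norm; last by apply: Rintegral_ge0 => v _; exact: sqr_ge0.
    have iuk := integrable_addv (b k) iu.
    have eqI : \int[lebn n]_v (4 * f (consv (u, v)) ^+ 2) =
       \int[lebn n]_v (2 * f (consv (u, v)) ^+ 2 + 2 * f (consv (u, addv v (b k))) ^+ 2).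
      rewrite RintegralD//; [|exact: integrable_scale|exact: (integrable_scale 2 iuk)].
      rewrite !RintegralZl// (Rintegral_addv (b k) iu); lra.
    rewrite /G eqI; apply: le_Rintegral => //.
    + apply: integrable_sqrB; [exact: mf1| |exact: iu|exact: iuk].
      exact: (measurable_comp_addv _ (mf1 u)).
    + by apply: integrable_add; [exact: integrable_scale|exact: (integrable_scale 2 iuk)].
    + by move=> v _; exact: sqrB_le2sqr.
have H := cvgD (cvgD Ha Ha) (cvgD Hb Hb); rewrite !addr0 in H.
apply: squeeze_cvgr; [|exact: (@cvg_cst _ (0 : R))|exact: H]; apply: nearW => k.
rewrite Rintegral_ge0 => [|x _]; last exact: sqr_ge0.
by rewrite (le_trans (le k))//= !mulr2n !mulrDl !mul1r.
Qed.

End translation.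

Lemma Rintegral_tensor d1 d2 (T1 : measurableType d1) (T2 : measurableType d2) (R : realType)
  (m1 : {sigma_finite_measure set T1 -> \bar R}) (m2 : {sigma_finite_measure set T2 -> \bar R})
  (f : T1 -> R) (g : T2 -> R) :
  m1.-integrable setT (EFin \o f) -> m2.-integrable setT (EFin \o g) ->
  \int[(m1 \x m2)%E]_z (f z.1 * g z.2) = \int[m1]_x f x * \int[m2]_y g y.
Proof.
move=> if_ ig; rewrite (Rintegral_prod1 (f := fun z => f z.1 * g z.2)); last exact: integrable_tensor.
rewrite -RintegralZr//; apply: eq_Rintegral => x _ /=; rewrite RintegralZl//.
Qed.

(* The library equips [m1 \x m2] with a canonical sigma-finite structure only
   when the factors are subprobabilities. *)
Section sigma_finite_product.
Context d1 d2 (T1 : measurableType d1) (T2 : measurableType d2) (R : realType).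
Variable m1 : {sigma_finite_measure set T1 -> \bar R}.
Variable m2 : {sigma_finite_measure set T2 -> \bar R}.

Definition sfprod : set (T1 * T2) -> \bar R := (m1 \x m2)%E.

HB.instance Definition _ := Measure.on sfprod.

Let sigma_finite_sfprod : sigma_finite setT sfprod.
Proof.
have /sigma_finiteP[F [TF ndF Foo]] := sigma_finiteT m1.
have /sigma_finiteP[G [TG ndG Goo]] := sigma_finiteT m2.
exists (fun k => F k `*` G k).
  apply/seteqP; split=> // -[x y] _.
  have [i _ Fix] : (\bigcup_i F i) x by rewrite -TF.
  have [j _ Gjy] : (\bigcup_i G i) y by rewrite -TG.
  exists (maxn i j) => //; split=> /=.
    by move: x Fix; exact/subsetPset/ndF/leq_maxl.
  by move: y Gjy; exact/subsetPset/ndG/leq_maxr.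
move=> k; have [mF Fk] := Foo k; have [mG Gk] := Goo k.
split; first exact: measurableX.
by rewrite /sfprod product_measure1E// lte_mul_pinfty// ge0_fin_numE.
Qed.

HB.instance Definition _ := Measure_isSigmaFinite.Build _ _ _ sfprod
  sigma_finite_sfprod.

End sigma_finite_product.

(** * Plancherel's formula *)

Section fourier_products.
Context (R : realType) (n : nat).
Notation mu := (lebesgue R n).
Notation mu2 := (lebesgue R n \x lebesgue R n)%E.
Implicit Types (h : n.-tuple R -> R) (l x y s : n.-tuple R).

Definition cosft h (th : R) l : R := \int[mu]_x (h x * cos (2 * pi * dotv x l + th)).

Lemma integrable_mul_cos h c l th : mu.-integrable setT (EFin \o h) ->
  mu.-integrable setT (EFin \o (fun x => h x * cos (c * dotv x l + th))).
Proof.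
move=> ih; apply: (integrable_mulb (M := 1) _ ih); first exact: measurable_cos_dotv.
by move=> x; rewrite ler_norml cos_geN1 cos_le1.
Qed.

Lemma cosftE h th l : mu.-integrable setT (EFin \o h) ->
  cosft h th l = cos th * cosft h 0 l + sin th * cosft h (pi / 2) l.
Proof.
move=> ih; have i0 := integrable_mul_cos (2 * pi) l 0 ih.
have i1 := integrable_mul_cos (2 * pi) l (pi / 2) ih.
rewrite /cosft -!RintegralZl// -RintegralD//; [|exact: (integrable_scale _ i0)|exact: (integrable_scale _ i1)].
apply: eq_Rintegral => x _; rewrite addr0 !cosD cos_pihalf sin_pihalf; ring.
Qed.

(** The real part of exp (- i th) * fourier h l * fourier h l', so that th = 0 and th = pi / 2
    return the real and imaginary parts of the product. *)
Definition ftprod h th l l' : R :=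
  cos th * (cosft h 0 l * cosft h 0 l' - cosft h (pi / 2) l * cosft h (pi / 2) l') +
  sin th * (cosft h (pi / 2) l * cosft h 0 l' + cosft h 0 l * cosft h (pi / 2) l').

Lemma ftprodE h th l l' : mu.-integrable setT (EFin \o h) ->
  ftprod h th l l' = \int[mu2]_z
    (h z.1 * h z.2 * cos (2 * pi * (dotv z.1 l + dotv z.2 l') + th)).
Proof.
move=> ih.
transitivity (cosft h th l * cosft h 0 l' - cosft h (th + pi / 2) l * cosft h (pi / 2) l').
  rewrite (cosftE th)// (cosftE (th + _))// cosD sinD cos_pihalf sin_pihalf /ftprod; ring.
pose F c l x := h x * cos (2 * pi * dotv x l + c).
have iF c l0 : mu.-integrable setT (EFin \o F c l0) by exact: integrable_mul_cos.
have iT c l0 c' l0' := integrable_tensor (iF c l0) (iF c' l0').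
rewrite /cosft -!(Rintegral_tensor (iF _ _) (iF _ _)) -RintegralB//.
apply: eq_Rintegral => z _; rewrite /F /=.
set A := 2 * pi * dotv z.1 l; set B := 2 * pi * dotv z.2 l'.
rewrite (_ : 2 * pi * _ + th = (A + th) + B); last by rewrite /A /B; ring.
by rewrite addr0 addrA !cosDpihalf (cosD _ B); ring.
Qed.

Lemma measurable_cos_dotv2 d' (T : measurableType d') (f g : T -> n.-tuple R) (u : T -> R) c :
  measurable_fun setT f -> measurable_fun setT g -> measurable_fun setT u ->
  measurable_fun setT (fun t => cos (c * dotv (f t) (g t) + u t)).
Proof.
move=> mf mg mu_; apply: (measurableT_comp (@measurable_cos R)).
by apply: measurable_funD => //; apply: measurable_funM => //; exact: measurable_dotv.
Qed.

(** An integrable Gaussian factor [g l] makes the kernel jointly integrable, so Fubini gives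
    measurability in [l]; the factor is then divided out. *)
Lemma measurable_cosft h th : mu.-integrable setT (EFin \o h) ->
  measurable_fun setT (cosft h th).
Proof.
move=> ih.
pose g l : R := expR (- (1 * enorm l ^+ 2)).
have ig : mu.-integrable setT (EFin \o g) by exact: integrable_exp_enorm.
have iG : mu2.-integrable setT (EFin \o (fun z => h z.1 * g z.2 * cos (2 * pi * dotv z.1 z.2 + th))).
  apply: (integrable_mulb (M := 1) _ (integrable_tensor ih ig)).
    exact: measurable_cos_dotv2.
  by move=> z; rewrite ler_norml cos_geN1 cos_le1.
have mG := integrable_measurable (integrable_Rintegral2 iG).
rewrite (_ : cosft h th = fun l => expR (enorm l ^+ 2) *
   \int[mu]_x (h x * g l * cos (2 * pi * dotv x l + th))); last first.
  apply/funext => l; rewrite (_ : \int[mu]_x _ = g l * cosft h th l).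
    by rewrite mulrA /g mul1r -expRD subrr expR0 mul1r.
  rewrite -RintegralZl//; last exact: integrable_mul_cos.
  by apply: eq_Rintegral => x _ /=; ring.
apply: measurable_funM => //; apply: measurableT_comp; first exact: measurable_expR.
exact: measurable_enorm2.
Qed.

Lemma measurable_ftprod h th s : mu.-integrable setT (EFin \o h) ->
  measurable_fun setT (fun l => ftprod h th l (subv s l)).
Proof.
move=> ih; have mc t := measurable_cosft t ih.
have mcs t : measurable_fun setT (fun l => cosft h t (subv s l)).
  by apply: (measurableT_comp (mc t)); apply: measurable_subv.
by apply: measurable_funD; apply: measurable_funM => //;
  [apply: measurable_funB|apply: measurable_funD]; apply: measurable_funM.
Qed.

(** For b tending to 0 it approaches the diagonal integral of h^2, which is how Plancherel arises;
    for b = 2 a / r^2 it is the double integral in the m-th term. *)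
Definition smoothed h b s th : R := \int[mu2]_z
  (h z.1 * h z.2 * gaussian_density b (subv z.1 z.2) * cos (pi * dotv (addv z.1 z.2) s + th)).

(** Completing the square writes the weight as a constant times a Gaussian centered at s / 2. After
    the translation by s / 2, integrating out [l] first leaves the Fourier transform of a Gaussian
    at z.1 - z.2, and the phase becomes pi <z.1 + z.2, s>. *)
Lemma ftprod_gauss h e s th : 0 < e -> mu.-integrable setT (EFin \o h) ->
  let F l := ftprod h th l (subv s l) *
    expR (- (e * pi ^+ 2 * (enorm l ^+ 2 + enorm (subv s l) ^+ 2))) in
  mu.-integrable setT (EFin \o F) /\
  \int[mu]_l F l = expR (- (e * pi ^+ 2 / 2 * enorm s ^+ 2)) * smoothed h (2 * e) s th.
Proof.
move=> e0 ih F.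
pose w l : R := expR (- (2 * e * pi ^+ 2 * enorm l ^+ 2)).
pose v := scalev (- 2^-1) s.
pose c0 := expR (- (e * pi ^+ 2 / 2 * enorm s ^+ 2)).
have iw : mu.-integrable setT (EFin \o w).
  by apply: integrable_exp_enorm; rewrite !mulr_gt0// pi_gt0.
have WE l : expR (- (e * pi ^+ 2 * (enorm l ^+ 2 + enorm (subv s l) ^+ 2))) =
    c0 * w (addv l v).
  rewrite /c0 /w -expRD; congr expR; rewrite !enorm2E /v !dotvE (dotvC l s).
  by move: (pi : R) => p; field.
pose G z := h z.1.1 * h z.1.2 * w (addv z.2 v) *
  cos (2 * pi * dotv (subv z.1.1 z.1.2) z.2 + (2 * pi * dotv z.1.2 s + th)).
have iG : (sfprod mu mu \x mu)%E.-integrable setT (EFin \o G).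
  have iT := integrable_tensor (m1 := sfprod mu mu) (integrable_tensor ih ih) (integrable_addv v iw).
  refine (@integrable_mulb _ _ _ _ _ (fun z => cos (2 * pi * dotv (subv z.1.1 z.1.2) z.2 + (2 * pi * dotv z.1.2 s + th))) 1 _ iT _).
    have m11 : measurable_fun setT (fun z : (n.-tuple R * n.-tuple R) * n.-tuple R => z.1.1).
      exact: (measurableT_comp measurable_fst measurable_fst).
    have m12 : measurable_fun setT (fun z : (n.-tuple R * n.-tuple R) * n.-tuple R => z.1.2).
      exact: (measurableT_comp measurable_snd measurable_fst).
    apply: measurable_cos_dotv2; [exact: measurable_subv|exact: measurable_snd|].
    by apply: measurable_funD => //; apply: measurable_funM => //; exact: measurable_dotv.
  by move=> z; rewrite ler_norml cos_geN1 cos_le1.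
have FE l : F l = c0 * \int[mu2]_z G (z, l).
  rewrite /F WE mulrCA; congr (_ * _); rewrite ftprodE// -RintegralZr//; last first.
    apply: (integrable_mulb (M := 1) _ (integrable_tensor ih ih)).
      by apply: (measurableT_comp (@measurable_cos R)); apply: measurable_funD => //;
        apply: measurable_funM => //; apply: measurable_funD; exact: measurable_dotv.
    by move=> z; rewrite ler_norml cos_geN1 cos_le1.
  apply: eq_Rintegral => z _; rewrite /G /= mulrAC; congr (_ * _ * cos _).
  by rewrite !dotvE; ring.
have -> : F = fun l => c0 * \int[mu2]_z G (z, l) by exact/funext.
have iGl := integrable_Rintegral2 iG.
split; first exact: (integrable_scale c0 iGl).
rewrite RintegralZl//; congr (_ * _); rewrite -(Rintegral_Fubini iG).
apply: eq_Rintegral => z _; rewrite /G /=.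
pose f l := w l * cos (2 * pi * dotv l (subv z.1 z.2) + (pi * dotv (addv z.1 z.2) s + th)).
have if_ : mu.-integrable setT (EFin \o f) by exact: integrable_mul_cos.
transitivity (\int[mu]_l (h z.1 * h z.2 * f (addv l v))).
  apply: eq_Rintegral => l _; rewrite /f -!mulrA; congr (_ * (_ * (_ * cos _))).
  by rewrite /v !dotvE (dotvC l) (dotvC l) (dotvC s) (dotvC s); field.
rewrite RintegralZl//; last exact: (integrable_addv v if_).
rewrite (Rintegral_addv v if_) /f Rintegral_exp_enorm_cos ?mulr_gt0//.
by rewrite !mulrA.
Qed.

End fourier_products.

Section smoothing.
Context (R : realType) (n : nat).
Notation mu := (lebesgue R n).
Notation mu2 := (lebesgue R n \x lebesgue R n)%E.
Implicit Types (h : n.-tuple R -> R) (l x y s w : n.-tuple R).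

Lemma gaussian_density_le (b : R) x : 0 < b ->
  `|gaussian_density b x| <= (b * pi) `^ (- (n%:R / 2)).
Proof.
move=> b0; rewrite ger0_norm ?gaussian_density_ge0// /gaussian_density ler_piMr ?powR_ge0//.
by rewrite -[leRHS]expR0 ler_expR oppr_le0 divr_ge0 ?sqr_ge0// ltW.
Qed.

Lemma integrable_sheared (k g : n.-tuple R -> R) (c : R) :
  (forall x, 0 <= k x) -> (forall x, 0 <= g x) ->
  mu.-integrable setT (EFin \o k) -> mu.-integrable setT (EFin \o g) ->
  mu2.-integrable setT (EFin \o (fun z => k z.1 * g (addv z.2 (scalev c z.1)))).
Proof.
move=> k0 g0 ik ig.
have mk := integrable_measurable ik; have mg := integrable_measurable ig.
have mF : measurable_fun setT (fun z : n.-tuple R * n.-tuple R => k z.1 * g (addv z.2 (scalev c z.1))).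
  apply: measurable_funM; first exact: (measurableT_comp mk).
  apply: (measurableT_comp mg); apply: measurable_addv => //; exact: measurable_scalev.
apply: integrable_ge0_fin => //; first by move=> z; rewrite mulr_ge0.
rewrite fubini_tonelli1; last 2 first.
- exact/measurable_EFinP.
- by move=> z; rewrite lee_fin mulr_ge0.
rewrite (eq_integral (fun w => (k w)%:E * \int[mu]_y (g y)%:E)%E); last first.
  move=> w _; rewrite /fubini_F /=; under eq_integral do rewrite EFinM.
  rewrite ge0_integralZl; last 4 first.
  - by [].
  - by apply/measurable_EFinP; exact: measurable_comp_addv.
  - by move=> y _; rewrite lee_fin.
  - by rewrite lee_fin.
  congr (_ * _)%E; apply: (ge0_integral_addv _ (f := fun y => (g y)%:E)) => //.
  exact/measurable_EFinP.
rewrite ge0_integralZr; last 4 first.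
- by [].
- exact/measurable_EFinP.
- by move=> y _; rewrite lee_fin.
- by apply: integral_ge0 => y _; rewrite lee_fin.
by rewrite -!EFin_Rintegral// -EFinM ltry.
Qed.

(** The inner integral of [smoothed h (c ^+ 2)] after substituting x = y + c w. The outer weight
    becomes the density of parameter 1, so [c] only appears as a translation of [h]. *)
Definition autocor h s th (c : R) w : R := \int[mu]_y
  (h y * h (addv y (scalev c w)) * cos (pi * dotv (addv (addv y (scalev c w)) y) s + th)).

Section square_integrable.
Variable h : n.-tuple R -> R.
Hypothesis ih : mu.-integrable setT (EFin \o h).
Hypothesis ih2 : mu.-integrable setT (EFin \o (fun x => h x ^+ 2)).

Let mh : measurable_fun setT h := integrable_measurable ih.

Lemma normM_le_sqr (a b u : R) : `|u| <= 1 -> `|a * b * u| <= 2^-1 * (a ^+ 2 + b ^+ 2).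
Proof.
move=> u1; rewrite normrM (@le_trans _ _ (`|a| * `|b|))//.
  by rewrite normrM ler_piMr// mulr_ge0.
rewrite -(real_normK (num_real a)) -(real_normK (num_real b)).
have : 0 <= (`|a| - `|b|) ^+ 2 by exact: sqr_ge0.
move: `|a| `|b| => {a b} a b; nra.
Qed.

Let norm_cos_le1 (x : R) : `|cos x| <= 1.
Proof. by rewrite ler_norml cos_geN1 cos_le1. Qed.

Let mcos s th (c : R) w :
  measurable_fun setT (fun y => cos (pi * dotv (addv (addv y (scalev c w)) y) s + th)).
Proof.
apply: measurable_cos_dotv2 => //; apply: measurable_addv => //; exact: measurable_addv.
Qed.

Lemma integrable_autocor s th c w : mu.-integrable setT (EFin \o (fun y =>
  h y * h (addv y (scalev c w)) * cos (pi * dotv (addv (addv y (scalev c w)) y) s + th))).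
Proof.
apply: (integrable_le _ (integrable_scale 2^-1
  (integrable_add ih2 (integrable_sqr_addv (scalev c w) ih2)))).
  apply: measurable_funM => //; apply: measurable_funM => //; exact: measurable_comp_addv.
by move=> y; exact: normM_le_sqr.
Qed.

Lemma autocor_le s th c w : `|autocor h s th c w| <= \int[mu]_y h y ^+ 2.
Proof.
have i2 := integrable_add ih2 (integrable_sqr_addv (scalev c w) ih2).
apply: (le_trans (le_normr_Rintegral _ (integrable_autocor s th c w))) => //.
apply: (@le_trans _ _ (\int[mu]_y (2^-1 * (h y ^+ 2 + h (addv y (scalev c w)) ^+ 2)))).
  apply: le_Rintegral => //.
  - exact: (integrable_norm (integrable_autocor s th c w)).
  - exact: (integrable_scale 2^-1 i2).
  - by move=> y _; exact: normM_le_sqr.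
rewrite RintegralZl// RintegralD//; last exact: integrable_sqr_addv.
by rewrite (Rintegral_addv (scalev c w) ih2); lra.
Qed.

Lemma smoothedE s th c : 0 < c ->
  mu.-integrable setT (EFin \o (fun w => gaussian_density 1 w * autocor h s th c w)) /\
  smoothed h (c ^+ 2) s th = \int[mu]_w (gaussian_density 1 w * autocor h s th c w).
Proof.
move=> c0.
pose G (z : n.-tuple R * n.-tuple R) := gaussian_density 1 z.1 * (h z.2 * h (addv z.2 (scalev c z.1)) *
  cos (pi * dotv (addv (addv z.2 (scalev c z.1)) z.2) s + th)).
have g0 := @gaussian_density_ge0 R n 1.
have mas : measurable_fun setT (fun z : n.-tuple R * n.-tuple R => addv z.2 (scalev c z.1)).
  by apply: measurable_addv => //; exact: measurable_scalev.
(* The square integrability of [h] is used here: the product of two values of [h] is at most half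
   the sum of their squares, and each square is integrable against the Gaussian. *)
have iG : mu2.-integrable setT (EFin \o G).
  have ig := @integrable_gaussian_density R n 1 ltr01.
  have i1 := integrable_tensor ig ih2.
  have i2 := integrable_sheared c g0 (fun x => sqr_ge0 (h x)) ig ih2.
  apply: (integrable_le _ (integrable_scale 2^-1 (integrable_add i1 i2))).
    apply: measurable_funM; first exact: (measurableT_comp (@measurable_gaussian_density R n 1)).
    apply: measurable_funM; last by apply: measurable_cos_dotv2 => //; exact: measurable_addv.
    by apply: measurable_funM; apply: (measurableT_comp mh).
  move=> z; rewrite /G normrM (ger0_norm (g0 _)) -mulrDr mulrCA ler_wpM2l//.
  exact: normM_le_sqr.
have [iG1 _] := integrable_Rintegral1 iG.
have GE w : \int[mu]_y G (w, y) = gaussian_density 1 w * autocor h s th c w.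
  by rewrite /G /= RintegralZl//; exact: integrable_autocor.
split; first by apply: eq_integrable iG1 => // w _; rewrite /= GE.
have -> : \int[mu]_w (gaussian_density 1 w * autocor h s th c w) =
    \int[mu]_w \int[mu]_y G (w, y) by apply: eq_Rintegral => w _; rewrite GE.
rewrite (Rintegral_Fubini iG) /smoothed.
pose F z := h z.1 * h z.2 * gaussian_density (c ^+ 2) (subv z.1 z.2) *
  cos (pi * dotv (addv z.1 z.2) s + th).
have c20 : 0 < c ^+ 2 by rewrite exprn_gt0.
have mgs : measurable_fun setT (fun z : n.-tuple R * n.-tuple R => gaussian_density (c ^+ 2) (subv z.1 z.2)).
  by apply: (measurableT_comp (@measurable_gaussian_density R n (c ^+ 2))); exact: measurable_subv.
have iF : mu2.-integrable setT (EFin \o F).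
  apply: (integrable_mulb (M := 1)) => [| |z]; last exact: norm_cos_le1.
    by apply: measurable_cos_dotv2 => //; exact: measurable_addv.
  by apply: (integrable_mulb _ (integrable_tensor ih ih) (fun z => gaussian_density_le _ c20)).
rewrite (Rintegral_prod1 iF) (Rintegral_Fubini iF); apply: eq_Rintegral => y _.
pose f x := F (x, y).
have if_ : mu.-integrable setT (EFin \o f).
  apply: (integrable_mulb (M := 1)) => [| |z]; last exact: norm_cos_le1.
    apply: measurable_cos_dotv2 => //.
    by apply: measurable_addv; [exact: measurable_id|exact: measurable_cst].
  apply: (integrable_mulb _ _ (fun x => gaussian_density_le _ c20)).
    apply: (measurableT_comp (@measurable_gaussian_density R n (c ^+ 2))).
    by apply: measurable_subv; [exact: measurable_id|exact: measurable_cst].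
  by apply: eq_integrable (integrable_scale (h y) ih) => // x _; rewrite /= mulrC.
have cn0 : c ^+ n != 0 by rewrite expf_neq0// gt_eqF.
(* The substitution x = c w + y; its Jacobian c^n turns the density of parameter c^2 at c w into the
   one of parameter 1 at w. *)
have := Rintegral_affinev y c0 if_.
move=> /(congr1 (fun u => c ^+ n * u)); rewrite mulrA mulfV// mul1r => <-.
rewrite -RintegralZl//; last exact: integrable_affinev.
apply: eq_Rintegral => w _; rewrite /f /F /G /=.
have avC (u v : n.-tuple R) : addv u v = addv v u.
  by apply: eq_from_tnth => i; rewrite !tnth_mktuple addrC.
have avK (u v : n.-tuple R) : subv (addv u v) v = u.
  by apply: eq_from_tnth => i; rewrite !tnth_mktuple addrK.
rewrite avK (avC y (scalev c w)) -(_ : gaussian_density (c ^+ 2) (scalev c w) * c ^+ n = gaussian_density 1 w); last first.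
  by rewrite gaussian_density_scale// divff// gt_eqF.
ring.
Qed.

Lemma smoothed_le s th c : 0 < c -> `|smoothed h (c ^+ 2) s th| <= \int[mu]_y h y ^+ 2.
Proof.
move=> c0; have [iA ->] := smoothedE s th c0.
apply: (le_trans (le_normr_Rintegral _ iA)) => //.
have ig := @integrable_gaussian_density R n 1 ltr01.
rewrite [leRHS](_ : _ = \int[mu]_w ((\int[mu]_y h y ^+ 2) * gaussian_density 1 w)); last first.
  by rewrite RintegralZl// Rintegral_gaussian_density// mulr1.
apply: le_Rintegral => //; [exact: (integrable_norm iA)|exact: integrable_scale|].
move=> w _; rewrite normrM mulrC (ger0_norm (gaussian_density_ge0 _ _)) ler_wpM2r ?gaussian_density_ge0//.
exact: autocor_le.
Qed.

(** Replace the translated [h] by [h] while keeping the phase: the error is controlled by continuity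
    of translations in L^2, and the remaining [B k] converges by dominated convergence of the
    phase. *)
Lemma autocor_cvg s th (c : nat -> R) w : c k @[k --> \oo] --> 0 ->
  autocor h s th (c k) w @[k --> \oo] --> \int[mu]_y (h y ^+ 2 * cos (2 * pi * dotv y s + th)).
Proof.
move=> c0.
pose al k y := cos (pi * dotv (addv (addv y (scalev (c k) w)) y) s + th).
pose B k := \int[mu]_y (h y ^+ 2 * al k y).
have Bcvg : B k @[k --> \oo] --> \int[mu]_y (h y ^+ 2 * cos (2 * pi * dotv y s + th)).
  apply: (Rintegral_dominated_cvg _ _ _ ih2).
  - by move=> k; apply: measurable_funM; [exact: measurable_funX|exact: mcos].
  - by apply: measurable_funM; [exact: measurable_funX|exact: measurable_cos_dotv].
  - move=> y; apply: cvgMr; rewrite /al.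
    have -> : (fun k => cos (pi * dotv (addv (addv y (scalev (c k) w)) y) s + th)) =
        (fun k => cos (c k * (pi * dotv w s) + (2 * pi * dotv y s + th))).
      by apply/funext => k; rewrite !dotvE; congr cos; ring.
    have cv : c k * (pi * dotv w s) + (2 * pi * dotv y s + th) @[k --> \oo] -->
        2 * pi * dotv y s + th.
      rewrite -[X in _ --> X]add0r -[X in _ --> X + _](mul0r (pi * dotv w s)).
      by apply: cvgD; [exact: cvgMl|exact: cvg_cst].
    by apply: cvg_comp; [exact: cv|exact: continuous_cos].
  - by move=> k y; rewrite normrM ger0_norm ?sqr_ge0// ler_piMr ?sqr_ge0 ?norm_cos_le1.
pose D k y := h y - h (addv y (scalev (c k) w)).
have iD k : mu.-integrable setT (EFin \o (fun y => D k y ^+ 2)).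
  by apply: integrable_sqrB => //; [exact: measurable_comp_addv|exact: integrable_sqr_addv].
have T0 : \int[mu]_y D k y ^+ 2 @[k --> \oo] --> 0.
  apply: translation_L2 => // i; rewrite -[X in _ --> X](mul0r (tnth w i)).
  rewrite (_ : (fun k => tnth (scalev (c k) w) i) = (fun k => c k * tnth w i)).
    exact: cvgMl.
  by apply/funext => k; rewrite tnth_mktuple.
have H0 : 0 <= \int[mu]_y h y ^+ 2 by apply: Rintegral_ge0 => y _; exact: sqr_ge0.
have iB k : mu.-integrable setT (EFin \o (fun y => h y ^+ 2 * al k y)).
  apply: (integrable_mulb (M := 1) _ ih2); first exact: mcos.
  by move=> y; exact: norm_cos_le1.
have dist0 : autocor h s th (c k) w - B k @[k --> \oo] --> 0.
  apply/cvgrPdist_le => /= e e0.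
  have aux (H t d : R) : d = e / (H + 1) -> 0 <= H -> t <= e * d -> 2^-1 * (d * H) + 2^-1 * (d^-1 * t) <= e.
    move=> -> Hge hT.
    have Hp : 0 < H + 1 by lra.
    have : (e / (H + 1))^-1 * t <= e by rewrite ler_pdivrMl ?divr_gt0// mulrC.
    have : e / (H + 1) * H <= e by rewrite mulrAC ler_pdivrMr// ler_wpM2l//; lra.
    by move: (_ * t) (_ * H) => i j; lra.
  set I := \int[mu]_y h y ^+ 2 in H0.
  (* Weight of Young's inequality: d I <= e, and the translation term is made smaller than e d. The
     1 keeps the denominator positive when I = 0. *)
  pose d := e / (I + 1).
  have d0 : 0 < d by rewrite divr_gt0// ltr_wpDl.
  have ed0 : 0 < e * d by rewrite mulr_gt0.
  move/cvgrPdist_le : T0 => /(_ _ ed0); apply: filterS => k /=.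
  rewrite !sub0r !normrN => /(le_trans (ler_norm _)) hk.
  have iA := integrable_autocor s th (c k) w.
  rewrite /autocor /B -RintegralB//.
  apply: (le_trans (le_normr_Rintegral _ _)) => //; first exact: integrable_sub.
  apply: (le_trans _ (aux I _ d erefl H0 hk)).
  rewrite -!RintegralZl//; [|exact: (integrable_scale d^-1 (iD k))|exact: (integrable_scale d ih2)].
  rewrite -RintegralD//; last 2 first.
  - exact: (integrable_scale 2^-1 (integrable_scale d ih2)).
  - exact: (integrable_scale 2^-1 (integrable_scale d^-1 (iD k))).
  apply: le_Rintegral => //.
  - exact: (integrable_norm (integrable_sub iA (iB k))).
  - by apply: integrable_add; [exact: (integrable_scale 2^-1 (integrable_scale d ih2))|
      exact: (integrable_scale 2^-1 (integrable_scale d^-1 (iD k)))].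
  move=> y _; rewrite -/(al k y) -mulrBl expr2 -mulrBr -mulrDr.
  have q0 : 0 < Num.sqrt d by rewrite sqrtr_gt0.
  have qd : Num.sqrt d ^+ 2 = d by rewrite sqr_sqrtr// ltW.
  (* Young's inequality with weight [d] is the unweighted one after distributing sqrt d and its
     inverse over the two factors. *)
  rewrite (_ : h y * (h (addv y (scalev (c k) w)) - h y) =
    (Num.sqrt d * h y) * ((Num.sqrt d)^-1 * - D k y)); last first.
    by rewrite /D; field; exact: lt0r_neq0.
  apply: (le_trans (normM_le_sqr _ _ _)); first exact: norm_cos_le1.
  by rewrite !exprMn sqrrN exprVn qd expr2.
have -> : (fun k => autocor h s th (c k) w) = (fun k => (autocor h s th (c k) w - B k) + B k).
  by apply/funext => k; rewrite subrK.
by rewrite -[X in _ --> X]add0r; exact: cvgD.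
Qed.

Lemma smoothed_cvg s th (c : nat -> R) : (forall k, 0 < c k) -> c k @[k --> \oo] --> 0 ->
  smoothed h (c k ^+ 2) s th @[k --> \oo] --> \int[mu]_y (h y ^+ 2 * cos (2 * pi * dotv y s + th)).
Proof.
move=> c0 cv; have ig := @integrable_gaussian_density R n 1 ltr01.
set A := Rintegral _ _ _.
rewrite (_ : A = \int[mu]_w (A * gaussian_density 1 w)); last first.
  by rewrite RintegralZl// Rintegral_gaussian_density// mulr1.
rewrite (_ : (fun k => _) = (fun k => \int[mu]_w (gaussian_density 1 w * autocor h s th (c k) w))); last first.
  by apply/funext => k; rewrite (smoothedE s th (c0 k)).2.
apply: (Rintegral_dominated_cvg _ _ _ (integrable_scale (\int[mu]_y h y ^+ 2) ig)).
- by move=> k; exact: (integrable_measurable (smoothedE s th (c0 k)).1).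
- by apply: measurable_funM => //; exact: measurable_gaussian_density.
- by move=> w; rewrite mulrC; apply: cvgMr; exact: autocor_cvg.
- move=> k w; rewrite normrM mulrC (ger0_norm (gaussian_density_ge0 _ _)) ler_wpM2r ?gaussian_density_ge0//.
  exact: autocor_le.
Qed.

End square_integrable.

End smoothing.

Section plancherel.
Context (R : realType) (n : nat).
Notation mu := (lebesgue R n).
Implicit Types (l x y s w : n.-tuple R).
Variable h : n.-tuple R -> R.
Hypothesis ih : mu.-integrable setT (EFin \o h).
Hypothesis ih2 : mu.-integrable setT (EFin \o (fun x => h x ^+ 2)).

Lemma subv_addv s l : subv s l = scalev (-1) (addv l (scalev (-1) s)).
Proof. by apply: eq_from_tnth => i; rewrite !tnth_mktuple; ring. Qed.

Lemma cosft0_opp l : cosft h 0 (scalev (-1) l) = cosft h 0 l.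
Proof.
by apply: eq_Rintegral => x _; rewrite !addr0 dotvZr mulN1r mulrN cosN.
Qed.

Lemma cosft_pihalf_opp l : cosft h (pi / 2) (scalev (-1) l) = - cosft h (pi / 2) l.
Proof.
rewrite /cosft -[RHS]mulN1r -RintegralZl//; last exact: integrable_mul_cos.
apply: eq_Rintegral => x _; rewrite !cosDpihalf dotvZr (mulN1r (dotv _ _)) (mulrN _ (dotv _ _)) sinN; ring.
Qed.

(** The squared modulus of [fourier h l]. *)
Definition power l : R := cosft h 0 l ^+ 2 + cosft h (pi / 2) l ^+ 2.

Lemma power_opp l : power (scalev (-1) l) = power l.
Proof. by rewrite /power cosft0_opp cosft_pihalf_opp sqrrN. Qed.

Lemma power_ge0 l : 0 <= power l.
Proof. by rewrite addr_ge0// sqr_ge0. Qed.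

Lemma measurable_power : measurable_fun setT power.
Proof. by apply: measurable_funD; apply: measurable_funX; exact: measurable_cosft. Qed.

Lemma ftprod_le th l l' : `|ftprod h th l l'| <= power l + power l'.
Proof.
rewrite /ftprod /power; set a := cosft h 0 l; set b := cosft _ _ l.
set c := cosft h 0 l'; set d := cosft _ _ l'.
have k1 (x : R) : `|cos x| <= 1 by rewrite ler_norml cos_geN1 cos_le1.
have k2 (x : R) : `|sin x| <= 1 by rewrite ler_norml sin_geN1 sin_le1.
have p (u v : R) : `|u * v| <= 2^-1 * (u ^+ 2 + v ^+ 2).
  by have := @normM_le_sqr R u v 1; rewrite normr1 mulr1 => ->.
have aux (u x y z w : R) : `|u| <= 1 -> `|x| <= z -> `|y| <= w -> `|u * (x + y)| <= z + w.
  move=> u1 xz yw; rewrite normrM (le_trans (ler_piMl _ u1))//.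
  by rewrite (le_trans (ler_normD _ _))// lerD.
apply: (le_trans (ler_normD _ _)).
have h1 := aux _ _ _ _ _ (k1 th) (p a c) (_ : `|- (b * d)| <= _).
have h2 := aux _ _ _ _ _ (k2 th) (p b c) (p a d).
rewrite normrN in h1; have := lerD (h1 _ (p b d)) h2.
move/le_trans; apply; lra.
Qed.

Lemma cvg_expR_harmonic (u : R) :
  expR (- (k.+1%:R^-1 ^+ 2 / 2 * u)) @[k --> \oo] --> (1 : R).
Proof.
have cc : (k.+1%:R^-1 : R) @[k --> \oo] --> (0 : R) by exact: cvg_harmonic.
have : - (k.+1%:R^-1 ^+ 2 / 2 * u) @[k --> \oo] --> - ((0 : R) ^+ 2 / 2 * u).
  apply: cvgN; apply: cvgMl; apply: cvgMl; rewrite (_ : (fun k : nat => _) = (fun k : nat => (k.+1%:R^-1 : R) * k.+1%:R^-1)).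
    by rewrite expr2; exact: cvgM.
  by apply/funext => k; rewrite expr2.
rewrite expr0n !mul0r oppr0 => cv; rewrite -[X in _ --> X]expR0.
by apply: cvg_comp; [exact: cv|exact: continuous_expR].
Qed.

(** Since [h] is real, [power] is the case s = 0 of [ftprod]. Its regularized integrals increase as
    the Gaussian factor tends to 1 and are all bounded by the integral of h^2, so monotone
    convergence applies without prior integrability. *)
Lemma integrable_power : mu.-integrable setT (EFin \o power).
Proof.
pose o : n.-tuple R := [tuple 0 | i < n].
pose c (k : nat) : R := k.+1%:R^-1.
have c0 k : 0 < c k by rewrite invr_gt0.
(* With e = c^2 / 2 the parameter 2 e produced by [ftprod_gauss] is the square c^2 expected by
   [smoothed_le]. *)
have e0 k : 0 < c k ^+ 2 / 2 by rewrite divr_gt0// exprn_gt0.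
pose F (k : nat) l := ftprod h 0 l (subv o l) *
    expR (- (c k ^+ 2 / 2 * pi ^+ 2 * (enorm l ^+ 2 + enorm (subv o l) ^+ 2))).
have PE l : ftprod h 0 l (subv o l) = power l.
  have -> : subv o l = scalev (-1) l.
    by apply: eq_from_tnth => i; rewrite !tnth_mktuple; ring.
  rewrite /ftprod cos0 sin0 cosft0_opp cosft_pihalf_opp /power; ring.
have FE k := ftprod_gauss o 0 (e0 k) ih.
have F0 k l : 0 <= F k l by rewrite /F PE mulr_ge0 ?power_ge0// expR_ge0.
have cvF l : F k l @[k --> \oo] --> power l.
  rewrite -[X in _ --> X]mulr1 -PE /F; apply: cvgMr.
  by under eq_fun do rewrite -mulrA; exact: cvg_expR_harmonic.
apply: integrable_ge0_fin; [exact: measurable_power|exact: power_ge0|].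
have cvE l : (F k l)%:E @[k --> \oo] --> (power l)%:E by apply: cvg_EFin; [exact: nearW|exact: cvF].
have mF k : measurable_fun setT (fun l => (F k l)%:E).
  by apply/measurable_EFinP; exact: (integrable_measurable (FE k).1).
have ndF l : {homo (fun k => (F k l)%:E) : p q / (p <= q)%N >-> (p <= q)%E}.
  move=> p q pq; rewrite lee_fin /F ler_wpM2l ?PE ?power_ge0// ler_expR lerN2.
  rewrite ler_wpM2r ?addr_ge0 ?sqr_ge0// ler_wpM2r ?sqr_ge0// ler_wpM2r//.
  by rewrite ler_pXn2r ?nnegrE ?(ltW (c0 _))// lef_pV2 ?posrE// ler_nat.
have := @cvg_monotone_convergence _ _ _ mu setT measurableT (fun k l => (F k l)%:E)
  mF (fun k l _ => F0 k l) (fun l _ => ndF l).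
move=> cv.
have -> : (\int[mu]_l (power l)%:E = \int[mu]_l limn (fun k => (F k l)%:E))%E.
  by apply: eq_integral => l _; apply/esym/cvg_lim; [exact: ereal_hausdorff|exact: cvE].
apply: (@le_lt_trans _ _ (\int[mu]_y h y ^+ 2)%:E); last by rewrite ltry.
rewrite -(cvg_lim _ cv)//; apply: lime_le; first by apply/cvg_ex; eexists; exact: cv.
apply: nearW => k; rewrite -EFin_Rintegral; last exact: (FE k).1.
rewrite lee_fin (FE k).2 mulrC.
have -> : 2 * (c k ^+ 2 / 2) = c k ^+ 2 by rewrite mulrC divfK.
rewrite (_ : enorm o ^+ 2 = 0); last first.
  by rewrite enorm2E /dotv big1// => i _; rewrite tnth_mktuple mul0r.
rewrite mulr0 oppr0 expR0 mulr1 (le_trans (ler_norm _))//.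
exact: smoothed_le.
Qed.

Lemma integrable_power_subv s : mu.-integrable setT (EFin \o (fun l => power (subv s l))).
Proof.
have := integrable_addv (scalev (-1) s) integrable_power.
by apply: eq_integrable => // l _; rewrite /= subv_addv power_opp.
Qed.

Lemma integrable_ftprod th s : mu.-integrable setT (EFin \o (fun l => ftprod h th l (subv s l))).
Proof.
apply: (integrable_le _ (integrable_add integrable_power (integrable_power_subv s))).
  exact: measurable_ftprod.
by move=> l; exact: ftprod_le.
Qed.

(** Two limits of the same regularized integral: dominated convergence in frequency, with
    [integrable_ftprod] as majorant, and [smoothed_cvg] in space. *)
Lemma plancherel th s : \int[mu]_l ftprod h th l (subv s l) =
  \int[mu]_y (h y ^+ 2 * cos (2 * pi * dotv y s + th)).
Proof.
pose c (k : nat) : R := k.+1%:R^-1.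
have c0 k : 0 < c k by rewrite invr_gt0.
have e0 k : 0 < c k ^+ 2 / 2 by rewrite divr_gt0// exprn_gt0.
have cc : c k @[k --> \oo] --> 0 by exact: cvg_harmonic.
pose F (k : nat) l := ftprod h th l (subv s l) *
    expR (- (c k ^+ 2 / 2 * pi ^+ 2 * (enorm l ^+ 2 + enorm (subv s l) ^+ 2))).
have FE k := ftprod_gauss s th (e0 k) ih.
have l1 : \int[mu]_l F k l @[k --> \oo] --> \int[mu]_l ftprod h th l (subv s l).
  apply: (Rintegral_dominated_cvg _ _ _ (integrable_norm (integrable_ftprod th s))).
  - by move=> k; exact: (integrable_measurable (FE k).1).
  - exact: measurable_ftprod.
  - move=> l; rewrite -[X in _ --> X]mulr1 /F; apply: cvgMr.
    by under eq_fun do rewrite -mulrA; exact: cvg_expR_harmonic.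
  - move=> k l; rewrite /F normrM ler_piMr// ger0_norm ?expR_ge0// -[leRHS]expR0 ler_expR oppr_le0.
    by rewrite mulr_ge0 ?addr_ge0 ?sqr_ge0// mulr_ge0 ?sqr_ge0//; exact: ltW.
have l2 : \int[mu]_l F k l @[k --> \oo] --> \int[mu]_y (h y ^+ 2 * cos (2 * pi * dotv y s + th)).
  rewrite (_ : (fun k => _) = (fun k => expR (- (c k ^+ 2 / 2 * (pi ^+ 2 / 2 * enorm s ^+ 2))) *
      smoothed h (c k ^+ 2) s th)); last first.
    apply/funext => k; rewrite (FE k).2 (_ : 2 * (c k ^+ 2 / 2) = c k ^+ 2); last by rewrite mulrC divfK.
    by rewrite !mulrA.
  rewrite -[X in _ --> X]mul1r; apply: cvgM; first exact: cvg_expR_harmonic.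
  exact: smoothed_cvg.
exact: (cvg_unique _ l1 l2).
Qed.

End plancherel.

Section theta_sum.
Context d (T : measurableType d) (R : realType).
Variable mu : {sigma_finite_measure set T -> \bar R}.

(** The summable weights justify exchanging sum and integral; [theta_identity] is then applied at
    each [t]. *)
Lemma rsum_theta n (a th : R) (f : T -> R) (Y : T -> n.-tuple R) : 0 < a ->
  mu.-integrable setT (EFin \o f) -> measurable_fun setT Y ->
  rsummable (fun m : n.-tuple int => theta_weight a m *
    \int[mu]_t (f t * cos (2 * pi * dotv (intv R m) (Y t) + th))) /\
  rsum (fun m : n.-tuple int => theta_weight a m *
    \int[mu]_t (f t * cos (2 * pi * dotv (intv R m) (Y t) + th))) =
  cos th * \int[mu]_t (f t * theta a (Y t)).
Proof.
move=> a0 if_ mY.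
pose c (m : n.-tuple int) t := cos (2 * pi * dotv (intv R m) (Y t) + th).
pose F (m : n.-tuple int) t := theta_weight a m * (f t * c m t).
have c1 m t : `|c m t| <= 1 by rewrite ler_norml cos_geN1 cos_le1.
have ic m : mu.-integrable setT (EFin \o (fun t => f t * c m t)).
  by apply: (integrable_mulb (M := 1) _ if_ (c1 m)); exact: measurable_cos_dotv2.
have iF m : mu.-integrable setT (EFin \o F m) by exact: (integrable_scale _ (ic m)).
have sF : rsummable (fun m => \int[mu]_t `|F m t|).
  apply: (rsummable_le (rsummableZ (\int[mu]_t `|f t|) (rsummable_theta_weight n a0))) => m.
  rewrite ger0_norm; last by apply: Rintegral_ge0.
  rewrite mulrC -RintegralZl//; last exact: integrable_norm.
  apply: le_Rintegral => //.
  - exact: (integrable_norm (iF m)).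
  - exact: (integrable_scale _ (integrable_norm if_)).
  - move=> t _; rewrite /F !normrM (ger0_norm (theta_weight_ge0 _ _)).
    by rewrite ler_wpM2l ?theta_weight_ge0// ler_piMr.
have [_ _ sI eI] := rsum_Rintegral iF sF.
have FE m : \int[mu]_t F m t = theta_weight a m * \int[mu]_t (f t * c m t).
  by rewrite /F RintegralZl.
rewrite (_ : (fun m => _) = (fun m => \int[mu]_t F m t)); last by apply/funext => m; rewrite FE.
split => //; rewrite -eI.
have ith : mu.-integrable setT (EFin \o (fun t => f t * theta a (Y t))).
  apply: (integrable_mulb (M := rsum (fun m : n.-tuple int => theta_weight a m)) _ if_).
    exact: measurable_theta.
  by move=> t; have /andP[t0 t1] := theta_le (Y t) a0; rewrite ger0_norm.
rewrite -RintegralZl//; apply: eq_Rintegral => t _.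
rewrite mulrCA -theta_identity// -rsumZ; last first.
  apply: (rsummable_le (rsummable_theta_weight n a0)) => m.
  by rewrite normrM (ger0_norm (theta_weight_ge0 _ _)) ler_piMr ?theta_weight_ge0 ?ler_norml ?cos_geN1 ?cos_le1.
by congr rsum; apply/funext => m; rewrite /F mulrCA.
Qed.

End theta_sum.

(** * The terms of the series *)

Section variance_terms.
Context (R : realType) (n : nat).
Notation mu := (lebesgue R n).
Notation mu2 := (sfprod (lebesgue R n) (lebesgue R n)).
Implicit Types (l x y s w : n.-tuple R) (m : n.-tuple int).
Variables (a r : R) (h : n.-tuple R -> R).
Hypotheses (a0 : 0 < a) (r0 : 0 < r).
Hypothesis ih : mu.-integrable setT (EFin \o h).
Hypothesis ih2 : mu.-integrable setT (EFin \o (fun x => h x ^+ 2)).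

Lemma fourierE l : fourier h l = (cosft h 0 l +i* cosft h (pi / 2) l)%C.
Proof.
rewrite /fourier /cintegral; congr (_ +i* _)%C; apply: eq_Rintegral => x _ /=.
  by rewrite mul0r subr0 cosN addr0.
by rewrite mul0r addr0 sinN cosDpihalf.
Qed.

Definition variance_term th m l : R :=
  let s := scalev r (intv R m) in
  ftprod h th l (subv s l) *
  (theta_weight a m - expR (- (a * pi ^+ 2 * enorm l ^+ 2 / r ^+ 2))
     * expR (- (a * pi ^+ 2 * enorm (subv s l) ^+ 2 / r ^+ 2))).

Lemma Re_variance_integrand m l :
  complex.Re (variance_integrand a r h m l) = variance_term 0 m l.
Proof.
rewrite /variance_integrand /variance_term !fourierE /ftprod /= cos0 sin0 !mulr0 subr0 mul0r addr0 mul1r.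
by [].
Qed.

Lemma Im_variance_integrand m l :
  complex.Im (variance_integrand a r h m l) = variance_term (pi / 2) m l.
Proof.
rewrite /variance_integrand /variance_term !fourierE /ftprod /= cos_pihalf sin_pihalf !mulr0 mul0r !add0r mul1r.
by rewrite addrC.
Qed.

(** The two exponentials combine into the regularizing factor with e = a / r^2. The first half is
    [plancherel], the second [ftprod_gauss], where |s|^2 = r^2 |m|^2 cancels r^2 and leaves the
    weight of parameter a / 2. *)
Lemma variance_term_integral th m :
  mu.-integrable setT (EFin \o variance_term th m) /\
  \int[mu]_l variance_term th m l =
  theta_weight a m * \int[mu]_y (h y ^+ 2 * cos (2 * pi * dotv y (scalev r (intv R m)) + th)) -
  theta_weight (a / 2) m * smoothed h (2 * (a / r ^+ 2)) (scalev r (intv R m)) th.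
Proof.
set s := scalev r (intv R m).
have e0 : 0 < a / r ^+ 2 by rewrite divr_gt0// exprn_gt0.
have [iF FE] := ftprod_gauss s th e0 ih.
have iP := integrable_scale (theta_weight a m) (integrable_ftprod ih ih2 th s).
have VE l : variance_term th m l = theta_weight a m * ftprod h th l (subv s l) -
    ftprod h th l (subv s l) * expR (- (a / r ^+ 2 * pi ^+ 2 * (enorm l ^+ 2 + enorm (subv s l) ^+ 2))).
  rewrite /variance_term -/s mulrBr (mulrC _ (theta_weight _ _)) -expRD; congr (_ - _ * expR _).
  by move: (pi : R) => p; field; exact: lt0r_neq0.
rewrite (_ : variance_term th m = fun l => theta_weight a m * ftprod h th l (subv s l) -
    ftprod h th l (subv s l) * expR (- (a / r ^+ 2 * pi ^+ 2 * (enorm l ^+ 2 + enorm (subv s l) ^+ 2)))); last exact/funext.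
split; first exact: (integrable_sub iP iF).
rewrite RintegralB// RintegralZl//; last exact: integrable_ftprod.
rewrite plancherel// FE; congr (_ - expR (- _) * _).
rewrite !enorm2E /s !dotvE.
by move: (pi : R) => p; field; exact: lt0r_neq0.
Qed.

Definition variance_sum : R :=
  \int[mu]_y (h y ^+ 2 * theta a (scalev r y)) -
  \int[mu2]_z (h z.1 * h z.2 * gaussian_density (2 * (a / r ^+ 2)) (subv z.1 z.2) *
    theta (a / 2) (scalev (r / 2) (addv z.1 z.2))).

Lemma integrable_smoothed : mu2.-integrable setT (EFin \o (fun z : n.-tuple R * n.-tuple R =>
  h z.1 * h z.2 * gaussian_density (2 * (a / r ^+ 2)) (subv z.1 z.2))).
Proof.
have b0 : 0 < 2 * (a / r ^+ 2) by rewrite mulr_gt0// divr_gt0// exprn_gt0.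
apply: (integrable_mulb _ (integrable_tensor ih ih) (fun z => gaussian_density_le _ b0)).
apply: (measurableT_comp (@measurable_gaussian_density R n _)); exact: measurable_subv.
Qed.

Lemma rsum_variance_term th :
  rsummable (fun m => \int[mu]_l variance_term th m l) /\
  rsum (fun m => \int[mu]_l variance_term th m l) = cos th * variance_sum.
Proof.
have mY : measurable_fun setT (fun y : n.-tuple R => scalev r y) by exact: measurable_scalev.
have mZ : measurable_fun setT (fun z : n.-tuple R * n.-tuple R => scalev (r / 2) (addv z.1 z.2)).
  by apply: measurable_scalev; exact: measurable_addv.
have a20 : 0 < a / 2 by rewrite divr_gt0.
have [s1 e1] := rsum_theta th a0 ih2 mY.
have [s2 e2] := rsum_theta th a20 integrable_smoothed mZ.
pose A m := theta_weight a m *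
  \int[mu]_t (h t ^+ 2 * cos (2 * pi * dotv (intv R m) (scalev r t) + th)).
pose B m := theta_weight (a / 2) m * \int[mu2]_t (h t.1 * h t.2 *
  gaussian_density (2 * (a / r ^+ 2)) (subv t.1 t.2) *
  cos (2 * pi * dotv (intv R m) (scalev (r / 2) (addv t.1 t.2)) + th)).
rewrite (_ : (fun m => _) = (fun m => A m - B m)); last first.
  apply/funext => m; rewrite (variance_term_integral th m).2 /A /B; congr (_ * _ - _ * _).
    by apply: eq_Rintegral => y _; rewrite !dotvE (dotvC y).
  apply: eq_Rintegral => z _; rewrite !dotvZr (dotvC (addv _ _)); congr (_ * cos (_ + _)).
  by move: (pi : R) => p; field.
split; first exact: (rsummableB s1 s2).
by rewrite (rsumB s1 s2) e1 e2 -mulrBr.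
Qed.

End variance_terms.

(** * Moments of the linear statistic *)

Section density.
Context d d' (T : measurableType d) (T' : measurableType d') (R : realType).
Variables (P : probability T R) (mu : {sigma_finite_measure set T' -> \bar R}).
Variables (X : {RV P >-> T'}) (phi : T' -> R).
Hypotheses (phi0 : forall x, 0 <= phi x).
Hypothesis iphi : mu.-integrable setT (EFin \o phi).
Hypothesis Xphi : has_density mu X phi.

Let mphi : measurable_fun setT phi := integrable_measurable iphi.

(** The hypothesis makes the law of [X] absolutely continuous with respect to [mu], and its
    Radon-Nikodym derivative equals [phi] almost everywhere because both have the same integrals. *)
Lemma ge0_integral_density (f : T' -> R) : measurable_fun setT f -> (forall x, 0 <= f x) ->
  (\int[P]_t (f (X t))%:E = \int[mu]_x (f x * phi x)%:E)%E.
Proof.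
move=> mf f0; pose nu := distribution P X.
have f0' x : (0 <= (f x)%:E)%E by rewrite lee_fin.
have mfE : measurable_fun setT (EFin \o f) by exact/measurable_EFinP.
have numu : nu `<< mu.
  apply/null_content_dominatesP => A mA muA; rewrite /nu Xphi//.
  by apply: null_set_integral => //; exact/measurable_funTS/measurable_EFinP.
rewrite -(@ge0_integral_distribution _ _ _ _ _ P X (EFin \o f))//.
rewrite -(Radon_Nikodym_SigmaFinite.change_of_variables numu f0' measurableT mfE).
pose g := Radon_Nikodym_SigmaFinite.f (distribution P X) mu.
have mg : measurable_fun setT g by exact: (measurable_int mu (Radon_Nikodym_SigmaFinite.f_integrable numu)).
apply: ge0_ae_eq_integral => //.
- exact: emeasurable_funM.
- by apply/measurable_EFinP; exact: measurable_funM.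
- by move=> x _; rewrite mule_ge0//; exact: Radon_Nikodym_SigmaFinite.f_ge0.
- by move=> x _; rewrite lee_fin mulr_ge0.
have : ae_eq mu setT g (EFin \o phi).
  apply: integral_ae_eq => //; first exact: Radon_Nikodym_SigmaFinite.f_integrable.
    exact/measurable_EFinP.
  by move=> E _ mE; rewrite -Radon_Nikodym_SigmaFinite.f_integral//; exact: Xphi.
by apply: filterS => x /(_ I) gx _; rewrite EFinM -/g gx.
Qed.

Lemma integrable_density (f : T' -> R) : measurable_fun setT f ->
  mu.-integrable setT (EFin \o (fun x => f x * phi x)) ->
  P.-integrable setT (EFin \o (fun t => f (X t))) /\
  \int[P]_t f (X t) = \int[mu]_x (f x * phi x).
Proof.
move=> mf ifp.
have mX : measurable_fun setT X by exact: measurable_funP.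
have ge0 (g : T' -> R) : measurable_fun setT g -> (forall x, 0 <= g x) -> (forall x, g x <= `|f x|) ->
    [/\ mu.-integrable setT (EFin \o (fun x => g x * phi x)),
      P.-integrable setT (EFin \o (fun t => g (X t))) &
      \int[P]_t g (X t) = \int[mu]_x (g x * phi x)].
  move=> mg g0 gf.
  have ig : mu.-integrable setT (EFin \o (fun x => g x * phi x)).
    apply: (integrable_le _ (integrable_norm ifp)); first exact: measurable_funM.
    move=> x; rewrite normrM [leRHS]normrM ler_wpM2r// (ger0_norm (g0 x)).
    exact: gf.
  have E := ge0_integral_density mg g0.
  split => //; last by rewrite /Rintegral E.
  apply: integrable_ge0_fin => //; first exact: (measurableT_comp mg).
  by rewrite E -EFin_Rintegral// ltry.
pose f1 x := Num.max (f x) 0; pose f2 x := Num.max (- f x) 0.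
have [i1 j1 e1] : [/\ mu.-integrable setT (EFin \o (fun x => f1 x * phi x)),
      P.-integrable setT (EFin \o (fun t => f1 (X t))) &
      \int[P]_t f1 (X t) = \int[mu]_x (f1 x * phi x)].
  apply: ge0; first exact: measurable_maxr.
    by move=> x; rewrite le_max lexx orbT.
  by move=> x; rewrite ge_max ler_norm normr_ge0.
have [i2 j2 e2] : [/\ mu.-integrable setT (EFin \o (fun x => f2 x * phi x)),
      P.-integrable setT (EFin \o (fun t => f2 (X t))) &
      \int[P]_t f2 (X t) = \int[mu]_x (f2 x * phi x)].
  apply: ge0; first by apply: measurable_maxr => //; exact: measurable_funN.
    by move=> x; rewrite le_max lexx orbT.
  by move=> x; rewrite ge_max -normrN ler_norm normr_ge0.
have fE x : f x = f1 x - f2 x.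
  rewrite /f1 /f2; move: (f x) => {f mf ifp ge0 f1 f2 i1 i2 j1 j2 e1 e2} u.
  by have [h1|h1] := leP u 0; have [h2|h2] := leP (- u) 0; lra.
split.
  by apply: eq_integrable (integrable_sub j1 j2) => // t _; rewrite /= -fE.
under eq_Rintegral do rewrite fE.
rewrite RintegralB// e1 e2 -RintegralB//.
by apply: eq_Rintegral => x _; rewrite -mulrBl -fE.
Qed.

End density.

Section independence.
Context d d' (T : measurableType d) (T' : measurableType d') (R : realType).
Variables (P : probability T R) (I : choiceType) (X : I -> {RV P >-> T'}).
Hypothesis iX : mutually_independent X.

Lemma mutually_independent_pair i j (A B : set T') : i != j ->
  measurable A -> measurable B ->
  P ((X i @^-1` A) `&` (X j @^-1` B)) = (P (X i @^-1` A) * P (X j @^-1` B))%E.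
Proof.
move=> ij mA mB.
have := iX [fset i; j]%fset (A := fun k => if k == i then A else B).
move=> /(_ (fun k => _)) H.
have {H} := H (fun k => ltac:(by case: ifP)).
rewrite big_fsetU1/= ?inE// big_seq_fset1 eqxx eq_sym (negbTE ij) => <-.
congr (P _); apply/seteqP; split => t /=.
  move=> [At Bt] k /=; rewrite !inE => /orP[/eqP->|/eqP->]; first by rewrite eqxx.
  by rewrite eq_sym (negbTE ij).
move=> H; split; first by have := H i; rewrite /= eqxx; apply; rewrite !inE eqxx.
by have := H j; rewrite /= eq_sym (negbTE ij); apply; rewrite !inE eqxx orbT.
Qed.

(** Independence gives the joint law on rectangles, hence everywhere by uniqueness of the product
    measure; the expectation of the product is then a product integral. *)
Lemma indep_mul i j (f g : T' -> R) : i != j ->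
  measurable_fun setT f -> measurable_fun setT g ->
  P.-integrable setT (EFin \o (fun t => f (X i t))) ->
  P.-integrable setT (EFin \o (fun t => g (X j t))) ->
  P.-integrable setT (EFin \o (fun t => f (X i t) * g (X j t))) ->
  \int[P]_t (f (X i t) * g (X j t)) = \int[P]_t f (X i t) * \int[P]_t g (X j t).
Proof.
move=> ij mf mg if_ ig ifg.
have mXX : measurable_fun setT (fun t => (X i t, X j t)).
  by apply: measurable_fun_pair; exact: measurable_funP.
pose XX : {mfun T >-> (T' * T')%type} := mfun_Sub (mem_set mXX).
have XXE t : XX t = (X i t, X j t) by [].
pose nu1 := distribution P (X i); pose nu2 := distribution P (X j).
have law A : measurable A -> (nu1 \x nu2)%E A = distribution P XX A.
  apply: product_measure_unique => {}A B mA mB.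
  rewrite /distribution /pushforward -mutually_independent_pair//.
pose F (z : T' * T') := f z.1 * g z.2.
have mF : measurable_fun setT F.
  by apply: measurable_funM; apply: measurableT_comp.
have pf (Y : {RV P >-> T'}) (k : T' -> R) : measurable_fun setT k ->
    P.-integrable setT (EFin \o (fun t => k (Y t))) ->
    (distribution P Y).-integrable setT (EFin \o k) /\
    \int[distribution P Y]_y k y = \int[P]_t k (Y t).
  move=> mk ik; split; last first.
    by rewrite /Rintegral (@integral_distribution _ _ _ _ _ P Y (EFin \o k))//; exact/measurable_EFinP.
  by apply: (@integrable_pushforward _ _ _ _ _ Y) => //; exact/measurable_EFinP.
have [i1 e1] := pf _ _ mf if_; have [i2 e2] := pf _ _ mg ig.
rewrite -e1 -e2 -(Rintegral_tensor i1 i2).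
transitivity (\int[distribution P XX]_z F z).
  rewrite /Rintegral (@integral_pushforward _ _ _ _ _ XX _ P setT (EFin \o F))//; exact/measurable_EFinP.
rewrite /Rintegral; congr fine; apply: eq_measure_integral => A mA _.
exact/esym/law.
Qed.

End independence.

Section variance_of_sum.
Context d (T : measurableType d) (R : realType) (P : probability T R) (I : countType).

Lemma rsummable_diag (v : I -> R) : (forall i, 0 <= v i) -> rsummable v ->
  rsummable (fun z : I * I => if z.1 == z.2 then v z.1 else 0).
Proof.
move=> v0 sv.
have D i : rsummable (fun j => if i == j then v i else 0) /\
    rsum (fun j => if i == j then v i else 0) = v i.
  have := @rsum1 R I i (fun j => if i == j then v i else 0).
  by rewrite eqxx; apply => j; rewrite eq_sym => /negbTE ->.
apply: (@rsummable_pair_ge0 R I I (fun z : I * I => if z.1 == z.2 then v z.1 else 0)) => /=.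
- by move=> z; case: ifP.
- by move=> i; exact: (D i).1.
- by rewrite (_ : (fun i => _) = v)//; apply/funext => i; rewrite (D i).2.
Qed.

Lemma rsum_diag (v : I -> R) : rsummable (fun z : I * I => if z.1 == z.2 then v z.1 else 0) ->
  rsummable v /\ rsum (fun z : I * I => if z.1 == z.2 then v z.1 else 0) = rsum v.
Proof.
move=> s; have [_ s1 e1] := rsum_pair s.
have D i : rsum (fun j => if i == j then v i else 0) = v i.
  have := @rsum1 R I i (fun j => if i == j then v i else 0).
  by rewrite eqxx => -[|//] j; rewrite eq_sym => /negbTE ->.
have E : (fun i => rsum (fun j => if i == j then v i else 0)) = v by exact/funext.
by rewrite e1 /=; rewrite /= E in s1 *.
Qed.

Lemma rsum_mul (u v : I -> R) : rsummable u -> rsummable v ->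
  rsum (fun z : I * I => u z.1 * v z.2) = rsum u * rsum v.
Proof.
move=> su sv; have [_ _ ->] := rsum_pair (rsummable_tensor su sv).
rewrite [RHS]mulrC -rsumZ//; congr rsum; apply/funext => i /=.
by rewrite rsumZ// mulrC.
Qed.

(** N^2 is expanded as an unordered sum over pairs of indices and integrated termwise. Off the
    diagonal the covariances vanish, so only the variances of the terms remain. *)
Lemma variance_rsum (X : I -> T -> R) :
  (forall i, P.-integrable setT (EFin \o X i)) ->
  (forall i, P.-integrable setT (EFin \o (fun t => X i t ^+ 2))) ->
  (forall i j, i != j -> \int[P]_t (X i t * X j t) = \int[P]_t X i t * \int[P]_t X j t) ->
  (forall i j, i != j ->
    \int[P]_t (`|X i t| * `|X j t|) = \int[P]_t `|X i t| * \int[P]_t `|X j t|) ->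
  rsummable (fun i => \int[P]_t `|X i t|) ->
  rsummable (fun i => \int[P]_t X i t ^+ 2) ->
  let N t := rsum (X^~ t) in
  [/\ {ae P, forall t, rsummable (X^~ t)},
      P.-integrable setT (EFin \o N),
      P.-integrable setT (EFin \o (fun t => N t ^+ 2)) &
      \int[P]_t N t ^+ 2 - (\int[P]_t N t) ^+ 2 =
        rsum (fun i => \int[P]_t X i t ^+ 2 - (\int[P]_t X i t) ^+ 2)].
Proof.
move=> iX iX2 indep indepN s1 s2 N.
have [sX iN sE EN] := rsum_Rintegral iX s1.
have mX i := integrable_measurable (iX i).
pose F (z : I * I) t := X z.1 t * X z.2 t.
have iF z : P.-integrable setT (EFin \o F z).
  apply: (integrable_le _ (integrable_scale 2^-1 (integrable_add (iX2 z.1) (iX2 z.2)))).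
    exact: measurable_funM.
  by move=> t; have := @normM_le_sqr R (X z.1 t) (X z.2 t) 1; rewrite normr1 mulr1 => ->.
have sF : rsummable (fun z : I * I => \int[P]_t `|F z t|).
  (* Off the diagonal the absolute moments factor and are dominated by the tensor square of the
     first moments; on the diagonal the second moments are needed. *)
  apply: (rsummable_le (rsummableD (rsummable_tensor s1 s1) (rsummable_diag _ s2))) => [i|[i j] /=].
    by apply: Rintegral_ge0 => t _; exact: sqr_ge0.
  rewrite ger0_norm; last by apply: Rintegral_ge0.
  have [<-|ij] := eqVneq i j; rewrite /F /=.
    rewrite (_ : \int[P]_t `|X i t * X i t| = \int[P]_t X i t ^+ 2).
      by rewrite lerDr mulr_ge0//; apply: Rintegral_ge0.
    by apply: eq_Rintegral => t _; rewrite -expr2 ger0_norm// sqr_ge0.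
  by under eq_Rintegral do rewrite normrM; rewrite indepN// addr0.
have [_ iFs sEF EF] := rsum_Rintegral iF sF.
(* The product formula for sums requires summability of the family, which is known only almost
   surely. *)
have NE : {ae P, forall t, rsum (F^~ t) = N t ^+ 2}.
  by apply: filterS sX => t st; rewrite expr2 -(rsum_mul st st).
have mN2 : measurable_fun setT (fun t => N t ^+ 2).
  by apply: measurable_funX; exact: (integrable_measurable iN).
have aeE : ae_eq P setT (EFin \o (fun t => rsum (F^~ t))) (EFin \o (fun t => N t ^+ 2)).
  by apply: filterS NE => t ft _ /=; rewrite ft.
have II : (\int[P]_t (rsum (F^~ t))%:E = \int[P]_t (N t ^+ 2)%:E)%E.
  apply: ae_eq_integral => //; first exact: (measurable_int P iFs).
  exact/measurable_EFinP.
have iN2 : P.-integrable setT (EFin \o (fun t => N t ^+ 2)).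
  apply: integrable_ge0_fin => // [t|]; first exact: sqr_ge0.
  by rewrite -II -EFin_Rintegral// ltry.
split => //.
have -> : \int[P]_t N t ^+ 2 = rsum (fun z : I * I => \int[P]_t F z t).
  by rewrite -EF /Rintegral II.
rewrite EN expr2 -(rsum_mul sE sE) -(rsumB sEF (rsummable_tensor sE sE)).
pose v i := \int[P]_t X i t ^+ 2 - (\int[P]_t X i t) ^+ 2.
have dE : (fun z : I * I => \int[P]_t F z t - \int[P]_t X z.1 t * \int[P]_t X z.2 t) =
    (fun z : I * I => if z.1 == z.2 then v z.1 else 0).
  apply/funext => -[i j] /=; rewrite /F /=; have [<-|ij] := eqVneq i j.
    by rewrite /v [in RHS]expr2; congr (_ - _); apply: eq_Rintegral => t _; rewrite expr2.
  by rewrite indep// subrr.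
have sd : rsummable (fun z : I * I => if z.1 == z.2 then v z.1 else 0).
  by rewrite -dE; exact: (rsummableB sEF (rsummable_tensor sE sE)).
by rewrite dE; have [] := rsum_diag sd.
Qed.

End variance_of_sum.

Section gaussian_sum.
Context d (T : measurableType d) (R : realType).
Variable mu : {sigma_finite_measure set T -> \bar R}.

(** Tonelli: the absolute values sum to |f| theta, which is integrable because theta is bounded. *)
Lemma rsum_gaussian n (a : R) (f : T -> R) (Y : T -> n.-tuple R) : 0 < a ->
  mu.-integrable setT (EFin \o f) -> measurable_fun setT Y ->
  [/\ forall k, mu.-integrable setT (EFin \o (fun t => f t * gaussian_density a (subv (Y t) (intv R k)))),
      rsummable (fun k : n.-tuple int => \int[mu]_t (f t * gaussian_density a (subv (Y t) (intv R k)))) &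
      rsum (fun k : n.-tuple int => \int[mu]_t (f t * gaussian_density a (subv (Y t) (intv R k)))) =
        \int[mu]_t (f t * theta a (Y t))].
Proof.
move=> a0 if_ mY.
pose F (k : n.-tuple int) t := f t * gaussian_density a (subv (Y t) (intv R k)).
have mg k : measurable_fun setT (fun t => gaussian_density a (subv (Y t) (intv R k))).
  apply: (measurableT_comp (@measurable_gaussian_density R n a)).
  by apply: measurable_subv.
have iF k : mu.-integrable setT (EFin \o F k).
  by apply: (integrable_mulb _ if_ (fun t => gaussian_density_le _ a0)).
have iN k := integrable_norm (iF k).
have sF : rsummable (fun k => \int[mu]_t `|F k t|).
  apply: ge0_rsummable => [k|]; first by apply: Rintegral_ge0.
  rewrite (_ : (\esum_(k in [set: n.-tuple int]) (\int[mu]_t `|F k t|)%:E)%E =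
      (\esum_(k in [set: n.-tuple int]) \int[mu]_t `|F k t|%:E)%E); last first.
    by congr esum; apply/funext => k; rewrite EFin_Rintegral.
  rewrite ge0_integral_rsum//; last first.
    by move=> k; exact: (integrable_measurable (iN k)).
  have ith : mu.-integrable setT (EFin \o (fun t => `|f t| * theta a (Y t))).
    apply: (integrable_mulb (M := rsum (fun m : n.-tuple int => theta_weight a m)) _ (integrable_norm if_)).
      exact: measurable_theta.
    by move=> t; have /andP[t0 t1] := theta_le (Y t) a0; rewrite ger0_norm.
  rewrite (eq_integral (EFin \o (fun t => `|f t| * theta a (Y t)))); last first.
    move=> t _; have sg := rsummable_gaussian_density (Y t) a0.
    have FE : (fun k => `|F k t|) = (fun k => `|f t| * gaussian_density a (subv (Y t) (intv R k))).
      by apply/funext => k; rewrite /F normrM (ger0_norm (gaussian_density_ge0 _ _)).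
    rewrite esum_rsum//; last by rewrite FE; exact: (rsummableZ _ sg).
    by rewrite FE rsumZ.
  by rewrite -EFin_Rintegral// ltry.
have [_ _ sE E] := rsum_Rintegral iF sF; split => //.
rewrite -E; apply: eq_Rintegral => t _; rewrite /F rsumZ//.
exact: rsummable_gaussian_density.
Qed.

End gaussian_sum.

Lemma variance_Rintegral d (T : measurableType d) (R : realType) (P : probability T R) (N : T -> R) :
  P.-integrable setT (EFin \o N) -> P.-integrable setT (EFin \o (fun t => N t ^+ 2)) ->
  'V_P[N]%E = (\int[P]_t N t ^+ 2 - (\int[P]_t N t) ^+ 2)%:E.
Proof.
move=> iN iN2; rewrite /variance unlock expectation.unlock -/(Rintegral P setT N).
set m := Rintegral P setT N.
have im : P.-integrable setT (EFin \o (fun=> m ^+ 2 : R)) by exact: finite_measure_integrable_cst.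
have i2m := integrable_scale (2 * m) iN.
have iS := integrable_sub iN2 (integrable_sub i2m im).
rewrite -(_ : (\int[P]_t (N t ^+ 2 - (2 * m * N t - m ^+ 2))) = \int[P]_t N t ^+ 2 - m ^+ 2).
  rewrite EFin_Rintegral//; apply: eq_integral => t _; congr EFin.
  rewrite [LHS](_ : _ = (N t - m) * (N t - m))//; ring.
rewrite RintegralB//; last exact: integrable_sub.
rewrite RintegralB// RintegralZl// Rintegral_cst//.
rewrite -/m [fine _](_ : _ = 1); last exact: (congr1 fine (probability_setT P)).
by ring.
Qed.

Section moments.
Context d (T : measurableType d) (R : realType) (P : probability T R) (n : nat).
Notation mu := (lebesgue R n).
Variables (a r : R) (k : n.-tuple int) (X : {RV P >-> n.-tuple R}).
Hypotheses (a0 : 0 < a) (r0 : 0 < r).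
Hypothesis gX : has_density mu X (gaussian_density a).

(** Substituting v = r y - k sends [scaled_point r k v] to [y], with Jacobian r^n. *)
Lemma integrable_scaled_point (g : n.-tuple R -> R) : mu.-integrable setT (EFin \o g) ->
  P.-integrable setT (EFin \o (fun t => g (scaled_point r k (X t)))) /\
  \int[P]_t g (scaled_point r k (X t)) =
  r ^+ n * \int[mu]_y (g y * gaussian_density a (subv (scalev r y) (intv R k))).
Proof.
move=> ig.
pose f v := g (scaled_point r k v).
have spE v : scaled_point r k v = addv (scalev r^-1 v) (scalev r^-1 (intv R k)).
  by apply: eq_from_tnth => i; rewrite !tnth_mktuple; ring.
have ri0 : 0 < r^-1 by rewrite invr_gt0.
have if_ : mu.-integrable setT (EFin \o f).
  by rewrite /f; under eq_fun do rewrite spE; exact: (integrable_affinev _ ri0 ig).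
have ifp : mu.-integrable setT (EFin \o (fun v => f v * gaussian_density a v)).
  apply: (integrable_mulb _ if_ (fun v => gaussian_density_le v a0)).
  exact: measurable_gaussian_density.
have [i e] := integrable_density (@gaussian_density_ge0 R n a) (integrable_gaussian_density n a0)
  gX (integrable_measurable if_) ifp.
split => //; rewrite -/f in e *; rewrite e.
have rn0 : r ^+ n != 0 by rewrite expf_neq0// gt_eqF.
have E1 y : scaled_point r k (addv (scalev r y) (scalev (-1) (intv R k))) = y.
  apply: eq_from_tnth => j; rewrite !tnth_mktuple mulN1r addrC subrK mulrA.
  by rewrite mulVf ?gt_eqF// mul1r.
have E2 y : addv (scalev r y) (scalev (-1) (intv R k)) = subv (scalev r y) (intv R k).
  by apply: eq_from_tnth => j; rewrite !tnth_mktuple mulN1r.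
have FE : (fun y => f (addv (scalev r y) (scalev (-1) (intv R k))) *
    gaussian_density a (addv (scalev r y) (scalev (-1) (intv R k)))) =
    (fun y => g y * gaussian_density a (subv (scalev r y) (intv R k))).
  by apply/funext => y; rewrite /f E1 E2.
have := Rintegral_affinev (scalev (-1) (intv R k)) r0 ifp; rewrite FE => ->.
by rewrite mulVKf.
Qed.

End moments.

Section linear_statistic_variance.
Context (R : realType) (n : nat) (a r : R) (h : n.-tuple R -> R).
Notation mu := (lebesgue R n).
Notation mu2 := (sfprod (lebesgue R n) (lebesgue R n)).
Hypotheses (a0 : 0 < a) (r0 : 0 < r).
Hypothesis ih : mu.-integrable setT (EFin \o h).
Hypothesis ih2 : mu.-integrable setT (EFin \o (fun x => h x ^+ 2)).

(** The expectation of [g] at the k-th rescaled point, divided by r^n. *)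
Let M (g : n.-tuple R -> R) (k : n.-tuple int) : R :=
  \int[mu]_y (g y * gaussian_density a (subv (scalev r y) (intv R k))).

Let mY : measurable_fun setT (fun y : n.-tuple R => scalev r y).
Proof. exact: measurable_scalev. Qed.

(** The squared mean is a double integral to which [gaussian_density_mul] applies. The factor r^n is
    absorbed by the dilation that turns the density of parameter 2 a at r (y - z) into the one of
    parameter 2 a / r^2 at y - z. *)
Lemma rsum_second_moment :
  rsummable (fun k => M (fun y => h y ^+ 2) k - r ^+ n * M h k ^+ 2) /\
  rsum (fun k => M (fun y => h y ^+ 2) k - r ^+ n * M h k ^+ 2) = variance_sum a r h.
Proof.
have [_ s1 e1] := rsum_gaussian a0 ih2 mY.
have mZ : measurable_fun setT (fun z : n.-tuple R * n.-tuple R => scalev (r / 2) (addv z.1 z.2)).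
  by apply: measurable_scalev; exact: measurable_addv.
have a20 : 0 < a / 2 by rewrite divr_gt0.
have [_ s2 e2] := rsum_gaussian a20 (integrable_smoothed a0 r0 ih) mZ.
have [iM _ _] := rsum_gaussian a0 ih mY.
pose Q k := \int[mu2]_z (h z.1 * h z.2 *
  gaussian_density (2 * (a / r ^+ 2)) (subv z.1 z.2) *
  gaussian_density (a / 2) (subv (scalev (r / 2) (addv z.1 z.2)) (intv R k))).
have QE k : r ^+ n * M h k ^+ 2 = Q k.
  rewrite expr2 /M -(Rintegral_tensor (iM k) (iM k)) -RintegralZl//; last first.
    exact: (integrable_tensor (iM k) (iM k)).
  apply: eq_Rintegral => z _ /=; rewrite mulrACA gaussian_density_mul//.
  rewrite (_ : subv (scalev r z.1) (scalev r z.2) = scalev r (subv z.1 z.2)); last first.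
    by apply: eq_from_tnth => i; rewrite !tnth_mktuple mulrBr.
  rewrite (_ : scalev 2^-1 (addv (scalev r z.1) (scalev r z.2)) = scalev (r / 2) (addv z.1 z.2)); last first.
    by apply: eq_from_tnth => i; rewrite !tnth_mktuple; ring.
  by rewrite mulrA -gaussian_density_scale ?mulr_gt0//; ring.
rewrite (_ : (fun k => _) = (fun k => M (fun y => h y ^+ 2) k - Q k)); last first.
  by apply/funext => k; rewrite QE.
by split; [exact: (rsummableB s1 s2)|rewrite (rsumB s1 s2) e1 e2].
Qed.

Context dT (T : measurableType dT) (P : probability T R)
  (xi : n.-tuple int -> {RV P >-> n.-tuple R}).
Hypothesis xi_indep : mutually_independent xi.
Hypothesis xi_gauss : forall k, has_density mu (xi k) (gaussian_density a).

Lemma variance_linear_statistic :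
  let N := linear_statistic xi h r in
  [/\ {ae P, forall t, rsummable (fun k => h (scaled_point r k (xi k t)))},
      P.-integrable setT (EFin \o N),
      P.-integrable setT (EFin \o (fun t => N t ^+ 2)) &
      \int[P]_t N t ^+ 2 - (\int[P]_t N t) ^+ 2 = r ^+ n * variance_sum a r h].
Proof.
move=> N.
have mom k g (ig : mu.-integrable setT (EFin \o g)) :=
  integrable_scaled_point k a0 r0 (xi_gauss k) ig.
have sumM g : mu.-integrable setT (EFin \o g) ->
    rsummable (fun k => \int[P]_t g (scaled_point r k (xi k t))).
  move=> ig; have [_ s _] := rsum_gaussian a0 ig mY.
  rewrite (_ : (fun k => _) = (fun k => r ^+ n * M g k)); first exact: (rsummableZ _ s).
  by apply/funext => k; rewrite (mom _ _ ig).2.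
have msp k : measurable_fun setT (fun v : n.-tuple R => scaled_point r k v).
  by apply: measurable_scalev; apply: measurable_addv.
have mh := integrable_measurable ih.
have ihn := integrable_norm ih.
have iXX k l : P.-integrable setT (EFin \o (fun t =>
    h (scaled_point r k (xi k t)) * h (scaled_point r l (xi l t)))).
  apply: (integrable_le _ (integrable_scale 2^-1
    (integrable_add (mom k _ ih2).1 (mom l _ ih2).1))).
    by apply: measurable_funM; apply: integrable_measurable; exact: (mom _ _ ih).1.
  by move=> t; have := @normM_le_sqr R (h (scaled_point r k (xi k t))) (h (scaled_point r l (xi l t))) 1; rewrite normr1 mulr1 => ->.
have [| | | | | |sX iN iN2 ->] := @variance_rsum _ T R P (n.-tuple int)
  (fun k t => h (scaled_point r k (xi k t))).
- by move=> k; exact: (mom k _ ih).1.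
- by move=> k; exact: (mom k _ ih2).1.
- move=> k l kl; apply: (indep_mul xi_indep (f := fun v => h (scaled_point r k v))
    (g := fun v => h (scaled_point r l v)) kl).
  + exact: (measurableT_comp mh).
  + exact: (measurableT_comp mh).
  + exact: (mom k _ ih).1.
  + exact: (mom l _ ih).1.
  + exact: iXX.
- move=> k l kl; apply: (indep_mul xi_indep (f := fun v => `|h (scaled_point r k v)|)
    (g := fun v => `|h (scaled_point r l v)|) kl).
  + by apply: measurableT_comp => //; exact: (measurableT_comp mh).
  + by apply: measurableT_comp => //; exact: (measurableT_comp mh).
  + exact: (mom k _ ihn).1.
  + exact: (mom l _ ihn).1.
  + have := integrable_norm (iXX k l); apply: eq_integrable => // t _ /=.
    by rewrite normrM.
- exact: (sumM _ ihn).
- exact: (sumM _ ih2).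
split => //.
(* The second moment carries r^n and the squared mean r^(2 n), so r^n factors out of each
   variance. *)
have [s <-] := rsum_second_moment; rewrite -(rsumZ _ s); congr rsum; apply/funext => k.
by rewrite (mom _ _ ih2).2 (mom _ _ ih).2 -/(M _ k) -/(M _ k); ring.
Qed.

End linear_statistic_variance.

Local Open Scope complex_scope.

Theorem theorem1 (R : realType) (d : nat) (hd : (1 <= d)%N)
    (a r : R) (ha : 0 < a) (hr : 0 < r)
    (dT : measure_display) (T : measurableType dT) (P : probability T R)
    (xi : d.-tuple int -> {RV P >-> d.-tuple R})
    (xi_indep : mutually_independent xi)
    (xi_gauss : forall n, has_density (lebesgue R d) (xi n) (gaussian_density a))
    (h : d.-tuple R -> R)
    (h1 : h \in Lfun (lebesgue R d) 1) (h2 : h \in Lfun (lebesgue R d) 2%:E) :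
  let N : T -> R := linear_statistic xi h r in
  let I (m : d.-tuple int) : R[i] :=
    cintegral (lebesgue R d) (variance_integrand a r h m) in
  [/\ {ae P, forall t, rsummable (fun n => h (scaled_point r n (xi n t)))},
      forall m, cintegrable (lebesgue R d) (variance_integrand a r h m),
      csummable I,
      ('V_P[N] \is a fin_num)%E
    & (fine 'V_P[N])%:C = (r ^+ d)%:C * csum I].
Proof.
move=> N I.
have ih := (Lfun1_integrable _ _).1 h1.
have ih2 := Lfun2_integrable_sqr h2.
have [sN iN iN2 VN] := variance_linear_statistic ha hr ih ih2 xi_indep xi_gauss.
have VE := variance_Rintegral iN iN2; rewrite VN in VE.
have ReE m : @complex.Re R \o variance_integrand a r h m = variance_term a r h 0 m.
  by apply/funext => l; exact: Re_variance_integrand.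
have ImE m : @complex.Im R \o variance_integrand a r h m = variance_term a r h (pi / 2) m.
  by apply/funext => l; exact: Im_variance_integrand.
have [s0 e0] := rsum_variance_term ha hr ih ih2 0.
have [s1 e1] := rsum_variance_term ha hr ih ih2 (pi / 2).
have ReI : @complex.Re R \o I = fun m => \int[lebesgue R d]_l variance_term a r h 0 m l.
  by apply/funext => m; rewrite /I /= ReE.
have ImI : @complex.Im R \o I = fun m => \int[lebesgue R d]_l variance_term a r h (pi / 2) m l.
  by apply/funext => m; rewrite /I /= ImE.
split => //.
- move=> m; rewrite /cintegrable ReE ImE.
  by split; [exact: (variance_term_integral ha hr ih ih2 0 m).1|
    exact: (variance_term_integral ha hr ih ih2 (pi / 2) m).1].
- by rewrite /csummable ReI ImI.
- by rewrite VE.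
(* The imaginary part is cos (pi / 2) times [variance_sum], hence 0. *)
rewrite VE /csum ReI ImI e0 e1 cos0 cos_pihalf mul1r mul0r /=.
by apply/eqP; rewrite eq_complex /= !mulr0 !mul0r subr0 addr0 !eqxx.
Qed.
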